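(* Let $d\geq 2$, let $\psi$ satisfy Assumption (A) below, and let $f\in\operatorname{BV}(\mathbb{R}^d)$ have bounded support. For $\alpha>0$ let $u_{\alpha,0}$ be the unique minimizer of $u\mapsto\int_{\mathbb{R}^d}\psi(u-f)\,dx+\alpha\operatorname{TV}(u)$ over $\operatorname{BV}(\mathbb{R}^d)$. For $s>0$ put $E^s_\alpha=\{u_{\alpha,0}>s\}$, $G^s=\{f>s\}$, and for $s<0$ put $E^s_\alpha=\{u_{\alpha,0}<s\}$, $G^s=\{f<s\}$. Let $s\neq 0$ be such that $|E^s_\alpha\,\Delta\, G^s|\to 0$ as $\alpha\to0$, and such that $$\lim_{\nu\to0}d_H(G^s,G^{s+\nu})=0\quad\text{and}\quad\lim_{\nu\to 0}d_H(\mathbb{R}^d\setminus G^s,\mathbb{R}^d\setminus G^{s+\nu})=0.$$ Then $d_H(\partial E^s_\alpha,\partial G^s)\to 0$ as $\alpha\to 0$.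
   Context: $\operatorname{TV}(u)=\sup\{\int u\,\operatorname{div} z\,dx: z\in C_c^\infty(\mathbb{R}^d;\mathbb{R}^d),\ \|z\|_\infty\leq 1\}$; $\operatorname{BV}(\mathbb{R}^d)=\{u\in L^1_{loc}(\mathbb{R}^d):\operatorname{TV}(u)<\infty\}$. Assumption (A): $\psi:\mathbb{R}\to\mathbb{R}$ is strictly convex, even, $\psi(0)=0$, its Fenchel conjugate $\psi^\ast$ is uniformly convex, and $|\psi(s)|\leq C|s|^{d/(d-1)}$ for some $C>0$. Convention: every measurable set $E$ is identified with the representative whose topological boundary is $\partial E=\{x: 0<|E\cap B(x,r)|/|B(x,r)|<1 \text{ for all } r>0\}$. $d_H(E,F)=\max\{\sup_{x\in E}\operatorname{dist}(x,F),\sup_{y\in F}\operatorname{dist}(y,E)\}$ is the Hausdorff distance. *)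

(* Defs.v *)
From HB Require Import structures.
From mathcomp Require Import all_boot all_order all_algebra.
From mathcomp Require Import all_classical all_reals all_analysis.
Set Implicit Arguments. Unset Strict Implicit. Unset Printing Implicit Defensive.
Import Order.TTheory GRing.Theory Num.Theory numFieldNormedType.Exports.
Local Open Scope classical_set_scope.
Local Open Scope ring_scope.

Section Defs.
Variables (R : realType) (d : nat).
Local Notation V := 'rV[R]_d.

Definition enorm (x : V) : R := Num.sqrt (\sum_(i < d) x ord0 i ^+ 2).
Definition eball (x : V) (r : R) : set V := [set y | enorm (y - x) < r].

Definition box (a b : V) : set V :=
  [set x | forall i, a ord0 i <= x ord0 i <= b ord0 i].
Definition boxes : set (set V) := [set B | exists a b, B = box a b].
Definition Rd := g_sigma_algebraType boxes.

Definition is_lebesgue (lam : {measure set Rd -> \bar R}) : Prop :=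
  forall a b : V, (forall i, a ord0 i <= b ord0 i) ->
    lam (box a b : set Rd) = (\prod_(i < d) (b ord0 i - a ord0 i))%:E.

Fixpoint iterD (W : normedModType R) (vs : seq V) (g : V -> W) : V -> W :=
  match vs with
  | [::] => g
  | v :: vs' => 'D_v (iterD vs' g)
  end.
Definition smooth (W : normedModType R) (g : V -> W) : Prop :=
  forall (vs : seq V) (x : V), differentiable (iterD vs g) x.

Definition divg (z : V -> V) (x : V) : R :=
  \sum_(i < d) 'D_(delta_mx ord0 i) (fun y => z y ord0 i) x.
Definition test_field (z : V -> V) : Prop :=
  [/\ smooth z, compact (closure [set x | z x != 0]) & forall x, enorm (z x) <= 1].

Variable lam : {measure set Rd -> \bar R}.

Definition L1loc (u : V -> R) : Prop :=
  measurable_fun [set: Rd] (u : Rd -> R) /\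
  forall r : R, lam.-integrable (eball 0 r : set Rd) (fun x : Rd => (u x)%:E).

Definition TV (u : V -> R) : \bar R :=
  ereal_sup [set (\int[lam]_(x in [set: Rd]) (u x * divg z x)%:E)%E | z in test_field].

Definition BV (u : V -> R) : Prop := L1loc u /\ (TV u < +oo)%E.

Definition Jfun (psi : R -> R) (f : V -> R) (alpha : R) (u : V -> R) : \bar R :=
  (\int[lam]_(x in [set: Rd]) (psi (u x - f x))%:E + alpha%:E * TV u)%E.
Definition is_minimizer psi f alpha (u : V -> R) : Prop :=
  BV u /\ forall v, BV v -> (Jfun psi f alpha u <= Jfun psi f alpha v)%E.

Definition levelset (g : V -> R) (t : R) : set V :=
  if 0 < t then [set x | t < g x] else [set x | g x < t].

Definition symdiff (A B : set V) : set V := (A `\` B) `|` (B `\` A).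

(** topological boundary of the normalized representative of E:
    x such that 0 < |E cap B(x,r)|/|B(x,r)| < 1 for all r > 0 *)
Definition mboundary (E : set V) : set V :=
  [set x | forall r : R, 0 < r ->
     0 < fine (lam (E `&` eball x r : set Rd)) / fine (lam (eball x r : set Rd)) < 1].

(** closure of the normalized representative of E (Hausdorff distance only
    depends on closures): points x with |E cap B(x,r)| > 0 for all r > 0 *)
Definition msupport (E : set V) : set V :=
  [set x | forall r : R, 0 < r -> (0 < lam (E `&` eball x r : set Rd))%E].

End Defs.

Section Hausdorff.
Variables (R : realType) (d : nat).
Local Notation V := 'rV[R]_d.
Definition edist (x : V) (A : set V) : \bar R :=
  ereal_inf [set (enorm (x - y))%:E | y in A].
(** sup over a set of nonnegative numbers, with sup of the empty set = 0 *)
Definition dH (A B : set V) : \bar R :=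
  maxe (ereal_sup ([set edist x B | x in A] `|` [set 0%E]))
       (ereal_sup ([set edist y A | y in B] `|` [set 0%E])).
End Hausdorff.

Definition fenchel {R : realType} (psi : R -> R) (t : R) : \bar R :=
  ereal_sup [set (s * t - psi s)%:E | s in [set: R]].

Definition strictly_convex {R : realType} (psi : R -> R) : Prop :=
  forall x y l : R, x != y -> 0 < l < 1 ->
    psi (l * x + (1 - l) * y) < l * psi x + (1 - l) * psi y.

Definition uniformly_convex {R : realType} (g : R -> \bar R) : Prop :=
  exists phi : R -> R, (forall t, 0 < t -> 0 < phi t) /\
  forall x y l : R, (0 <= l <= 1)%R ->
    (g (l * x + (1 - l) * y)%R <=
       l%:E * g x + (1 - l)%:E * g y - (l * (1 - l) * phi `|x - y|)%:E)%E.

Definition assumptionA {R : realType} (d : nat) (psi : R -> R) : Prop :=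
  [/\ strictly_convex psi, (forall s, psi (- s) = psi s), psi 0 = 0,
      uniformly_convex (fenchel psi) &
      exists C : R, 0 < C /\ forall s, `|psi s| <= C * (`|s| `^ (d%:R / (d%:R - 1)))].

(* Main.v *)
Require Import Defs.
From HB Require Import structures.
From mathcomp Require Import all_boot all_order all_algebra.
From mathcomp Require Import all_classical all_reals all_analysis.
From mathcomp Require Import measurable_realfun.
From mathcomp Require Import ring lra.
Import Order.TTheory GRing.Theory Num.Theory numFieldNormedType.Exports.
Local Open Scope classical_set_scope.
Local Open Scope ring_scope.
Set Implicit Arguments. Unset Strict Implicit. Unset Printing Implicit Defensive.

(** Let [u] minimize and suppose [f <= s - nu] a.e. on a ball. The competitor
    [v = u - w], with [w = chi * k (u - s)], [chi] a radial cutoff of the ball and [k] a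
    smooth convex replacement of the positive part, satisfies
    [TV v <= TV u + int (w * div z)], where [z] is a radial field with [|z| <= 1] that
    calibrates [chi], i.e. [z . grad chi = - |grad chi|]. On the other hand
    [psi (u - f) - psi (v - f) >= (psi nu / nu) * w], so minimality gives
    [(psi nu / nu) * int w <= alpha * sup (div z) * int w], and [w = 0] as soon as
    [alpha] is small, uniformly in the centre of the ball. Hence [u <= s] near every
    point at distance [rho] from the level set of [f] (the Hausdorff hypotheses
    provide [nu]); the symmetric statement holds inside. This puts the boundary of the
    level set of [u] near that of [f]; the reverse inclusion follows from
    [|E Delta G| -> 0], compactness and the connectedness of balls.

    The inequality for [TV v] is proved for mollifications of [u]. If [Z] is continuous
    with compact support and [|Z| <= 1] then, by Fubini,
    [- int Z . grad (u * eta) = int u div (Z * eta) <= TV u]. It is applied to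
    [Z = (1 - a) zeta - a z] with [a = chi * k'], [zeta] being the test field for [v];
    one then passes to the limit using the [L^1] continuity of translations. *)

(** * Euclidean norm *)

Section Euclid.
Variables (R : realType) (d : nat).
Local Notation V := 'rV[R]_d.
Implicit Types x y z : V.

(** Total variation is given only as a supremum over smooth test fields, so [u] has no gradient that
    could be cut at the level [s]. This is why the competitor depends on [u] through a C1 function
    [k] with [0 <= k' <= 1]: on mollifications [U] of [u] the chain rule applies, and its outcome is
    expressed by a single field of norm at most 1, against which [TV u] can be tested. That field is
    forced: [Z] is the coefficient of [grad U] in [zeta . grad (U - w) - z . grad w]. The remaining
    term carries [grad chi] and has a sign because [z] calibrates [chi]; an uncalibrated cutoff
    would leave [int k |grad chi|], which no multiple of [int w] absorbs near the edge of the
    support of [chi]. The factor [psi nu / nu] comes from the monotonicity of [psi t / t] for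
    [t > 0]. Gain and loss are multiples of the same [int w], so the comparison yields [w = 0] and
    not mere smallness, with a threshold on [alpha] that depends only on [d], [psi], [nu] and the
    radius. *)

Definition dot x y : R := \sum_(i < d) x ord0 i * y ord0 i.

Lemma dotC x y : dot x y = dot y x.
Proof. by apply: eq_bigr => i _; rewrite mulrC. Qed.

Lemma dotDl x y z : dot (x + y) z = dot x z + dot y z.
Proof. by rewrite -big_split; apply: eq_bigr => i _; rewrite mxE mulrDl. Qed.

Lemma dotZl a x y : dot (a *: x) y = a * dot x y.
Proof. by rewrite mulr_sumr; apply: eq_bigr => i _; rewrite mxE mulrA. Qed.

Lemma dotDr x y z : dot x (y + z) = dot x y + dot x z.
Proof. by rewrite dotC dotDl !(dotC x). Qed.

Lemma dotZr a x y : dot x (a *: y) = a * dot x y.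
Proof. by rewrite dotC dotZl dotC. Qed.

Lemma dotNl x y : dot (- x) y = - dot x y.
Proof. by rewrite -scaleN1r dotZl mulN1r. Qed.

Lemma dotNr x y : dot x (- y) = - dot x y.
Proof. by rewrite -scaleN1r dotZr mulN1r. Qed.

Lemma dot_ge0 x : 0 <= dot x x.
Proof. by apply: sumr_ge0 => i _; rewrite -expr2 sqr_ge0. Qed.

Lemma enormE x : enorm x = Num.sqrt (dot x x).
Proof. by congr Num.sqrt; apply: eq_bigr => i _; rewrite expr2. Qed.

Lemma enorm_ge0 x : 0 <= enorm x. Proof. exact: sqrtr_ge0. Qed.

Lemma enorm_sqr x : enorm x ^+ 2 = dot x x.
Proof. by rewrite enormE sqr_sqrtr// dot_ge0. Qed.

Lemma enorm_le x (r : R) : 0 <= r -> (enorm x <= r) = (dot x x <= r ^+ 2).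
Proof. by move=> r0; rewrite -enorm_sqr ler_sqr ?nnegrE// enorm_ge0. Qed.

Lemma enorm_lt x (r : R) : 0 <= r -> (enorm x < r) = (dot x x < r ^+ 2).
Proof. by move=> r0; rewrite -enorm_sqr ltr_sqr ?nnegrE// enorm_ge0. Qed.

Lemma dot_CS_sqr x y : dot x y ^+ 2 <= dot x x * dot y y.
Proof.
have [y0|y0] := eqVneq (dot y y) 0.
  have /eqP : dot y y = 0 by [].
  rewrite /dot psumr_eq0 => [/allP h|i _]; last by rewrite -expr2 sqr_ge0.
  have yi i : y ord0 i = 0.
    by have := h i (mem_index_enum _); rewrite mulf_eq0 orbb => /eqP.
  by rewrite big1 ?expr0n ?mulr_ge0 ?dot_ge0// => i _; rewrite yi mulr0.
have ypos : 0 < dot y y by rewrite lt_neqAle eq_sym y0 dot_ge0.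
(* This vector is [y . y] times the component of [x] orthogonal to [y]; its squared norm is
   [c * (a * c - b ^+ 2)] in the notation below. *)
have := dot_ge0 (dot y y *: x - dot x y *: y).
rewrite dotDl !dotDr !dotNl !dotNr !dotZl !dotZr (dotC y x).
set a := dot x x; set b := dot x y; set c := dot y y => h.
have : 0 <= c * (a * c - b ^+ 2) by rewrite (le_trans h)//; nra.
by rewrite pmulr_rge0// subr_ge0.
Qed.

Lemma dot_CS x y : `|dot x y| <= enorm x * enorm y.
Proof.
rewrite -ler_sqr ?nnegrE ?mulr_ge0 ?enorm_ge0//.
by rewrite real_normK ?num_real// exprMn !enorm_sqr dot_CS_sqr.
Qed.

Lemma enormD x y : enorm (x + y) <= enorm x + enorm y.
Proof.
rewrite enorm_le ?addr_ge0 ?enorm_ge0// sqrrD !enorm_sqr dotDl !dotDr (dotC y x).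
have := le_trans (ler_norm _) (dot_CS x y); lra.
Qed.

Lemma enormZ a x : enorm (a *: x) = `|a| * enorm x.
Proof. by rewrite !enormE dotZl dotZr mulrA -expr2 sqrtrM ?sqr_ge0// sqrtr_sqr. Qed.

Lemma enormN x : enorm (- x) = enorm x.
Proof. by rewrite -scaleN1r enormZ normrN1 mul1r. Qed.

Lemma enorm0 : enorm (0 : V) = 0.
Proof. by rewrite -(scale0r (0 : V)) enormZ normr0 mul0r. Qed.

Lemma enormB x y : enorm (x - y) = enorm (y - x).
Proof. by rewrite -enormN opprB. Qed.

Lemma coord_le_norm x i : `|x ord0 i| <= `|x|.
Proof.
rewrite [leRHS]/Num.Def.normr/= mx_normrE.
by apply: le_trans; last exact: (le_bigmax _ _ (ord0, i)).
Qed.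

Lemma norm_leP x (r : R) : 0 <= r -> (forall i, `|x ord0 i| <= r) -> `|x| <= r.
Proof.
move=> r0 h; rewrite [leLHS]/Num.Def.normr/= mx_normrE; apply: bigmax_le => //.
by move=> [i j] _ /=; rewrite (ord1 i).
Qed.

(** The topology of row vectors comes from the sup norm [|x|], while balls, fields and distances are
    Euclidean. This bound and the next one pass between the two; the constant [d] of the latter is
    crude, which does no harm. *)
Lemma norm_le_enorm x : `|x| <= enorm x.
Proof.
apply: norm_leP => [|i]; first exact: enorm_ge0.
rewrite -ler_sqr ?nnegrE ?enorm_ge0// enorm_sqr real_normK ?num_real//.
rewrite /dot (bigD1 i)//= expr2 lerDl sumr_ge0// => j _.
by rewrite -expr2 sqr_ge0.
Qed.

Lemma enorm_le_norm x : enorm x <= d%:R * `|x|.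
Proof.
rewrite enorm_le ?mulr_ge0//; case: (posnP d) => [d0|d0].
  rewrite /dot big1 ?sqr_ge0// => i _; have := ltn_ord i; by rewrite {2}d0.
apply: (@le_trans _ _ (\sum_(i < d) `|x| ^+ 2)).
  apply: ler_sum => i _; rewrite -expr2 -real_normK ?num_real//.
  by rewrite ler_sqr ?nnegrE// coord_le_norm.
rewrite sumr_const card_ord exprMn -[leLHS]mulr_natl ler_wpM2r ?sqr_ge0//.
by rewrite -natrX ler_nat -{1}(expn1 d) leq_pexp2l.
Qed.

Lemma continuous_coord i : continuous (fun x : V => x ord0 i).
Proof.
by move=> x; exact: (@differentiable_continuous _ _ _ _ (fun y : V => y ord0 i)
  (@differentiable_coord R _ _ x ord0 i)).
Qed.

Lemma near_norm_lt x (e : R) : 0 < e -> \forall y \near x, `|x - y| < e.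
Proof.
move=> e0; have := @nbhsx_ballx _ V x e e0; apply: filterS => y.
by rewrite mx_norm_ball.
Qed.

Lemma near_normP x (P : set V) :
  (\forall y \near x, P y) -> exists2 e : R, 0 < e & forall y, `|x - y| < e -> P y.
Proof.
move=> /nbhs_ballP[e /= e0 h]; exists e => // y xy; apply: h.
by rewrite mx_norm_ball.
Qed.

Lemma continuous_epsP (f : V -> R) x :
  {for x, continuous f} <->
  forall e : R, 0 < e -> exists2 h : R, 0 < h & forall y, `|x - y| < h -> `|f x - f y| < e.
Proof.
split=> [fx e e0|h].
  by apply: near_normP; exact: (@cvgr_dist_lt _ R^o V (nbhs x) _ f (f x) fx e e0).
apply/(@cvgrPdist_lt _ R^o V (nbhs x)) => e /h[r r0 {}h].
by apply: filterS (near_norm_lt x r0).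
Qed.

Lemma enorm_lip x y : `|enorm x - enorm y| <= enorm (x - y).
Proof.
rewrite ler_norml.
have h1 : enorm x <= enorm (x - y) + enorm y by rewrite -{1}(subrK y x) enormD.
have h2 : enorm y <= enorm (x - y) + enorm x.
  by rewrite enormB -{1}(subrK x y) enormD.
by apply/andP; split; lra.
Qed.

Lemma continuous_enormB x : continuous (fun y : V => enorm (y - x)).
Proof.
move=> y; apply/continuous_epsP => e e0.
have d1 : 0 < d%:R + 1 :> R by rewrite ltr_wpDl.
exists (e / (d%:R + 1)) => [|z yz]; first by rewrite divr_gt0.
apply: (le_lt_trans (enorm_lip _ _)); rewrite opprB addrA subrK.
apply: le_lt_trans (enorm_le_norm _) _.
apply: (@le_lt_trans _ _ ((d%:R + 1) * `|y - z|)).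
  by rewrite ler_wpM2r// lerDl.
by rewrite mulrC -ltr_pdivlMr.
Qed.

Lemma open_eball x r : open (eball x r).
Proof.
have -> : eball x r = (fun y => enorm (y - x)) @^-1` [set t | t < r] by [].
by apply: open_comp; [move=> y _; exact: continuous_enormB|exact: open_lt].
Qed.

Lemma eball_center x r : 0 < r -> eball x r x.
Proof. by move=> r0; rewrite /eball/= subrr enorm0. Qed.

Lemma nbhs_eball x r : 0 < r -> nbhs x (eball x r).
Proof. by move=> r0; apply: open_nbhs_nbhs; split; [exact: open_eball|exact: eball_center]. Qed.

Lemma eball_sub x y (r r' : R) : enorm (x - y) + r <= r' -> eball x r `<=` eball y r'.
Proof.
move=> h z /= zx; apply: lt_le_trans h.
rewrite -(subrKA x) (le_lt_trans (enormD _ _))// addrC ltrD2l//.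
Qed.

End Euclid.

(** * Borel sets and Lebesgue measure *)

Section Borel.
Variables (R : realType) (d : nat).
Local Notation V := 'rV[R]_d.
Local Notation T := (Rd R d).
Implicit Types x y z a b : V.

Lemma measurable_box a b : measurable (box a b : set T).
Proof. by apply: sub_sigma_algebra; exists a, b. Qed.

(** A countable family indexed by [nat] through pickling, so that countable unions apply. The boxes
    are closed, hence measurable by definition of the sigma-algebra. *)
Definition ratbox (n : nat) : set V :=
  if unpickle n is Some p then
    box (map_mx ratr (p : 'rV[rat]_d * 'rV[rat]_d).1) (map_mx ratr p.2)
  else set0.

Lemma measurable_ratbox n : measurable (ratbox n : set T).
Proof. by rewrite /ratbox; case: unpickle => [p|]; [exact: measurable_box|exact: measurable0]. Qed.

Lemma ratbox_nbhs x (A : set V) : nbhs x A -> exists n, ratbox n x /\ ratbox n `<=` A.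
Proof.
move=> /near_normP[e e0 eA].
have e2 : 0 < e / 2 by rewrite divr_gt0.
have ha i : exists q : rat, x ord0 i - e / 2 < ratr q < x ord0 i.
  have h : x ord0 i - e / 2 < x ord0 i by rewrite ltrBlDr ltrDl.
  by have [q] := rat_in_itvoo h; rewrite in_itv/= => ?; exists q.
have hb i : exists q : rat, x ord0 i < ratr q < x ord0 i + e / 2.
  have h : x ord0 i < x ord0 i + e / 2 by rewrite ltrDl.
  by have [q] := rat_in_itvoo h; rewrite in_itv/= => ?; exists q.
have [qa qaP] := choice ha; have [qb qbP] := choice hb.
exists (pickle (\row_i qa i : 'rV[rat]_d, \row_i qb i : 'rV[rat]_d)).
rewrite /ratbox pickleK /=; split.
  move=> i; rewrite !mxE.
  by have /andP[_ /ltW ->] := qaP i; have /andP[/ltW -> _] := qbP i.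
move=> y yb; apply: eA; apply: (@le_lt_trans _ _ (e / 2)); last by lra.
apply: norm_leP => [|i]; first exact: ltW.
have := yb i; rewrite !mxE ler_norml => /andP[].
have /andP[] := qaP i; have /andP[] := qbP i => *; apply/andP; split; lra.
Qed.

Lemma measurable_open (A : set V) : open A -> measurable (A : set T).
Proof.
move=> oA.
have -> : A = \bigcup_n (if `[< ratbox n `<=` A >] then ratbox n else set0).
  apply/seteqP; split=> [x Ax|x [n _]]; last first.
    by case: asboolP => // h; exact: h.
  have [n [nx nA]] := ratbox_nbhs (open_nbhs_nbhs (conj oA Ax)).
  by exists n => //; case: asboolP.
apply: bigcupT_measurable => n; case: asboolP => _.
  exact: measurable_ratbox.
exact: measurable0.
Qed.

Lemma measurable_eball x r : measurable (eball x r : set T).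
Proof. by apply: measurable_open; exact: open_eball. Qed.

Lemma measurable_continuous (g : V -> R) : continuous g ->
  measurable_fun [set: T] (g : T -> R).
Proof.
move=> cg; apply: (measurability _ (RGenOInfty.measurableE R)) => _ [_ [a ->] <-].
rewrite setTI; apply: measurable_open; apply: open_comp; last exact: interval_open.
by move=> x _; exact: cg.
Qed.

Lemma measurable_coord i : measurable_fun [set: T] (fun x : T => (x : V) ord0 i).
Proof. by apply: measurable_continuous; exact: continuous_coord. Qed.

Lemma measurable_to_Rd d' (S : measurableType d') (g : S -> V) :
  (forall i, measurable_fun [set: S] (fun t => g t ord0 i)) ->
  measurable_fun [set: S] (g : S -> T).
Proof.
move=> mg; apply: (@measurability _ _ S T setT g (@boxes R d) erefl) => _ [_ [a [b ->]] <-].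
rewrite setTI.
have -> : g @^-1` box a b =
    \bigcap_(i in [set: 'I_d]) ((fun t => g t ord0 i) @^-1` `[a ord0 i, b ord0 i]%classic).
  apply/seteqP; split=> [t h i _|t h i] /=.
    by have := h i; rewrite in_itv.
  by have := h i I; rewrite /= in_itv.
apply: fin_bigcap_measurable => [|i _]; first exact: finite_finset.
rewrite -[X in measurable X]setTI.
by apply: mg => //; exact: measurable_itv.
Qed.

Lemma measurable_shift a : measurable_fun [set: T] ((fun x => x + a) : T -> T).
Proof.
apply: measurable_to_Rd => i; under eq_fun do rewrite mxE.
by apply: measurable_funD => //; exact: measurable_coord.
Qed.

Lemma measurable_subr : measurable_fun [set: T * T] ((fun p => p.1 - p.2) : T * T -> T).
Proof.
apply: measurable_to_Rd => i; under eq_fun do rewrite !mxE.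
by apply: measurable_funB; apply: measurableT_comp (measurable_coord i) _.
Qed.

Lemma measurable_addr : measurable_fun [set: T * T] ((fun p => p.1 + p.2) : T * T -> T).
Proof.
apply: measurable_to_Rd => i; under eq_fun do rewrite !mxE.
by apply: measurable_funD; apply: measurableT_comp (measurable_coord i) _.
Qed.

End Borel.

(** * Lebesgue measure: null sets, translation invariance, Fubini *)

Section Lebesgue.
Variables (R : realType) (d : nat).
Local Notation V := 'rV[R]_d.
Local Notation T := (Rd R d).
Variable lam : {measure set T -> \bar R}.
Implicit Types x y z a b : V.

(* The space is second countable: the boxes with rational vertices form a base. *)
Lemma null_local (E A : set V) : measurable (E : set T) -> measurable (A : set T) ->
  (forall y, A y -> exists2 r, 0 < r & lam (E `&` eball y r : set T) = 0%E) ->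
  lam (E `&` A : set T) = 0%E.
Proof.
move=> mE mA h.
pose F n : set T := if `[< lam (E `&` ratbox n : set T) = 0%E >] then E `&` ratbox n else set0.
have F0 n : lam.-negligible (F n).
  rewrite /F; case: asboolP => [h0|_]; last exact: negligible_set0.
  by apply/negligibleP => //; apply: measurableI => //; exact: measurable_ratbox.
have [N [mN N0 FN]] := negligible_bigcup F0.
apply/eqP; rewrite eq_le measure_ge0 andbT -N0 le_measure ?inE//.
  exact: measurableI.
move=> y [Ey Ay]; apply: FN; have [r r0 hr] := h _ Ay.
have [n [ny nr]] := ratbox_nbhs (nbhs_eball y r0).
exists n => //; rewrite /F; case: asboolP => // -[].
apply/eqP; rewrite eq_le measure_ge0 andbT -hr le_measure ?inE//.
- by apply: measurableI => //; exact: measurable_ratbox.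
- by apply: measurableI => //; exact: measurable_eball.
- exact: setIS.
Qed.

Hypothesis hlam : is_lebesgue lam.

(** [is_lebesgue] prescribes the volume only for ordered vertices. The positive parts extend the
    formula to all pairs of vertices, as intersections of boxes require. *)
Lemma lam_box a b :
  lam (box a b : set T) = (\prod_(i < d) Num.max 0 (b ord0 i - a ord0 i))%:E.
Proof.
have [h|/existsNP[i /negP]] := pselect (forall i, a ord0 i <= b ord0 i).
  rewrite hlam//; congr (_%:E); apply: eq_bigr => i _.
  by rewrite max_r// subr_ge0.
rewrite -ltNge => ba; have -> : box a b = set0.
  rewrite -subset0 => x /(_ i)/andP[h1 h2].
  by have := le_trans h1 h2; rewrite leNgt ba.
by rewrite measure0 (bigD1 i)//= max_l ?mul0r// subr_le0 ltW.
Qed.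

(** For [M >= 0] this is the closed sup-norm ball. Cubes are themselves generators, have finite
    measure and exhaust the space. *)
Definition cube (M : R) : set V := box (const_mx (- M)) (const_mx M).

Lemma cubeP M x : 0 <= M -> cube M x <-> `|x| <= M.
Proof.
move=> M0; split=> [h|h i].
  by apply: norm_leP => // i; have := h i; rewrite !mxE ler_norml.
by rewrite !mxE -ler_norml; apply: le_trans h; exact: coord_le_norm.
Qed.

Lemma measurable_cube M : measurable (cube M : set T).
Proof. exact: measurable_box. Qed.

Lemma lam_cube_lty M : (lam (cube M : set T) < +oo)%E.
Proof. by rewrite lam_box ltry. Qed.

Lemma lam_bounded_lty (A : set V) (M : R) : measurable (A : set T) ->
  (forall x, A x -> `|x| <= M) -> (lam (A : set T) < +oo)%E.
Proof.
move=> mA AM; apply: (le_lt_trans _ (lam_cube_lty (Num.max 0 M))).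
apply: le_measure; rewrite ?inE//; first exact: measurable_cube.
by move=> x /AM xM; apply/cubeP; rewrite ?le_max ?lexx ?xM ?orbT.
Qed.

Lemma lam_eball_lty x r : (lam (eball x r : set T) < +oo)%E.
Proof.
apply: (@lam_bounded_lty _ (`|x| + r)); first exact: measurable_eball.
move=> y /= /ltW yx; rewrite -[y](subrK x) (le_trans (ler_normD _ _))// addrC.
by rewrite lerD2l (le_trans (norm_le_enorm _)).
Qed.

Lemma lam_open_gt0 x (A : set V) : measurable (A : set T) ->
  nbhs x A -> (0 < lam (A : set T))%E.
Proof.
move=> mA /near_normP[e e0 eA].
have e2 : 0 < e / 2 by rewrite divr_gt0.
pose B := box (x - const_mx (e / 2)) (x + const_mx (e / 2)).
apply: (@lt_le_trans _ _ (lam (B : set T))).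
  rewrite lam_box lte_fin; apply: prodr_gt0 => i _.
  by rewrite !mxE lt_max; apply/orP; right; lra.
apply: le_measure; rewrite ?inE//; first exact: measurable_box.
move=> y By; apply: eA; apply: (@le_lt_trans _ _ (e / 2)); last lra.
apply: norm_leP => [|i]; first exact: ltW.
by have := By i; rewrite !mxE ler_norml => /andP[h1 h2]; apply/andP; split; lra.
Qed.

Lemma lam_eball_gt0 x r : 0 < r -> (0 < lam (eball x r : set T))%E.
Proof.
by move=> r0; apply: (@lam_open_gt0 x); [exact: measurable_eball|exact: nbhs_eball].
Qed.

Lemma setI_closed_boxes : setI_closed (@boxes R d).
Proof.
move=> _ _ [a [b ->]] [a' [b' ->]].
exists (\row_i Num.max (a ord0 i) (a' ord0 i)), (\row_i Num.min (b ord0 i) (b' ord0 i)).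
apply/seteqP; split=> [x [h h'] i|x h].
  by rewrite !mxE ge_max le_min; case/andP: (h i) => -> ->; case/andP: (h' i) => -> ->.
by split=> i; have := h i; rewrite !mxE ge_max le_min => /andP[/andP[h1 h2] /andP[h3 h4]]; apply/andP.
Qed.

Lemma bigcup_cube : \bigcup_k (cube k%:R) = [set: V].
Proof.
rewrite -subTset => x _; exists (Num.truncn `|x|).+1 => //.
by apply/cubeP => //; apply: ltW; rewrite truncnS_gt.
Qed.

(** The translated measure agrees with [lam] on boxes, which form a generating pi-system containing
    an exhaustion of finite measure; uniqueness of measures does the rest. *)
Lemma lam_shift a (A : set V) : measurable (A : set T) ->
  lam ((fun x => x + a) @^-1` A : set T) = lam (A : set T).
Proof.
move=> mA; pose mu := pushforward lam ((fun x => x + a) : T -> T).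
have mu_box b c : mu (box b c) = lam (box b c : set T).
  have -> : mu (box b c) = lam (box (b - a) (c - a) : set T).
    congr (lam _); apply/seteqP; split=> x /= h i; have := h i; rewrite !mxE;
    by rewrite lerBlDr lerBrDr.
  by rewrite !lam_box; congr (_%:E); apply: eq_bigr => i _; rewrite !mxE opprB addrA subrK.
apply/esym; apply: (@measure_unique _ R T (@boxes R d) (fun k => cube k%:R) erefl
  setI_closed_boxes _ bigcup_cube lam
  (@measure_function_pushforward__canonical__measure_function_Measure _ _ _ _ _ lam _ (measurable_shift a))) => //.
- by move=> i; exists (const_mx (- i%:R)), (const_mx i%:R).
- by move=> _ [b [c ->]]; rewrite -mu_box.
- by move=> k; exact: lam_cube_lty.
Qed.

Lemma ge0_integral_shift a (g : V -> \bar R) :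
  measurable_fun [set: T] (g : T -> \bar R) -> (forall x, (0 <= g x)%E) ->
  (\int[lam]_(x in [set: T]) g (x + a)%R = \int[lam]_(x in [set: T]) g x)%E.
Proof.
move=> mg g0.
have := @ge0_integral_pushforward _ _ T T R _ (measurable_shift a) lam setT g
  measurableT mg (fun y _ => g0 y).
rewrite preimage_setT => <-.
by apply: eq_measure_integral => [|mT A mA _]; [exact: measurable_shift|exact: lam_shift].
Qed.

Notation itg g := (lam.-integrable [set: T] (EFin \o (g : T -> R))).
Notation "'Int' g" := (Rintegral lam [set: T] (g : T -> R)) (at level 10, g at level 8).

Lemma itg_measurable (g : V -> R) : itg g -> measurable_fun [set: T] (g : T -> R).
Proof. by move=> /measurable_int/measurable_EFinP. Qed.

Lemma itg_shift a (g : V -> R) : itg g -> itg (fun x => g (x + a)).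
Proof.
move=> ig; have mg := itg_measurable ig; apply/integrableP; split.
  apply/measurable_EFinP.
  exact: (measurableT_comp mg (measurable_shift a)).
case/integrableP: ig => _; rewrite -(ge0_integral_shift a)//.
by apply: measurableT_comp => //; exact/measurable_EFinP.
Qed.

Lemma Int_shift a (g : V -> R) : itg g -> Int (fun x => g (x + a)) = Int g.
Proof.
move=> ig; have mg := itg_measurable ig.
have := @integral_pushforward _ _ T T R _ (measurable_shift a) lam setT (EFin \o (g : T -> R))
  ((measurable_EFinP _ _).2 mg) (itg_shift a ig) measurableT.
rewrite preimage_setT /Rintegral => <-; congr fine.
by apply: eq_measure_integral => [|mT A mA _]; [exact: measurable_shift|exact: lam_shift].
Qed.

Lemma sigma_finite_lam : sigma_finite [set: T] lam.
Proof.
exists (fun k => cube k%:R : set T); first by rewrite bigcup_cube.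
by move=> k; split; [exact: measurable_cube|exact: lam_cube_lty].
Qed.

(** The product-measure theorems take a bundled sigma-finite measure. The equality lets [lam] be
    replaced by such a bundle inside a goal. *)
Lemma sigma_finite_pack : exists mu : {sigma_finite_measure set T -> \bar R},
  (mu : {measure set T -> \bar R}) = lam.
Proof.
have := sigma_finite_lam; clear hlam; case: lam => m [c1 c2] sf.
pose mu0 : {measure set T -> \bar R} := Measure.Pack (Measure.Class c2).
pose m3 := Measure_isSigmaFinite.Build _ T R mu0 sf.
pose mu : {sigma_finite_measure set T -> \bar R} := HB.pack m c1 c2 m3.
by exists mu.
Qed.

Lemma tonelli (F : V -> V -> \bar R) :
  measurable_fun [set: T * T] (fun p : T * T => F p.1 p.2) ->
  (forall x y, 0 <= F x y)%E ->
  (\int[lam]_(x in [set: T]) \int[lam]_(y in [set: T]) F x y =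
   \int[lam]_(y in [set: T]) \int[lam]_(x in [set: T]) F x y)%E.
Proof.
move=> mF F0; have [mu mulam] := sigma_finite_pack; rewrite -mulam.
exact: (@fubini_tonelli _ _ T T R mu mu (fun p => F p.1 p.2)).
Qed.

Lemma measurable_tonelli (F : V -> V -> \bar R) :
  measurable_fun [set: T * T] (fun p : T * T => F p.1 p.2) ->
  (forall x y, 0 <= F x y)%E ->
  measurable_fun [set: T] (fun x : T => \int[lam]_(y in [set: T]) F x y)%E.
Proof.
move=> mF F0; have [mu mulam] := sigma_finite_pack; rewrite -mulam.
exact: (@measurable_fun_fubini_tonelli_F _ _ T T R mu (fun p => F p.1 p.2)).
Qed.

(** An integrable majorant [h] of the inner absolute integrals gives integrability on the product by
    Tonelli, in the form in which it is checked for convolutions. *)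
Lemma fubini_Int (F : V -> V -> R) (h : V -> R) :
  measurable_fun [set: T * T] (fun p : T * T => F p.1 p.2) ->
  (forall x, itg (F x)) -> (forall y, itg (fun x => F x y)) ->
  itg h -> (forall x, Int (fun y => `|F x y|) <= h x) ->
  Int (fun x => Int (F x)) = Int (fun y => Int (fun x => F x y)).
Proof.
move=> mF F1 F2 ih Fh.
have mF' := (measurable_EFinP _ _).2 mF.
have [mu mulam] := sigma_finite_pack.
have fin : (\int[lam]_(x in [set: T]) \int[lam]_(y in [set: T]) `|(F x y)%:E| < +oo)%E.
  apply: (@le_lt_trans _ _ (\int[lam]_(x in [set: T]) (h x)%:E)%E).
    apply: ge0_le_integral => //.
    - by move=> x _; exact: integral_ge0.
    - apply: (@measurable_tonelli (fun x y => `|(F x y)%:E|%E)) => //.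
      by apply: measurableT_comp.
    - exact: (measurable_int lam).
    - move=> x _; rewrite -[leLHS]fineK; first by rewrite lee_fin Fh.
      exact: (integrable_fin_num measurableT (integrable_abse (F1 x))).
  by rewrite integrable_lty.
have fb : (\int[lam]_(x in [set: T]) \int[lam]_(y in [set: T]) (F x y)%:E =
           \int[lam]_(y in [set: T]) \int[lam]_(x in [set: T]) (F x y)%:E)%E.
  rewrite -mulam in fin *.
  exact: (@Fubini _ _ T T R mu mu (fun p => (F p.1 p.2)%:E)
    ((integrable12ltyP _ _ mF').2 fin)).
rewrite /Rintegral; congr fine.
rewrite -[LHS](_ : (\int[lam]_x \int[lam]_y (F x y)%:E)%E = _); last first.
  apply: eq_integral => x _; rewrite fineK//.
  exact: (integrable_fin_num measurableT (F1 x)).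
rewrite -[RHS](_ : (\int[lam]_y \int[lam]_x (F x y)%:E)%E = _)//.
apply: eq_integral => x _; rewrite fineK//.
exact: (integrable_fin_num measurableT (F2 x)).
Qed.

End Lebesgue.

(** * Differential calculus and convolution *)

Section Calculus.
Variables (R : realType) (d : nat).
Local Notation V := 'rV[R]_d.
Implicit Types (x y z h v : V) (g F : V -> R).

Definition ebase (i : 'I_d) : V := delta_mx ord0 i.

Lemma row_sum_ebase v : v = \sum_i v ord0 i *: ebase i.
Proof. by rewrite {1}[v]row_sum_delta. Qed.

Lemma continuous_dot v : continuous (dot v).
Proof.
move=> x; apply/continuous_epsP => e e0.
have c0 : 0 < enorm v * d%:R + 1 by rewrite ltr_wpDl// mulr_ge0// enorm_ge0.
exists (e / (enorm v * d%:R + 1)) => [|y xy]; first by rewrite divr_gt0.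
rewrite -dotNr -dotDr (le_lt_trans (dot_CS _ _))//.
apply: (@le_lt_trans _ _ ((enorm v * d%:R + 1) * `|x - y|)).
  rewrite mulrDl mul1r -mulrA ler_wpDr// ler_wpM2l ?enorm_ge0//.
  exact: enorm_le_norm.
by rewrite mulrC -ltr_pdivlMr.
Qed.

Lemma dot_is_linear v : linear (dot v).
Proof. by move=> a x y; rewrite dotDr dotZr. Qed.

HB.instance Definition _ v := GRing.isLinear.Build R V R *:%R (dot v) (dot_is_linear v).

(** A remainder bounded by [C * |h|^2] is [o(h)], so the linear part is the differential. Squared
    distances, coordinates and convolutions are all differentiated this way. *)
Lemma diff_quad F x v (C : R) :
  (forall h, `|h| <= 1 -> `|F (x + h) - F x - dot v h| <= C * `|h| ^+ 2) ->
  differentiable F x /\ forall h, 'D_h F x = dot v h.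
Proof.
move=> hF.
have E : F \o shift x = cst (F x) + (dot v : V -> R) +o_ (0 : V) id.
  apply/eqaddoP => e e0.
  have r0 : 0 < Num.min 1 (e / (`|C| + 1)).
    by rewrite lt_min ltr01 divr_gt0// ltr_wpDl.
  apply: filterS (near_norm_lt (0 : V) r0) => h.
  rewrite sub0r normrN lt_min => /andP[h1 he].
  rewrite /= !fctE /= opprD addrA (addrC h x).
  apply: (le_trans (hF _ (ltW h1))).
  rewrite expr2 mulrA ler_wpM2r//.
  apply: (@le_trans _ _ ((`|C| + 1) * `|h|)).
    by rewrite ler_wpM2r// (le_trans (ler_norm _))// lerDl.
  by rewrite mulrC -ler_pdivlMr ?ltr_wpDl// ltW.
have dE := diff_unique (@continuous_dot v) E.
have dF : differentiable F x.
  by apply/diff_locallyP; rewrite dE; split; [exact: continuous_dot|exact: E].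
by split=> // h; rewrite deriveE// dE.
Qed.

Lemma derive_lin F x : differentiable F x -> forall v, 
  'D_v F x = \sum_i v ord0 i * 'D_(ebase i) F x.
Proof.
move=> dF v; rewrite deriveE// {1}[v]row_sum_ebase linear_sum.
by apply: eq_bigr => i _; rewrite linearZ/= deriveE.
Qed.

Lemma deriveZv F x : differentiable F x -> forall (a : R) v, 
  'D_(a *: v) F x = a * 'D_v F x.
Proof. by move=> dF a v; rewrite !deriveE// linearZ. Qed.

Lemma is_derive_line F x h (t : R) : differentiable F (t *: h + x) ->
  is_derive t 1 (fun s : R => F (s *: h + x)) ('D_h F (t *: h + x)).
Proof.
move=> /diff_derivable dF.
have E : (fun k : R => k^-1 *: (F ((k *: (1 : R^o) + t) *: h + x) - F (t *: h + x))) =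
         (fun k : R => k^-1 *: (F (k *: h + (t *: h + x)) - F (t *: h + x))).
  by apply/funext => k; rewrite [k *: 1]mulr1 scalerDl addrA.
apply: DeriveDef; last by rewrite /derive E.
by have := dF h; rewrite /derivable E.
Qed.

Lemma MVT_line F x h : (forall y, differentiable F y) ->
  exists2 t : R, 0 <= t <= 1 & F (x + h) - F x = 'D_h F (x + t *: h).
Proof.
move=> dF.
have [t _||t + E] := @MVT_segment R (fun s : R => F (s *: h + x))
   (fun s : R => 'D_h F (s *: h + x)) 0 1 ler01.
- exact: (is_derive_line (dF (t *: h + x))).
- apply: continuous_subspaceT => t.
  by apply: differentiable_continuous; apply/derivable1_diffP;
     case: (is_derive_line (dF (t *: h + x))).
rewrite in_itv/= => t01; exists t => //.
by move: E; rewrite scale0r scale1r add0r subr0 mulr1 !(addrC x).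
Qed.

(** Compact support is encoded as vanishing outside a sup-norm ball, a condition that passes to
    products, sums and derivatives without closures. *)
Definition bsupp g := exists M : R, forall x, M < `|x| -> g x = 0.

Lemma bsupp_bounded g : continuous g -> bsupp g -> exists2 C : R, 0 <= C & forall x, `|g x| <= C.
Proof.
move=> cg [M hM].
pose K : set V := [set x | `|x| <= Num.max 0 M].
have cK : compact K.
  apply: bounded_closed_compact.
    by exists (Num.max 0 M); split; [exact: num_real|move=> r /ltW h x /= /le_trans]; apply.
  have -> : K = (fun x : V => `|x|) @^-1` [set t | t <= Num.max 0 M] by [].
  apply: closed_comp; last exact: closed_le.
  by move=> x _; exact: norm_continuous.
have cn : {within K, continuous (fun x => `|g x|)}.
  apply: continuous_subspaceT => x; apply: continuous_comp; first exact: cg.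
  exact: norm_continuous.
have K0 : K !=set0 by exists 0; rewrite /K/= normr0 le_max lexx.
have [c _ hc] := EVT_max_rV K0 cK cn.
exists `|g c| => // x; have [xK|/negP] := pselect (K x).
  by apply: hc; rewrite inE.
by rewrite -ltNge gt_max => /andP[_ /hM ->]; rewrite normr0.
Qed.

Lemma bsupp_derive g v : bsupp g -> bsupp ('D_v g).
Proof.
move=> [M hM]; exists M => x xM.
have : \forall y \near x, g y = (cst 0 : V -> R) y.
  have r0 : 0 < `|x| - M by rewrite subr_gt0.
  apply: filterS (near_norm_lt x r0) => y xy; rewrite /= hM//.
  have : `|x| <= `|x - y| + `|y| by rewrite -{1}(subrK y x) ler_normD.
  by move=> *; lra.
by move=> h; rewrite (near_eq_derive _ h) derive_cst.
Qed.

Definition smoothc g := @smooth R d R g /\ bsupp g.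

Lemma iterD_rcons (W : normedModType R) (vs : seq V) v (G : V -> W) :
  Defs.iterD (rcons vs v) G = Defs.iterD vs ('D_v G).
Proof. by elim: vs => //= w vs ->. Qed.

Lemma smoothc_derive g v : smoothc g -> smoothc ('D_v g).
Proof.
move=> [sg bg]; split; last exact: bsupp_derive.
by move=> vs x; rewrite -iterD_rcons; exact: sg.
Qed.

Lemma smoothc_diff g x : smoothc g -> differentiable g x.
Proof. by move=> [sg _]; exact: (sg [::]). Qed.

Lemma smoothc_continuous g : smoothc g -> continuous g.
Proof. by move=> kg x; apply: differentiable_continuous; exact: smoothc_diff. Qed.

Lemma smoothc_bounded g : smoothc g -> exists2 C : R, 0 <= C & forall x, `|g x| <= C.
Proof. by move=> kg; apply: bsupp_bounded; [exact: smoothc_continuous|case: kg]. Qed.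

(** Two applications of the mean value theorem along the segment express the remainder by second
    derivatives, which are bounded since they are continuous with bounded support. [C] does not
    depend on [x]; this uniformity permits integration of the remainder. *)
Lemma smoothc_taylor g : smoothc g -> exists2 C : R, 0 <= C &
  forall x h, `|g (x + h) - g x - 'D_h g x| <= C * `|h| ^+ 2.
Proof.
move=> kg.
have hC : forall ij : 'I_d * 'I_d, exists C : R, 0 <= C /\
    forall x, `|'D_(ebase ij.1) ('D_(ebase ij.2) g) x| <= C.
  move=> ij; have [C C0 h] := smoothc_bounded (smoothc_derive (ebase ij.1) (smoothc_derive (ebase ij.2) kg)).
  by exists C.
have [C hC'] := choice hC.
exists (\sum_i \sum_j C (i, j)).
  by apply: sumr_ge0 => i _; apply: sumr_ge0 => j _; case: (hC' (i, j)).
move=> x h.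
have [t /andP[t0 t1] ->] := MVT_line x h (fun y => smoothc_diff y kg).
have [s _ ->] := MVT_line x (t *: h) (fun y => smoothc_diff y (smoothc_derive h kg)).
set y := x + _.
have dD v : differentiable ('D_v g) y by exact: smoothc_diff (smoothc_derive v kg).
rewrite deriveZv//.
have -> : 'D_h ('D_h g) y = \sum_i \sum_j h ord0 i * h ord0 j * 'D_(ebase i) ('D_(ebase j) g) y.
  rewrite derive_lin//; apply: eq_bigr => i _.
  have -> : 'D_h g = \sum_j (h ord0 j *: 'D_(ebase j) g).
    apply/funext => w; rewrite derive_lin; last exact: smoothc_diff.
    by rewrite fct_sumE.
  rewrite derive_sum => [|j]; last exact/diff_derivable/differentiableZ.
  rewrite mulr_sumr; apply: eq_bigr => j _; rewrite deriveZ ?mulrA//.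
  exact: diff_derivable.
rewrite normrM (ger0_norm t0).
apply: (@le_trans _ _ `|\sum_i \sum_j h ord0 i * h ord0 j * 'D_(ebase i) ('D_(ebase j) g) y|).
  by rewrite -[leRHS]mul1r ler_wpM2r.
rewrite (le_trans (ler_norm_sum _ _ _))// mulr_suml ler_sum// => i _.
rewrite (le_trans (ler_norm_sum _ _ _))// mulr_suml ler_sum// => j _.
rewrite normrM mulrC ler_pM//; first by case: (hC' (i, j)).
by rewrite normrM expr2 ler_pM// coord_le_norm.
Qed.

End Calculus.
Arguments ebase {R d} i.

(** * Integrability and differentiation of convolutions *)

Section Convolution.
Variables (R : realType) (d : nat).
Local Notation V := 'rV[R]_d.
Local Notation T := (Rd R d).
Variable lam : {measure set T -> \bar R}.
Hypothesis hlam : is_lebesgue lam.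
Implicit Types (x y z v : V) (g f F : V -> R).
Notation itg g := (lam.-integrable [set: T] (EFin \o (g : T -> R))).
Notation "'Int' g" := (Rintegral lam [set: T] (g : T -> R)) (at level 10, g at level 8).
Notation mfun g := (measurable_fun [set: T] (g : T -> R)).

Lemma itgD f g : itg f -> itg g -> itg (fun x => f x + g x).
Proof. by move=> f1 g1; exact: (integrableD measurableT f1 g1). Qed.

Lemma itgB f g : itg f -> itg g -> itg (fun x => f x - g x).
Proof. by move=> f1 g1; exact: (integrableB measurableT f1 g1). Qed.

Lemma itgZ (c : R) f : itg f -> itg (fun x => c * f x).
Proof. by move=> f1; exact: (integrableZl measurableT c f1). Qed.

Lemma itg_sum I (s : seq I) (f : I -> V -> R) :
  (forall i, itg (f i)) -> itg (fun x => \sum_(i <- s) f i x).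
Proof.
move=> h; elim: s => [|i s ih].
  under eq_fun do rewrite big_nil; exact: integrable0.
by under eq_fun do rewrite big_cons; exact: itgD.
Qed.

Lemma Int_sum I (s : seq I) (f : I -> V -> R) : (forall i, itg (f i)) ->
  Int (fun x => \sum_(i <- s) f i x) = \sum_(i <- s) Int (f i).
Proof.
move=> h; elim: s => [|i s ih].
  by under eq_fun do rewrite big_nil; rewrite big_nil Rintegral_cst// mul0r.
under eq_fun do rewrite big_cons.
by rewrite big_cons RintegralD// ?ih//; exact: itg_sum.
Qed.

Lemma le_Int f g : itg f -> itg g -> (forall x, f x <= g x) -> Int f <= Int g.
Proof. by move=> f1 g1 h; apply: le_Rintegral. Qed.

Lemma le_itg f g : mfun f -> itg g -> (forall x, `|f x| <= `|g x|) -> itg f.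
Proof.
move=> mf ig h; apply: (@le_integrable _ T R lam setT measurableT _ (EFin \o (g : T -> R))) => //.
  exact/measurable_EFinP.
by move=> x _; rewrite /= lee_fin h.
Qed.

Lemma L1loc_cube g (M : R) : L1loc lam g ->
  lam.-integrable (cube M : set T) (EFin \o (g : T -> R)).
Proof.
move=> [mg ig]; apply: (@integrableS _ T R lam _ _ _ _ _ _ (ig (d%:R * `|M| + 1))).
- exact: measurable_eball.
- exact: measurable_cube.
- move=> x xM; rewrite /eball/= subr0 (le_lt_trans (enorm_le_norm _))//.
  have : `|x| <= `|M|.
    apply: norm_leP => // i; have := xM i; rewrite !mxE => /andP[h1 h2].
    rewrite (ger0_norm (_ : 0 <= M)); last lra.
    by rewrite ler_norml h1.
  by move=> /(ler_wpM2l (ler0n R d)); lra.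
Qed.

Lemma cubeNP (M : R) x : 0 <= M -> ~ cube M x -> M < `|x|.
Proof. by move=> M0 h; rewrite ltNge; apply/negP => /(cubeP _ M0). Qed.

Lemma itg_locM g f (C M : R) : L1loc lam g -> mfun f ->
  (forall x, `|f x| <= C) -> (forall x, M < `|x| -> f x = 0) -> itg (fun x => g x * f x).
Proof.
move=> lg mf fC fM; pose N := Num.max 0 M.
have := L1loc_cube N lg; move=> /(integrable_mkcond _ (measurable_cube N)) ig.
apply: (@le_integrable _ T R lam setT measurableT _
   (fun x => C%:E * (((EFin \o (g : T -> R)) \_ (cube N)) x))%E).
- by apply/measurable_EFinP; apply: measurable_funM => //; case: lg.
- move=> x _; rewrite /= patchE; case: ifPn => xN.
    by rewrite /= lee_fin !normrM mulrC ler_wpM2r// (le_trans (fC _))// ler_norm.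
  rewrite fM ?mulr0 ?normr0 ?mule0 ?abse0//.
  move: xN; rewrite notin_setE => /cubeNP; rewrite le_max lexx => /(_ isT).
  by rewrite gt_max => /andP[].
- exact: integrableZl.
Qed.

Lemma L1loc_cst (c : R) : L1loc lam (fun=> c).
Proof.
split; first exact: measurable_cst.
move=> r; apply: measurable_bounded_integrable.
- exact: measurable_eball.
- exact: lam_eball_lty.
- exact: measurable_cst.
- by exists `|c|; split; [exact: num_real|move=> M /ltW h x _ /=].
Qed.

Lemma itg_bsupp f : continuous f -> bsupp f -> itg f.
Proof.
move=> cf bf; have [C _ hC] := bsupp_bounded cf bf; have [M hM] := bf.
rewrite (_ : f = fun x => 1 * f x); last by apply/funext => x; rewrite mul1r.
apply: (@itg_locM (fun=> 1) f C M) => //; first exact: L1loc_cst.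
exact: measurable_continuous.
Qed.

Lemma itg_locM_cts g f : L1loc lam g -> continuous f -> bsupp f -> itg (fun x => g x * f x).
Proof.
move=> lg cf bf; have [C _ hC] := bsupp_bounded cf bf; have [M hM] := bf.
by apply: (itg_locM lg _ hC hM); exact: measurable_continuous.
Qed.

Lemma itg_L1loc g : itg g -> L1loc lam g.
Proof.
move=> ig; split; first exact: itg_measurable ig.
by move=> r; apply: integrableS ig => //; exact: measurable_eball.
Qed.

Lemma L1locD f g : L1loc lam f -> L1loc lam g -> L1loc lam (fun x => f x + g x).
Proof.
move=> [mf f1] [mg g1]; split; first exact: measurable_funD.
by move=> r; apply: (integrableD _ (f1 r) (g1 r)); exact: measurable_eball.
Qed.

Lemma L1locB f g : L1loc lam f -> L1loc lam g -> L1loc lam (fun x => f x - g x).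
Proof.
move=> [mf f1] [mg g1]; split; first exact: measurable_funB.
by move=> r; apply: (integrableB _ (f1 r) (g1 r)); exact: measurable_eball.
Qed.

Lemma L1locZ c f : L1loc lam f -> L1loc lam (fun x => c * f x).
Proof.
move=> [mf f1]; split; first exact: measurable_funM.
by move=> r; apply: (integrableZl _ c (f1 r)); exact: measurable_eball.
Qed.

Lemma L1loc_norm f : L1loc lam f -> L1loc lam (fun x => `|f x|).
Proof.
move=> [mf f1]; split; first exact: measurableT_comp.
by move=> r; exact: (integrable_norm (f1 r)).
Qed.

Lemma continuous_L1loc f : continuous f -> L1loc lam f.
Proof.
move=> cf; split; first exact: measurable_continuous.
move=> r.
have [N N0 hN] : exists2 N : R, 0 <= N & forall x, eball 0 r x -> `|x| <= N.
  exists `|r| => // x; rewrite /eball/= subr0 => h.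
  by rewrite (le_trans (norm_le_enorm _))// (le_trans (ltW h))// ler_norm.
pose K : set V := [set x | `|x| <= N].
have cK : compact K.
  apply: bounded_closed_compact.
    by exists N; split; [exact: num_real|move=> s /ltW h x /= /le_trans]; apply.
  have -> : K = (fun x : V => `|x|) @^-1` [set t | t <= N] by [].
  apply: closed_comp; last exact: closed_le.
  by move=> x _; exact: norm_continuous.
have cn : {within K, continuous (fun x => `|f x|)}.
  apply: continuous_subspaceT => x; apply: continuous_comp; first exact: cf.
  exact: norm_continuous.
have K0 : K !=set0 by exists 0; rewrite /K/= normr0.
have [c _ hc] := EVT_max_rV K0 cK cn.
apply: measurable_bounded_integrable.
- exact: measurable_eball.
- exact: lam_eball_lty.
- by apply: measurable_funTS; exact: measurable_continuous.
- exists `|f c|; split; [exact: num_real|move=> M /ltW h x /hN xN /=].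
  by rewrite (le_trans _ h)// hc// inE.
Qed.

Definition convol g f x : R := Int (fun y => g y * f (x - y)).

Lemma continuous_rev f x : continuous f -> continuous (fun y => f (x - y)).
Proof.
move=> cf y; apply/continuous_epsP => e e0.
have /continuous_epsP/(_ e e0)[h h0 hh] := cf (x - y).
exists h => // z yz; apply: hh.
by rewrite opprB addrC addrA subrK distrC.
Qed.

Lemma bsupp_rev f x : bsupp f -> bsupp (fun y => f (x - y)).
Proof.
move=> [M hM]; exists (`|x| + M) => y yM; apply: hM.
have : `|y| <= `|x - y| + `|x| by rewrite distrC -{1}(subrK x y) ler_normD.
by move=> *; lra.
Qed.

Lemma itg_conv g f x : L1loc lam g -> continuous f -> bsupp f -> itg (fun y => g y * f (x - y)).
Proof.
move=> lg cf bf; apply: itg_locM_cts => //; [exact: continuous_rev|exact: bsupp_rev].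
Qed.

(** Integrating the uniform Taylor remainder of [f] against [|g|] leaves a quadratic remainder for
    the convolution, so [diff_quad] applies. Only local integrability of [g] is at hand, so the
    remainder has to vanish outside a cube. *)
Lemma conv_diff g f : L1loc lam g -> smoothc f ->
  forall x, differentiable (convol g f) x /\ forall v, 'D_v (convol g f) x = convol g ('D_v f) x.
Proof.
move=> lg kf x.
have [C C0 hC] := smoothc_taylor kf.
have ik u h : smoothc h -> itg (fun y => g y * h (u - y)).
  by move=> kh; apply: itg_conv => //; [exact: smoothc_continuous|case: kh].
have dsum v : convol g ('D_v f) x = \sum_i v ord0 i * convol g ('D_(ebase i) f) x.
  transitivity (\sum_i Int (fun y => v ord0 i * (g y * 'D_(ebase i) f (x - y)))).
    rewrite -Int_sum => [|i]; last exact: (itgZ (v ord0 i) (ik x _ (smoothc_derive (ebase i) kf))).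
    congr (Int _); apply/funext => y; rewrite derive_lin; last exact: smoothc_diff.
    by rewrite mulr_sumr; apply: eq_bigr => i _; rewrite mulrCA.
  by apply: eq_bigr => i _; rewrite RintegralZl//; exact: (ik x _ (smoothc_derive (ebase i) kf)).
(* For increments of norm at most 1, the whole Taylor remainder vanishes as soon as [z] is at
   distance 1 outside the support of [f]. *)
have [M hM] : exists M : R, forall z h, M < `|z| -> `|h| <= 1 -> f (z + h) - f z - 'D_h f z = 0.
  have [M hM] := kf.2; exists (`|M| + 1) => z h zM h1.
  have z1 : M < `|z| by have := ler_norm M; lra.
  have z2 : M < `|z + h|.
    have : `|z| <= `|z + h| + `|h| by rewrite -{1}(addrK h z) (le_trans (ler_normB _ _)).
    by have := ler_norm M; lra.
  rewrite hM// hM// subrr sub0r.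
  rewrite derive_lin; last exact: smoothc_diff.
  rewrite big1 ?oppr0// => i _.
  have : \forall y \near z, f y = (cst 0 : V -> R) y.
    have r0 : 0 < `|z| - M by rewrite subr_gt0.
    apply: filterS (near_norm_lt z r0) => y zy; rewrite /= hM//.
    have : `|z| <= `|z - y| + `|y| by rewrite -{1}(subrK y z) ler_normD.
    by move=> *; lra.
  by move=> h0; rewrite (near_eq_derive _ h0) derive_cst mulr0.
(* If [|y| > N] then [|x - y| > M], so only the cube of half-side [N] contributes to the
   remainder. *)
pose N := `|x| + `|M|.
pose cu : V -> R := \1_(cube N).
have mcu : mfun cu by apply: measurable_indic; exact: measurable_cube.
have icu : itg (fun y => `|g y| * cu y).
  apply: (@itg_locM _ _ 1 N) => //; first exact: L1loc_norm.
    by move=> y; rewrite /cu indicE; case: (_ \in _); rewrite ?normr1 ?normr0.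
  move=> y yN; rewrite /cu indicE memNset// => /cubeP; rewrite addr_ge0// => /(_ isT).
  by rewrite leNgt yN.
have [|df hd] := @diff_quad _ _ (convol g f) x (\row_i convol g ('D_(ebase i) f) x)
   (C * Int (fun y => `|g y| * cu y)).
  move=> h h1.
  have -> : dot (\row_i convol g ('D_(ebase i) f) x) h = convol g ('D_h f) x.
    by rewrite dsum; apply: eq_bigr => i _; rewrite mxE mulrC.
  have i1 := ik (x + h) _ kf; have i2 := ik x _ kf.
  have i4 := ik x _ (smoothc_derive h kf); have i3 := itgB (itgB i1 i2) i4.
  rewrite /convol -(RintegralB measurableT i1 i2) -(RintegralB measurableT (itgB i1 i2) i4).
  apply: (le_trans (le_normr_Rintegral measurableT i3)).
  rewrite mulrAC -RintegralZl//.
  apply: le_Int; [exact: (integrable_norm i3)|exact: (itgZ _ icu)|move=> y].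
  rewrite -!mulrBr normrM mulrCA ler_wpM2l//.
  have -> : x + h - y = x - y + h by rewrite addrAC.
  rewrite /cu indicE; case: (boolP (y \in cube N)) => yN.
    by rewrite mulr1 hC.
  rewrite mulr0 hM ?normr0// .
  move: yN; rewrite notin_setE => /cubeNP; rewrite addr_ge0// => /(_ isT); rewrite /N.
  have : `|y| <= `|x - y| + `|x| by rewrite distrC -{1}(subrK x y) ler_normD.
  by have := ler_norm M; lra.
split=> // v; rewrite hd dsum; apply: eq_bigr => i _; by rewrite mxE mulrC.
Qed.

Lemma conv_iterD g f (vs : seq V) : L1loc lam g -> smoothc f ->
  Defs.iterD vs (convol g f) = convol g (Defs.iterD vs f) /\ smoothc (Defs.iterD vs f).
Proof.
move=> lg; elim: vs => //= v vs ih kf; have [E k] := ih kf.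
rewrite E; split; last exact: smoothc_derive.
by apply/funext => x; have [_ ->] := conv_diff lg k x.
Qed.

Lemma bsupp_conv g f : bsupp g -> bsupp f -> bsupp (convol g f).
Proof.
move=> [M hM] [N hN]; exists (M + N) => x xMN; rewrite /convol.
have -> : (fun y => g y * f (x - y)) = (fun=> 0); last by rewrite Rintegral_cst// mul0r.
apply/funext => y; have [yM|yM] := ltP M `|y|; first by rewrite hM// mul0r.
rewrite hN ?mulr0//.
have : `|x| <= `|x - y| + `|y| by rewrite -{1}(subrK y x) ler_normD.
by move=> *; lra.
Qed.

End Convolution.

(** * Mollifiers *)

Section OneVariable.
Variable R : realType.
Implicit Types (t h l C : R) (m : nat).

(** One-variable form of [diff_quad], used at points where piecewise formulas are glued. *)
Lemma is_derive_quad (F : R -> R) t l C :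
  (forall h, `|F (t + h) - F t - l * h| <= C * h ^+ 2) -> is_derive t 1 F l.
Proof.
move=> hF.
have cv : (fun h : R => h^-1 *: (F (h *: (1 : R) + t) - F t)) @ 0^' --> l.
  apply/cvgrPdist_le => e e0.
  have r0 : 0 < e / (`|C| + 1) by rewrite divr_gt0// ltr_wpDl.
  near=> h.
  have h0 : h != 0 by near: h; exact: nbhs_dnbhs_neq.
  have he : `|h| < e / (`|C| + 1) by near: h; exact: dnbhs0_lt.
  rewrite [h *: 1]mulr1 addrC [h^-1 *: _]mulrC.
  have -> : - ((F (h + t) - F t) / h) + l = - (F (t + h) - F t - l * h) / h.
    by rewrite (addrC h t); field.
  rewrite normrM normrN normfV ler_pdivrMr ?normr_gt0//.
  apply: (le_trans (hF h)); rewrite -real_normK ?num_real// expr2 mulrA ler_wpM2r//.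
  apply: (@le_trans _ _ ((`|C| + 1) * `|h|)).
    by rewrite ler_wpM2r// (le_trans (ler_norm _))// lerDl.
  by rewrite mulrC -ler_pdivlMr ?ltr_wpDl// ltW.
by apply: DeriveDef; [apply/cvg_ex; exists l|exact: cvg_lim].
Unshelve. all: by end_near. Qed.

(** [theta 0] is the classical flat function [exp (- 1 / t)]; the powers of [1 / t] make the family
    closed, up to linear combinations, under differentiation. *)
Definition theta m t : R := if 0 < t then t^-1 ^+ m * expR (- t^-1) else 0.

(** Write [exp t = exp (t / m) ^ m] and use [exp (t / m) >= t / m]; this produces the constant
    [m ^ m]. *)
Lemma expX_le m t : 0 <= t -> t ^+ m * expR (- t) <= m%:R ^+ m.
Proof.
move=> t0; case: m => [|m]; first by rewrite !expr0 mul1r -expR0 ler_expR; lra.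
have m0 : 0 < m.+1%:R :> R by [].
rewrite expRN ler_pdivrMr ?expR_gt0//.
have -> : expR t = expR (t / m.+1%:R) ^+ m.+1.
  by rewrite -expRM_natl mulrC divfK// gt_eqF.
rewrite -exprMn lerXn2r ?nnegrE// ?mulr_ge0 ?expR_ge0//.
rewrite mulrC -ler_pdivrMr//; apply: le_trans (expR_ge1Dx _).
by rewrite lerDr.
Qed.

Lemma theta_ge0 m t : 0 <= theta m t.
Proof.
rewrite /theta; case: ifP => // t0.
by rewrite mulr_ge0 ?expR_ge0// exprn_ge0// invr_ge0 ltW.
Qed.

(** Two extra powers in [expX_le], taken at [1 / t], give quadratic flatness at 0, which is what
    [is_derive_quad] asks for there. *)
Lemma theta_quad m t : theta m t <= m.+2%:R ^+ m.+2 * t ^+ 2.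
Proof.
rewrite /theta; case: ifPn => [t0|_]; last by rewrite mulr_ge0// sqr_ge0.
have := @expX_le m.+2 t^-1; rewrite invr_ge0 => /(_ (ltW t0)) h.
rewrite -ler_pdivrMr ?exprn_gt0//; apply: le_trans h.
by rewrite -exprVn mulrAC -exprD addn2.
Qed.

Lemma is_derive_theta m t :
  is_derive t 1 (theta m) (theta m.+2 t - m%:R * theta m.+1 t).
Proof.
have [t0|t0|->] := ltgtP t 0.
- have E : \forall s \near t, theta m s = cst 0 s.
    near=> s; rewrite /theta /cst ltNge (_ : s <= 0)//.
    by apply/ltW; near: s; exact: lt_nbhsl.
  rewrite /theta (lt_gtF t0) mulr0 subr0.
  apply: (@near_eq_is_derive _ _ _ (cst 0)) => //.
  by near=> s; apply/esym; near: s.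
- have E : \forall s \near t, (fun s => s^-1 ^+ m * expR (- s^-1)) s = theta m s.
    near=> s; rewrite /theta (_ : 0 < s)//.
    by near: s; exact: lt_nbhsr.
  apply: (near_eq_is_derive E).
  have tn0 : t != 0 by rewrite gt_eqF.
  have dV : is_derive t 1 (fun s : R => s^-1) (- t ^- 2).
    apply: (@is_derive_eq _ _ _ _ _ _ _ _ (@is_deriveV R id t 1 1 tn0 (is_derive_id t 1))).
    by rewrite [_ *: _]mulr1.
  have dX := is_deriveX m dV.
  have dE := @is_derive1_comp R expR (- (fun s : R => s^-1)) t _ _
    (is_derive_expR (- t^-1)) (is_deriveN dV).
  have dM := is_deriveM dX dE.
  have -> : (fun s : R => s^-1 ^+ m * expR (- s^-1)) =
     (fun s : R => s^-1) ^+ m * (expR \o - (fun s : R => s^-1)).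
    by apply/funext => s; rewrite !fctE.
  apply: (is_derive_eq dM); rewrite /theta t0 /= !fctE.
  rewrite /GRing.scale/= -exprVn; move: (t^-1) (expR _) => a b.
  by case: m {E dM dX} => [|m] /=; rewrite ?exprS ?expr0; ring.
- apply: (@is_derive_quad _ _ _ (m.+2%:R ^+ m.+2)) => h.
  rewrite add0r {2 3 4}/theta ltxx mulr0 !subr0 mul0r subr0 ger0_norm ?theta_ge0//.
  exact: theta_quad.
Unshelve. all: by end_near. Qed.

End OneVariable.

(** * Smooth bumps and existence of mollifiers *)

Section Bump.
Variables (R : realType) (d : nat).
Local Notation V := 'rV[R]_d.
Local Notation T := (Rd R d).
Implicit Types (x y z v : V) (g f F : V -> R).

Lemma comp_diff (k : R -> R) F x l : is_derive (F x) 1 k l -> differentiable F x ->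
  differentiable (fun y => k (F y)) x /\
  forall v, 'D_v (fun y => k (F y)) x = l * 'D_v F x.
Proof.
move=> [dk kl] dF.
have dk' : differentiable k (F x) by exact/derivable1_diffP.
split=> [|v]; first exact: differentiable_comp.
rewrite deriveE; last exact: differentiable_comp.
rewrite [in LHS](@diff_comp _ _ _ _ F k)// /= (deriveE v dF).
move: ('d F x v) => w; rewrite -{1}[w]mulr1 -[w * 1]/(w *: (1 : R)) linearZ/=.
by rewrite -deriveE// kl mulrC.
Qed.

Definition sqdist (c x : V) : R := dot (x - c) (x - c).

Lemma sqdist_diff c x : differentiable (sqdist c) x /\
  forall v, 'D_v (sqdist c) x = 2 * dot (x - c) v.
Proof.
have [|h1 h2] := @diff_quad R d (sqdist c) x (2 *: (x - c)) (d%:R ^+ 2).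
  move=> h _; rewrite /sqdist.
  have -> : x + h - c = (x - c) + h by rewrite addrAC.
  move: (x - c) => w; rewrite dotDl !dotDr (dotC h w) dotZl.
  rewrite (_ : _ - 2 * _ = dot h h); last by ring.
  rewrite ger0_norm ?dot_ge0// -enorm_sqr -exprMn.
  by rewrite ler_sqr ?nnegrE ?enorm_ge0 ?mulr_ge0// enorm_le_norm.
by split=> // v; rewrite h2 dotZl.
Qed.

(* Contains the bump [exp (- 1 / (e^2 - |x|^2))] and is stable under differentiation. *)
Inductive bclass (e : R) : (V -> R) -> Prop :=
| bclass_theta m : bclass e (fun x => theta m (e ^+ 2 - sqdist 0 x))
| bclass_coord i g : bclass e g -> bclass e (fun x => x ord0 i * g x)
| bclass_scale c g : bclass e g -> bclass e (fun x => c * g x)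
| bclass_add f g : bclass e f -> bclass e g -> bclass e (fun x => f x + g x).

Lemma bclass_sum e I (s : seq I) (g : I -> V -> R) :
  (forall i, bclass e (g i)) -> bclass e (fun x => \sum_(i <- s) g i x).
Proof.
move=> h; elim: s => [|i s ih].
  have := bclass_scale 0 (bclass_theta e 0); congr bclass; apply/funext => x.
  by rewrite big_nil mul0r.
have := bclass_add (h i) ih; congr bclass; apply/funext => x.
by rewrite big_cons.
Qed.

Lemma coord_diff i x : differentiable (fun y : V => y ord0 i) x /\
  forall v, 'D_v (fun y : V => y ord0 i) x = v ord0 i.
Proof.
have [|h1 h2] := @diff_quad R d (fun y : V => y ord0 i) x (ebase i) 0.
  move=> h _; rewrite mul0r.
  have -> : dot (ebase i) h = h ord0 i.
    rewrite /dot (bigD1 i)//= mxE !eqxx mul1r big1 ?addr0// => j /negPf ji.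
    by rewrite mxE eqxx ji mul0r.
  by rewrite mxE (_ : _ - _ = 0) ?normr0//; ring.
split=> // v; rewrite h2.
rewrite /dot (bigD1 i)//= mxE !eqxx mul1r big1 ?addr0// => j /negPf ji.
by rewrite mxE eqxx ji mul0r.
Qed.

Lemma bclass_derive e g : bclass e g ->
  (forall x, differentiable g x) /\ forall v, bclass e ('D_v g).
Proof.
elim=> {g} [m|i g bg [dg Dg]|c g bg [dg Dg]|f g bf [df Df] bg [dg Dg]].
- pose q x := e ^+ 2 - sqdist 0 x.
  have dq x : differentiable q x.
    by apply: differentiableB; [exact: differentiable_cst|case: (sqdist_diff 0 x)].
  have Dq x v : 'D_v q x = - 2 * dot x v.
    rewrite deriveB; [|exact: derivable_cst|by apply: diff_derivable; case: (sqdist_diff 0 x)].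
    by rewrite derive_cst sub0r; case: (sqdist_diff 0 x) => _ ->; rewrite subr0 mulNr.
  split=> [x|v]; first by case: (comp_diff (is_derive_theta m (q x)) (dq x)).
  have -> : 'D_v (fun x => theta m (e ^+ 2 - sqdist 0 x)) =
    (fun x => \sum_i (- 2 * v ord0 i) * (x ord0 i *
       (theta m.+2 (e ^+ 2 - sqdist 0 x) + (- m%:R) * theta m.+1 (e ^+ 2 - sqdist 0 x)))).
    apply/funext => x; case: (comp_diff (is_derive_theta m (q x)) (dq x)) => _ ->.
    rewrite Dq /dot !mulr_sumr; apply: eq_bigr => i _; rewrite /q; ring.
  apply: bclass_sum => i; apply: bclass_scale; apply: bclass_coord.
  apply: bclass_add; first exact: bclass_theta.
  by apply: bclass_scale; exact: bclass_theta.
- split=> [x|v]; first by apply: differentiableM => //; case: (coord_diff i x).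
  have -> : 'D_v (fun x => x ord0 i * g x) = (fun x => x ord0 i * 'D_v g x + v ord0 i * g x).
    apply/funext => x; have [di Di] := coord_diff i x.
    rewrite (deriveM (diff_derivable di) (diff_derivable (dg x))) /GRing.scale/= Di.
    by rewrite (mulrC (g x)).
  apply: bclass_add; first by apply: bclass_coord.
  exact: bclass_scale.
- split=> [x|v]; first exact: differentiableZ.
  have -> : 'D_v (fun x => c * g x) = (fun x => c * 'D_v g x).
    by apply/funext => x; rewrite (deriveZ c (diff_derivable (dg x))).
  exact: bclass_scale.
- split=> [x|v]; first exact: differentiableD.
  have -> : 'D_v (fun x => f x + g x) = (fun x => 'D_v f x + 'D_v g x).
    by apply/funext => x; rewrite (deriveD (diff_derivable (df x)) (diff_derivable (dg x))).
  exact: bclass_add.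
Qed.

Lemma bclass_smooth e g : bclass e g -> @smooth R d R g.
Proof.
move=> bg vs x; suff : bclass e (Defs.iterD vs g) by move=> /bclass_derive[].
by elim: vs => //= v vs /bclass_derive[].
Qed.

Variable lam : {measure set T -> \bar R}.
Hypothesis hlam : is_lebesgue lam.
Notation itg g := (lam.-integrable [set: T] (EFin \o (g : T -> R))).
Notation "'Int' g" := (Rintegral lam [set: T] (g : T -> R)) (at level 10, g at level 8).

Lemma Int_gt0 g x : continuous g -> bsupp g -> (forall y, 0 <= g y) -> 0 < g x -> 0 < Int g.
Proof.
move=> cg bg g0 gx; have ig := itg_bsupp hlam cg bg.
have [|e e0 he] := (continuous_epsP g x).1 (cg x) (g x / 2); first by rewrite divr_gt0.
pose B : set V := eball x e.
have mB : measurable (B : set T) by exact: measurable_eball.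
have iB : itg (\1_B : V -> R).
  have -> : (\1_B : V -> R) = (fun y => 1 * \1_B y) by apply/funext => y; rewrite mul1r.
  apply: (@itg_locM _ _ lam (fun=> 1) _ 1 (`|x| + e)).
  - exact: L1loc_cst.
  - exact: measurable_indic.
  - by move=> y; rewrite indicE; case: (_ \in _); rewrite ?normr1 ?normr0.
  - move=> y yx; rewrite indicE memNset// /B/eball/= => h.
    have := le_lt_trans (norm_le_enorm _) h.
    have : `|y| <= `|y - x| + `|x| by rewrite -{1}(subrK x y) ler_normD.
    by lra.
apply: (@lt_le_trans _ _ (Int (fun y => g x / 2 * (\1_B : V -> R) y))).
  rewrite RintegralZl// mulr_gt0 ?divr_gt0//.
  rewrite /Rintegral integral_indic// setIT fine_gt0//.
  by rewrite lam_eball_gt0// lam_eball_lty.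
(* By continuity [g] stays above half of [g x] on the ball [B], whose measure is positive. *)
apply: le_Int => //; first exact: itgZ.
move=> y; rewrite indicE; case: (boolP (y \in B)) => [|_]; last by rewrite mulr0.
rewrite inE /B/eball/= mulr1 => yx.
have /he : `|x - y| < e by rewrite distrC (le_lt_trans (norm_le_enorm _)).
by rewrite ltr_norml => /andP[]; lra.
Qed.

(** Evenness makes the first derivatives odd; this supplies the sign when a derivative is moved
    across an integral. *)
Definition mollifier (e : R) g :=
  [/\ smoothc g, (forall x, 0 <= g x), (forall x, g (- x) = g x),
      (forall x, e < `|x| -> g x = 0) & Int g = 1].

Lemma mollifier_exists e : 0 < e -> exists g, mollifier e g.
Proof.
move=> e0; pose g0 x : R := theta 0 (e ^+ 2 - sqdist 0 x).
have s0 x : e < `|x| -> g0 x = 0.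
  move=> xe; rewrite /g0 /theta; case: ifP => //.
  rewrite subr_gt0 /sqdist subr0 -enorm_lt ?(ltW e0)// => h.
  by have := lt_trans (le_lt_trans (norm_le_enorm _) h) xe; rewrite ltxx.
have k0 : smoothc g0 by split; [exact: bclass_smooth (bclass_theta e 0)|exists e].
have I0 : 0 < Int g0.
  apply: (@Int_gt0 _ 0).
  - exact: smoothc_continuous.
  - by exists e.
  - by move=> x; exact: theta_ge0.
  - rewrite /g0 /sqdist subr0 /dot big1 => [|i _]; last by rewrite mxE mul0r.
    by rewrite subr0 /theta exprn_gt0// expr0 mul1r expR_gt0.
exists (fun x => (Int g0)^-1 * g0 x); split.
- split; last by exists e => x xe; rewrite s0// mulr0.
  exact: bclass_smooth (bclass_scale _ (bclass_theta e 0)).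
- by move=> x; rewrite mulr_ge0 ?theta_ge0// invr_ge0 ltW.
- by move=> x; rewrite /g0 /sqdist !subr0 dotNl dotNr opprK.
- by move=> x xe; rewrite s0// mulr0.
- rewrite RintegralZl// ?mulVf ?gt_eqF//.
  by apply: itg_bsupp => //; [exact: smoothc_continuous|exists e].
Qed.

End Bump.

(** * Mollified test fields and lower bounds for the total variation *)

Section Mollify.
Variables (R : realType) (d : nat).
Local Notation V := 'rV[R]_d.
Local Notation T := (Rd R d).
Variable lam : {measure set T -> \bar R}.
Hypothesis hlam : is_lebesgue lam.
Implicit Types (x y z v : V) (g f F : V -> R).
Notation itg g := (lam.-integrable [set: T] (EFin \o (g : T -> R))).
Notation "'Int' g" := (Rintegral lam [set: T] (g : T -> R)) (at level 10, g at level 8).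

Lemma Int0 g : (forall x, g x = 0) -> Int g = 0.
Proof.
move=> h; rewrite (_ : g = fun=> 0); last exact/funext.
by rewrite Rintegral_cst// mul0r.
Qed.

Lemma Int_opp g : itg g -> Int (fun x => - g x) = - Int g.
Proof.
move=> ig; rewrite -[RHS]mulN1r -(RintegralZl (-1) measurableT ig).
by congr (Int _); apply/funext => x; rewrite mulN1r.
Qed.

(** Here [g] is only locally integrable, so the majorant for Fubini is [|g|] times a constant on a
    cube that contains the sum of the two supports. *)
Lemma conv_fubini g f (h : V -> R) : L1loc lam g -> continuous f -> bsupp f -> 
  continuous h -> bsupp h ->
  Int (fun x => g x * convol lam f h x) = Int (fun y => f y * Int (fun x => g x * h (x - y))).
Proof.
move=> lg cf bf ch bh.
have [Cf Cf0 hCf] := bsupp_bounded cf bf; have [Mf hMf] := bf.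
have [Ch Ch0 hCh] := bsupp_bounded ch bh; have [Mh hMh] := bh.
have i1 x : itg (fun y => f y * h (x - y)).
  by apply: itg_conv => //; exact: continuous_L1loc.
have cs y : continuous (fun x => h (x - y)).
  move=> x; apply/continuous_epsP => e e0.
  have /continuous_epsP/(_ e e0)[r r0 hr] := ch (x - y).
  by exists r => // z xz; apply: hr; rewrite opprB addrA subrK.
have bs y : bsupp (fun x => h (x - y)).
  exists (`|y| + Mh) => x xM; apply: hMh.
  have : `|x| <= `|x - y| + `|y| by rewrite -{1}(subrK y x) ler_normD.
  by move=> *; lra.
have i2 y : itg (fun x => g x * h (x - y)) by apply: itg_locM_cts.
transitivity (Int (fun x => Int (fun y => g x * (f y * h (x - y))))).
  by congr (Int _); apply/funext => x; rewrite RintegralZl.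
transitivity (Int (fun y => Int (fun x => g x * (f y * h (x - y))))); last first.
  congr (Int _); apply/funext => y; rewrite -RintegralZl//.
  by congr (Int _); apply/funext => x; rewrite mulrCA.
(* For [|x| > N] no [y] makes both [f y] and [h (x - y)] nonzero. *)
pose N := `|Mf| + `|Mh|.
pose cu : V -> R := \1_(cube N).
have inf : itg (fun y => `|f y|) by exact: (integrable_norm (itg_bsupp hlam cf bf)).
pose K := Ch * Int (fun y => `|f y|).
apply: (@fubini_Int _ _ lam hlam (fun x y => g x * (f y * h (x - y)))
  (fun x => `|g x| * (K * cu x))).
- have mg : measurable_fun [set: T * T] (fun p : T * T => g p.1).
    by case: lg => mg _; exact: (measurableT_comp mg).
  have mf : measurable_fun [set: T * T] (fun p : T * T => f p.2).
    exact: (measurableT_comp (measurable_continuous cf)).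
  have mh : measurable_fun [set: T * T] (fun p : T * T => h (p.1 - p.2)).
    exact: (measurableT_comp (measurable_continuous ch) (@measurable_subr R d)).
  by apply: measurable_funM => //; exact: measurable_funM.
- by move=> x; exact: (itgZ _ (i1 x)).
- move=> y; have := itgZ (f y) (i2 y).
  by under eq_fun do rewrite mulrCA.
- apply: (@itg_locM _ _ lam _ _ `|K| N) => //; first exact: L1loc_norm.
  + apply: measurable_funM => //; apply: measurable_indic; exact: measurable_cube.
  + move=> x; rewrite normrM /cu indicE; case: (_ \in _); rewrite ?normr1 ?normr0 ?mulr1 ?mulr0//.
  + move=> x xN; rewrite /cu indicE memNset ?mulr0// => /cubeP; rewrite addr_ge0// => /(_ isT).
    by rewrite leNgt xN.
- move=> x.
  have -> : (fun y => `|g x * (f y * h (x - y))|) = (fun y => `|g x| * `|f y * h (x - y)|).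
    by apply/funext => y; rewrite normrM.
  have in1 := integrable_norm (i1 x).
  rewrite RintegralZl// ler_wpM2l//.
  have [xN|/(cubeNP _) xN] := pselect (cube N x).
    rewrite /cu indicE mem_set// mulr1 /K -RintegralZl//.
    apply: le_Int => //; first exact: (itgZ Ch inf).
    by move=> y; rewrite normrM mulrC ler_wpM2r.
  rewrite Int0 => [|y]; first by rewrite mulr_ge0// ?mulr_ge0// ?indicE// Rintegral_ge0.
  have {}xN : N < `|x| by apply: xN; rewrite addr_ge0.
  have [yM|yM] := ltP Mf `|y|; first by rewrite hMf// mul0r normr0.
  rewrite hMh ?mulr0 ?normr0//.
  have : `|x| <= `|x - y| + `|y| by rewrite -{1}(subrK y x) ler_normD.
  by move: xN; rewrite /N; have := ler_norm Mf; have := ler_norm Mh; move=> *; lra.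
Qed.

Lemma even_derive g v x : smoothc g -> (forall y, g (- y) = g y) ->
  'D_v g (- x) = - 'D_v g x.
Proof.
move=> kg ev; have E : g = g \o -%R by apply/funext => y; rewrite /= ev.
have dN : differentiable (-%R : V -> V) x by exact: (@ex_diff _ _ _ _ _ _ _ (is_diffN (is_diff_id x))).
rewrite {2}E [in RHS]deriveE; last first.
  by apply: differentiable_comp => //; exact: smoothc_diff.
rewrite diff_comp//; last exact: smoothc_diff.
rewrite /= (_ : 'd -%R x v = - v); last first.
  by rewrite (@diff_val _ _ _ _ _ _ _ (is_diffN (is_diff_id x))).
by rewrite linearN opprK deriveE//; exact: smoothc_diff.
Qed.

Lemma row_diff (G : 'I_d -> V -> R) x : (forall i, differentiable (G i) x) ->
  differentiable (fun y => \row_i G i y : V) x.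
Proof.
move=> dG; have -> : (fun y => \row_i G i y : V) = \sum_i (fun y => G i y *: ebase i).
  apply/funext => y; rewrite fct_sumE [LHS]row_sum_ebase.
  by apply: eq_bigr => i _; rewrite mxE.
by apply: differentiable_sum => i; exact: differentiableZl.
Qed.

Lemma row_derive (G : 'I_d -> V -> R) x v : (forall i, differentiable (G i) x) ->
  'D_v (fun y => \row_i G i y : V) x = \row_i 'D_v (G i) x.
Proof.
move=> dG; rewrite derive_mx; last exact: diff_derivable (row_diff dG).
apply/matrixP => i j; rewrite !mxE.
by congr ('D_v _ x); apply/funext => y; rewrite mxE.
Qed.

Variables (eta : V -> R) (e : R).
Hypothesis heta : mollifier lam e eta.

Let ceta : continuous eta. Proof. by case: heta => k *; exact: smoothc_continuous. Qed.
Let beta : bsupp eta. Proof. by case: heta => [[]]. Qed.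

Lemma Int_eta_rev x : Int (fun y => eta (x - y)) = 1.
Proof.
case: heta => k _ ev _ <-.
rewrite -(Int_shift hlam (- x) (itg_bsupp hlam ceta beta)).
by congr (Int _); apply/funext => y; rewrite -ev opprB.
Qed.

(** All derivatives fall on [eta], so continuity of [Z] suffices for smoothness. The norm bound
    persists because [eta] is a probability density. *)
Lemma conv_test_field (Z : V -> V) :
  (forall i, continuous (fun x => Z x ord0 i)) -> bsupp (fun x => enorm (Z x)) ->
  (forall x, enorm (Z x) <= 1) ->
  test_field (fun x => \row_i convol lam (fun y => Z y ord0 i) eta x).
Proof.
move=> cZ [M hM] Z1; case: (heta) => k eta0 ev eM I1.
have lZ i : L1loc lam (fun y => Z y ord0 i) by exact: continuous_L1loc.
have ZM x i : M < `|x| -> Z x ord0 i = 0.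
  move=> /hM h; apply/eqP; rewrite -normr_eq0 -normr_le0 -h.
  by rewrite normr_id (le_trans (coord_le_norm _ _))// norm_le_enorm.
set W := fun x => _.
have itW vs : Defs.iterD vs W = fun x => \row_i convol lam (fun y => Z y ord0 i) (Defs.iterD vs eta) x.
  elim: vs => //= v vs ->; apply/funext => x; rewrite row_derive.
    apply/rowP => i; rewrite !mxE.
    have [_ kk] := conv_iterD vs (lZ i) k.
    by case: (conv_diff (lZ i) kk x) => _ ->.
  move=> i; have [_ kk] := conv_iterD vs (lZ i) k.
  by case: (conv_diff (lZ i) kk x).
split.
- move=> vs x; rewrite itW; apply: row_diff => i.
  have [_ kk] := conv_iterD vs (lZ i) k.
  by case: (conv_diff (lZ i) kk x).
- apply: bounded_closed_compact; last exact: closed_closure.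
  have Wb x : M + e < `|x| -> W x = 0.
    move=> xM; apply/rowP => i; rewrite !mxE; apply: Int0 => y.
    have [yM|yM] := ltP M `|y|; first by rewrite ZM// mul0r.
    rewrite eM ?mulr0//.
    have : `|x| <= `|x - y| + `|y| by rewrite -{1}(subrK y x) ler_normD.
    by move=> *; lra.
  exists (M + e); split=> [|N MN x]; first exact: num_real.
  have clN : closed [set x : V | `|x| <= N].
    have -> : [set x : V | `|x| <= N] = (fun x : V => `|x|) @^-1` [set t | t <= N] by [].
    apply: closed_comp; last exact: closed_le.
    by move=> y _; exact: norm_continuous.
  have sub : [set x | W x != 0] `<=` [set x | `|x| <= N].
    move=> y /= Wy; rewrite leNgt; apply/negP => /(lt_trans MN)/Wb Wy0.
    by rewrite Wy0 eqxx in Wy.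
  by move=> /(closure_subset sub); rewrite -((closure_id _).1 clN).
- move=> x; have iZ i : itg (fun y => Z y ord0 i * eta (x - y)) by exact: itg_conv.
  have ie : itg (fun y => eta (x - y)).
    by apply: itg_bsupp => //; [exact: continuous_rev|exact: bsupp_rev].
  (* The triangle inequality for vector integrals is obtained by pairing with [W x] itself:
     [|W|^2 = int (W . Z) eta <= |W|]. *)
  have h : enorm (W x) ^+ 2 <= enorm (W x).
    rewrite enorm_sqr /dot.
    have -> : \sum_(i < d) W x ord0 i * W x ord0 i =
        Int (fun y => dot (W x) (Z y) * eta (x - y)).
      transitivity (\sum_i Int (fun y => W x ord0 i * (Z y ord0 i * eta (x - y)))).
        by apply: eq_bigr => i _; rewrite RintegralZl// {2}/W mxE.
      rewrite -Int_sum => [|i]; last exact: (itgZ _ (iZ i)).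
      by congr (Int _); apply/funext => y; rewrite mulr_suml; apply: eq_bigr => i _; rewrite mulrA.
    have -> : enorm (W x) = Int (fun y => enorm (W x) * eta (x - y)).
      by rewrite RintegralZl// Int_eta_rev mulr1.
    apply: le_Int; [|exact: (itgZ _ ie)|].
      have : itg (fun y => \sum_i W x ord0 i * (Z y ord0 i * eta (x - y))).
        by apply: itg_sum => i; exact: (itgZ _ (iZ i)).
      congr (lam.-integrable _ _); apply/funext => y /=; congr (_%:E).
      by rewrite mulr_suml; apply: eq_bigr => i _; rewrite mulrA.
    move=> y; rewrite ler_wpM2r// (le_trans (ler_norm _))// (le_trans (dot_CS _ _))//.
    by rewrite -[leRHS]mulr1 ler_wpM2l ?enorm_ge0.
  rewrite leNgt; apply/negP => h1; have : enorm (W x) ^+ 2 > enorm (W x).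
    by rewrite expr2 -{1}[enorm (W x)]mulr1 ltr_pM2l// (lt_trans _ h1).
  by rewrite ltNge h.
Qed.

(** Exchanging the two integrals replaces [D_i eta (x - y)] by its value at the opposite point, and
    oddness gives the minus sign. This acts as an integration by parts in which no derivative of [Z]
    appears, which matters because the [Z] to be used contains [k' (U x)] and is merely
    continuous. *)
Lemma TV_mollify (u : V -> R) (Z : V -> V) : L1loc lam u ->
  (forall i, continuous (fun x => Z x ord0 i)) -> bsupp (fun x => enorm (Z x)) ->
  (forall x, enorm (Z x) <= 1) ->
  ((- \sum_i Int (fun y => Z y ord0 i * convol lam u ('D_(ebase i) eta) y))%:E <= TV lam u)%E.
Proof.
move=> lu cZ bZ Z1; case: (heta) => k eta0 ev eM I1.
have tf := conv_test_field cZ bZ Z1.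
have lZ i : L1loc lam (fun y => Z y ord0 i) by exact: continuous_L1loc.
have bZi i : bsupp (fun y => Z y ord0 i).
  case: bZ => M hM; exists M => x /hM h; apply/eqP; rewrite -normr_eq0 -normr_le0 -h.
  by rewrite normr_id (le_trans (coord_le_norm _ _))// norm_le_enorm.
apply: le_trans (ereal_sup_ubound _); last by eexists; [exact: tf|reflexivity].
set W := fun x : V => _.
have dW x : divg W x = \sum_i convol lam (fun y => Z y ord0 i) ('D_(ebase i) eta) x.
  apply: eq_bigr => i _.
  have -> : (fun y => W y ord0 i) = convol lam (fun y => Z y ord0 i) eta.
    by apply/funext => y; rewrite mxE.
  by case: (conv_diff (lZ i) k x) => _ ->.
have cc i : continuous (convol lam (fun y => Z y ord0 i) ('D_(ebase i) eta)).
  move=> x; apply: differentiable_continuous.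
  by case: (conv_diff (lZ i) (smoothc_derive (ebase i) k) x).
have ii i : itg (fun x => u x * convol lam (fun y => Z y ord0 i) ('D_(ebase i) eta) x).
  apply: itg_locM_cts => //; apply: bsupp_conv => //; exact: bsupp_derive.
have cu i : continuous (convol lam u ('D_(ebase i) eta)).
  move=> x; apply: differentiable_continuous.
  by case: (conv_diff lu (smoothc_derive (ebase i) k) x).
have E : (fun x => u x * divg W x) =
   fun x => \sum_i u x * convol lam (fun y => Z y ord0 i) ('D_(ebase i) eta) x.
  by apply/funext => x; rewrite dW mulr_sumr.
have iE : itg (fun x => u x * divg W x) by rewrite E; exact: itg_sum.
rewrite -[leRHS]fineK; last exact: (integrable_fin_num measurableT iE).
rewrite lee_fin -[leRHS]/(Int (fun x => u x * divg W x)) E Int_sum// -sumrN.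
apply: ler_sum => i _; rewrite [leRHS]conv_fubini//; last 2 first.
- exact: smoothc_continuous (smoothc_derive _ k).
- exact: bsupp_derive.
have iZu : itg (fun y => Z y ord0 i * convol lam u ('D_(ebase i) eta) y).
  have := @itg_locM_cts _ _ lam _ _ (continuous_L1loc hlam (cu i)) (cZ i) (bZi i).
  by under eq_fun do rewrite mulrC.
rewrite -(Int_opp iZu).
suff -> : (fun y => - (Z y ord0 i * convol lam u ('D_(ebase i) eta) y)) =
   (fun y => Z y ord0 i * Int (fun x => u x * 'D_(ebase i) eta (x - y))) by [].
apply/funext => y; rewrite -mulrN; congr (_ * _).
have iu : itg (fun x => u x * 'D_(ebase i) eta (y - x)).
  have kd := smoothc_derive (ebase i) k.
  exact: (itg_conv y lu (smoothc_continuous kd) kd.2).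
rewrite /convol -(Int_opp iu).
congr (Int _); apply/funext => x; rewrite -mulrN; congr (_ * _).
by rewrite -even_derive// opprB.
Qed.

End Mollify.

(** * Calibrated truncation *)

Section Calibration.
Variables (R : realType) (d : nat).
Local Notation V := 'rV[R]_d.
Local Notation T := (Rd R d).
Variable lam : {measure set T -> \bar R}.
Hypothesis hlam : is_lebesgue lam.
Implicit Types (x y v : V) (g f F U chi : V -> R).
Notation itg g := (lam.-integrable [set: T] (EFin \o (g : T -> R))).
Notation "'Int' g" := (Rintegral lam [set: T] (g : T -> R)) (at level 10, g at level 8).

Definition C1 F := (forall x, differentiable F x) /\ forall v, continuous ('D_v F).

Lemma C1_continuous F : C1 F -> continuous F.
Proof. by move=> [dF _] x; exact: differentiable_continuous. Qed.

Lemma ctsD f g : continuous f -> continuous g -> continuous (fun x => f x + g x).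
Proof. by move=> cf cg x; exact: (@cvgD R R^o V (nbhs x) _ f g _ _ (cf x) (cg x)). Qed.

Lemma ctsB f g : continuous f -> continuous g -> continuous (fun x => f x - g x).
Proof. by move=> cf cg x; exact: (@cvgB R R^o V (nbhs x) _ f g _ _ (cf x) (cg x)). Qed.

Lemma ctsM f g : continuous f -> continuous g -> continuous (fun x => f x * g x).
Proof. by move=> cf cg x; exact: (@cvgM R V (nbhs x) _ f g _ _ (cf x) (cg x)). Qed.

Lemma ctsC (c : R) : continuous ((fun=> c) : V -> R).
Proof. by move=> x; apply/continuous_epsP => e e0; exists 1 => // y _; rewrite subrr normr0. Qed.

Lemma cts_sum I (s : seq I) (f : I -> V -> R) :
  (forall i, continuous (f i)) -> continuous (fun x => \sum_(i <- s) f i x).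
Proof.
move=> h; elim: s => [|i s ih].
  by under eq_fun do rewrite big_nil; exact: ctsC.
by under eq_fun do rewrite big_cons; exact: ctsD.
Qed.

Lemma cts_comp (k : R -> R) F : continuous k -> continuous F -> continuous (fun x => k (F x)).
Proof. by move=> ck cF x; apply: continuous_comp; [exact: cF|exact: ck]. Qed.

Lemma C1_derive_sub f g x v : C1 f -> C1 g ->
  'D_v (fun y => f y - g y) x = 'D_v f x - 'D_v g x.
Proof.
by move=> [df _] [dg _]; rewrite (deriveB (diff_derivable (df x)) (diff_derivable (dg x))).
Qed.

Lemma C1_derive_mul f g x v : C1 f -> C1 g ->
  'D_v (fun y => f y * g y) x = f x * 'D_v g x + g x * 'D_v f x.
Proof.
by move=> [df _] [dg _]; rewrite (deriveM (diff_derivable (df x)) (diff_derivable (dg x))).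
Qed.

Lemma C1B f g : C1 f -> C1 g -> C1 (fun x => f x - g x).
Proof.
move=> cf cg; split=> [x|v]; first by apply: differentiableB; [case: cf|case: cg].
have -> : 'D_v (fun x => f x - g x) = (fun x => 'D_v f x - 'D_v g x).
  by apply/funext => x; exact: C1_derive_sub.
by apply: ctsB; [case: cf|case: cg].
Qed.

Lemma C1M f g : C1 f -> C1 g -> C1 (fun x => f x * g x).
Proof.
move=> cf cg; split=> [x|v]; first by apply: differentiableM; [case: cf|case: cg].
have -> : 'D_v (fun x => f x * g x) = (fun x => f x * 'D_v g x + g x * 'D_v f x).
  by apply/funext => x; exact: C1_derive_mul.
apply: ctsD; apply: ctsM; try exact: C1_continuous; by [case: cf|case: cg].
Qed.

Lemma C1_comp (k k' : R -> R) F : (forall t : R, is_derive t 1 k (k' t)) -> continuous k' ->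
  C1 F -> C1 (fun x => k (F x)) /\
  forall x v, 'D_v (fun x => k (F x)) x = k' (F x) * 'D_v F x.
Proof.
move=> dk ck' cF; have [dF DF] := cF.
have D x v : 'D_v (fun x => k (F x)) x = k' (F x) * 'D_v F x.
  by case: (comp_diff (dk (F x)) (dF x)) => _ ->.
split=> //; split=> [x|v]; first by case: (comp_diff (dk (F x)) (dF x)).
have -> : 'D_v (fun x => k (F x)) = (fun x => k' (F x) * 'D_v F x) by apply/funext => x.
by apply: ctsM => //; apply: cts_comp => //; exact: C1_continuous.
Qed.

Lemma bsupp_mull f g : bsupp f -> bsupp (fun x => f x * g x).
Proof. by move=> [M h]; exists M => x /h ->; rewrite mul0r. Qed.

Lemma bsupp_mulr f g : bsupp g -> bsupp (fun x => f x * g x).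
Proof. by move=> [M h]; exists M => x /h ->; rewrite mulr0. Qed.

Lemma bsupp_sum I (s : seq I) (f : I -> V -> R) :
  (forall i, bsupp (f i)) -> bsupp (fun x => \sum_(i <- s) f i x).
Proof.
move=> h; elim: s => [|i s [M ih]].
  by exists 0 => x _; rewrite big_nil.
have [N hN] := h i; exists (Num.max M N) => x; rewrite gt_max => /andP[xM xN].
by rewrite big_cons hN// ih// addr0.
Qed.

(* By translation invariance the difference quotients of [F] have integral zero. *)
Lemma Int_derive0 F v : C1 F -> bsupp F -> Int ('D_v F) = 0.
Proof.
move=> cF bF; have [dF DF] := cF; have cF0 := C1_continuous cF.
have bD := bsupp_derive v bF; have cD := DF v.
have iF := itg_bsupp hlam cF0 bF.
have [C C0 hC] := bsupp_bounded cD bD.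
have [M hM] := bF.
pose a (n : nat) : R := n.+1%:R^-1.
have a0 n : 0 < a n by rewrite invr_gt0.
have a1 n : a n <= 1 by rewrite invf_le1// ler1n.
pose f_ n x := (a n)^-1 * (F (x + a n *: v) - F x).
have if_ n : itg (f_ n) by exact: (itgZ _ (itgB (itg_shift hlam _ iF) iF)).
have If n : Int (f_ n) = 0.
  rewrite RintegralZl//; last exact: (itgB (itg_shift hlam _ iF) iF).
  by rewrite (RintegralB measurableT (itg_shift hlam _ iF) iF) Int_shift// subrr mulr0.
(* The quotients are values of [D_v F] at nearby points; this gives both the uniform bound [C] and
   the pointwise limit. *)
have f_E n x : exists2 t : R, 0 <= t <= 1 & f_ n x = 'D_v F (x + (t * a n) *: v).
  have [t t01 E] := MVT_line x (a n *: v) dF; exists t => //.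
  rewrite /f_ E deriveZv// mulrA mulVf ?mul1r ?scalerA//.
  by rewrite gt_eqF.
pose N := `|M| + `|v|.
have fN n x : N < `|x| -> f_ n x = 0.
  rewrite /N => xN; rewrite /f_ !hM ?subrr ?mulr0//.
    by apply: le_lt_trans xN; rewrite (le_trans (ler_norm M))// lerDl.
  have : `|x| <= `|x + a n *: v| + `|a n *: v|.
    by rewrite -{1}(addrK (a n *: v) x) ler_normB.
  have : `|a n *: v| <= `|v|.
    by rewrite normrZ ger0_norm ?(ltW (a0 n))// -[leRHS]mul1r ler_wpM2r.
  by have := ler_norm M; lra.
have icu : itg (fun x => C * \1_(cube N) x).
  apply: (@itg_locM _ _ lam (fun=> C) _ 1 N).
  - exact: L1loc_cst.
  - by apply: measurable_indic; exact: measurable_cube.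
  - by move=> y; rewrite indicE; case: (_ \in _); rewrite ?normr1 ?normr0.
  - move=> y yN; rewrite indicE memNset// => /cubeP; rewrite addr_ge0// => /(_ isT).
    by rewrite leNgt yN.
have [||//||_ _] := @dominated_convergence _ T R lam setT measurableT
  (fun n => EFin \o (f_ n : T -> R)) (EFin \o ('D_v F : T -> R))
  (EFin \o ((fun x => C * \1_(cube N) x) : T -> R))
  (fun n => measurable_int _ (if_ n)).
- by apply/measurable_EFinP; exact: measurable_continuous.
- apply: aeW => x _; apply: cvg_EFin; first exact: nearW.
  apply/cvgrPdist_lt => e e0.
  have [r r0 hr] := (continuous_epsP _ _).1 (cD x) e e0.
  have v0 : 0 < `|v| + 1 by rewrite ltr_wpDl.
  have := @near_infty_natSinv_lt R (PosNum (divr_gt0 r0 v0)).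
  apply: filterS => n /= hn; have [t /andP[t0 t1] ->] := f_E n x.
  apply: hr; rewrite opprD addrA subrr sub0r normrN normrZ normrM.
  rewrite (ger0_norm t0) (ger0_norm (ltW (a0 n))).
  move: hn; rewrite ltr_pdivlMr// => hn.
  apply: (le_lt_trans _ hn); rewrite -mulrA -[leRHS]mul1r ler_pM//.
    by rewrite mulr_ge0// ltW.
  by rewrite ler_wpM2l ?(ltW (a0 n))// lerDl.
- apply: aeW => x n _; rewrite /= lee_fin indicE.
  case: (boolP (x \in _)) => xN.
    by rewrite mulr1; have [t _ ->] := f_E n x.
  rewrite mulr0 fN ?normr0//.
  by move: xN; rewrite notin_setE => /cubeNP; rewrite addr_ge0// => /(_ isT).
have -> : [sequence (\int[lam]_(x in [set: T]) (EFin \o f_ n) x)%E]_n = fun=> 0%E.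
  apply/funext => n /=; rewrite -[LHS]fineK.
    by congr (_%:E); exact: If.
  exact: (integrable_fin_num measurableT (if_ n)).
move=> h; have := cvg_unique _ h (cvg_cst 0%E).
by move=> /(_ (@ereal_hausdorff R)) E; rewrite /Rintegral /= E.
Qed.

Notation grad F x := (\row_i 'D_(ebase i) F x : V).

(** With [a = chi * k' U] one has [grad w = a grad U + k U grad chi]. The terms in [grad U] then
    assemble into [Z . grad U], and there remains [k U * (|grad chi| - zeta . grad chi)], which is
    nonnegative by Cauchy-Schwarz. [Z] is a convex combination of [zeta] and [- z], hence has norm
    at most 1. *)
Lemma calibration (U chi : V -> R) (k k' : R -> R) (z zeta : V -> V) :
  C1 U -> C1 chi -> bsupp chi -> (forall x, 0 <= chi x <= 1) ->
  (forall t : R, is_derive t 1 k (k' t)) -> continuous k' ->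
  (forall t, 0 <= k t) -> (forall t, 0 <= k' t <= 1) ->
  (forall i, C1 (fun x => z x ord0 i)) -> (forall x, enorm (z x) <= 1) ->
  (forall x, dot (z x) (grad chi x) = - enorm (grad chi x)) ->
  (forall i, C1 (fun x => zeta x ord0 i)) -> (forall i, bsupp (fun x => zeta x ord0 i)) ->
  (forall x, enorm (zeta x) <= 1) ->
  let a x := chi x * k' (U x) in
  let Z x := (1 - a x) *: zeta x - a x *: z x in
  let w x := chi x * k (U x) in
  [/\ forall i, continuous (fun x => Z x ord0 i), forall i, bsupp (fun x => Z x ord0 i),
      forall x, enorm (Z x) <= 1 &
  Int (fun x => (U x - w x) * divg zeta x) - Int (fun x => w x * divg z x) <=
  - \sum_i Int (fun x => Z x ord0 i * 'D_(ebase i) U x)].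
Proof.
move=> cU cchi bchi chi01 dk ck' k0 k'01 cz z1 zchi cze bze ze1 a Z w.
have [ckU DkU] := C1_comp dk ck' cU.
have cw : C1 w by exact: C1M.
have cv : C1 (fun x => U x - w x) by exact: C1B.
have ca : continuous a.
  by apply: ctsM; [exact: C1_continuous|apply: cts_comp => //; exact: C1_continuous].
have a01 x : 0 <= a x <= 1.
  have /andP[c0 c1] := chi01 x; have /andP[d0 d1] := k'01 (U x).
  by rewrite /a mulr_ge0//= mulr_ile1.
have bw : bsupp w by exact: bsupp_mull.
have ZE i x : Z x ord0 i = (1 - a x) * zeta x ord0 i - a x * z x ord0 i by rewrite !mxE.
have cZ i : continuous (fun x => Z x ord0 i).
  under eq_fun do rewrite ZE.
  apply: ctsB; apply: ctsM => //; try exact: C1_continuous.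
  by apply: ctsB => //; exact: ctsC.
have bZ i : bsupp (fun x => Z x ord0 i).
  have [M hM] := bze i; have [N hN] := bchi; exists (Num.max M N) => x.
  rewrite gt_max => /andP[/hM xM /hN xN].
  by rewrite ZE xM /a xN !(mul0r, mulr0) subrr.
have Z1 x : enorm (Z x) <= 1.
  have /andP[h0 h1] := a01 x.
  rewrite (le_trans (enormD _ _))// enormN !enormZ (ger0_norm h0) ger0_norm ?subr_ge0//.
  have : (1 - a x) * enorm (zeta x) <= (1 - a x) * 1 by rewrite ler_wpM2l// subr_ge0.
  have : a x * enorm (z x) <= a x * 1 by rewrite ler_wpM2l.
  by lra.
split => //.
have cdz : continuous (divg z) by apply: cts_sum => i; case: (cz i) => _; exact.
have cdze : continuous (divg zeta) by apply: cts_sum => i; case: (cze i) => _; exact.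
have bdze : bsupp (divg zeta) by apply: bsupp_sum => i; exact: bsupp_derive.
have I1 : itg (fun x => (U x - w x) * divg zeta x).
  apply: (itg_bsupp hlam); last exact: bsupp_mulr.
  by apply: ctsM => //; exact: C1_continuous.
have I2 : itg (fun x => w x * divg z x).
  apply: (itg_bsupp hlam); last exact: bsupp_mull.
  by apply: ctsM => //; exact: C1_continuous.
have I3 i : itg (fun x => Z x ord0 i * 'D_(ebase i) U x).
  apply: (itg_bsupp hlam); last exact: bsupp_mull.
  by apply: ctsM => //; case: cU.
have cA i : C1 (fun x => (U x - w x) * zeta x ord0 i) by exact: C1M.
have cB i : C1 (fun x => w x * z x ord0 i) by exact: C1M.
have bA i : bsupp (fun x => (U x - w x) * zeta x ord0 i) by exact: bsupp_mulr.
have bB i : bsupp (fun x => w x * z x ord0 i) by exact: bsupp_mull.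
have IA i : itg ('D_(ebase i) (fun x => (U x - w x) * zeta x ord0 i)).
  by apply: (itg_bsupp hlam); [case: (cA i)|exact: bsupp_derive].
have IB i : itg ('D_(ebase i) (fun x => w x * z x ord0 i)).
  by apply: (itg_bsupp hlam); [case: (cB i)|exact: bsupp_derive].
(* The fields [(U - w) zeta] and [w z] are C1 with bounded support, so their divergences integrate
   to zero; the claim is thereby reduced to a pointwise inequality. *)
have E0 : Int (fun x => \sum_i 'D_(ebase i) (fun x => (U x - w x) * zeta x ord0 i) x
       - \sum_i 'D_(ebase i) (fun x => w x * z x ord0 i) x) = 0.
  rewrite (RintegralB measurableT (itg_sum _ IA) (itg_sum _ IB)) !Int_sum//.
  by rewrite !big1 ?subrr// => i _; exact: Int_derive0.
have ILt := itgD (itgB I1 I2) (itg_sum (index_enum 'I_d) I3).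
rewrite -subr_ge0 -opprD oppr_ge0 -(Int_sum _ I3) -(RintegralB measurableT I1 I2).
rewrite addrC -(RintegralD measurableT (itgB I1 I2) (itg_sum _ I3)) -[leRHS]E0.
apply: le_Int => //; first exact: (itgB (itg_sum _ IA) (itg_sum _ IB)).
move=> x.
have Dw i : 'D_(ebase i) w x = a x * 'D_(ebase i) U x + k (U x) * 'D_(ebase i) chi x.
  by rewrite C1_derive_mul// DkU /a mulrA.
have -> : \sum_i 'D_(ebase i) (fun x => (U x - w x) * zeta x ord0 i) x =
   (U x - w x) * divg zeta x + \sum_i zeta x ord0 i * ('D_(ebase i) U x - 'D_(ebase i) w x).
  rewrite /divg mulr_sumr -big_split; apply: eq_bigr => i _ /=.
  by rewrite C1_derive_mul// C1_derive_sub.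
have -> : \sum_i 'D_(ebase i) (fun x => w x * z x ord0 i) x =
   w x * divg z x + \sum_i z x ord0 i * 'D_(ebase i) w x.
  rewrite /divg mulr_sumr -big_split; apply: eq_bigr => i _ /=.
  by rewrite C1_derive_mul.
have key : \sum_i zeta x ord0 i * ('D_(ebase i) U x - 'D_(ebase i) w x)
  - \sum_i z x ord0 i * 'D_(ebase i) w x - \sum_i Z x ord0 i * 'D_(ebase i) U x
  = k (U x) * (- dot (zeta x) (grad chi x) - dot (z x) (grad chi x)).
  rewrite /dot -!sumrN -!big_split mulr_sumr; apply: eq_bigr => i _ /=.
  by rewrite Dw ZE mxE; ring.
have : 0 <= k (U x) * (- dot (zeta x) (grad chi x) - dot (z x) (grad chi x)).
  rewrite mulr_ge0// zchi opprK addrC subr_ge0.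
  rewrite (le_trans (ler_norm _))// (le_trans (dot_CS _ _))//.
  by rewrite -[leRHS]mul1r ler_wpM2r ?enorm_ge0.
by rewrite -key; lra.
Qed.

End Calibration.

(** * Translations and mollification in L1 *)

Section Translation.
Variables (R : realType) (d : nat).
Local Notation V := 'rV[R]_d.
Local Notation T := (Rd R d).
Variable lam : {measure set T -> \bar R}.
Hypothesis hlam : is_lebesgue lam.
Implicit Types (x y v : V) (g f F U chi : V -> R).
Notation itg g := (lam.-integrable [set: T] (EFin \o (g : T -> R))).
Notation "'Int' g" := (Rintegral lam [set: T] (g : T -> R)) (at level 10, g at level 8).

(** Continuity at 0 of translation in L1. It holds for boxes by computation and spreads to Borel
    subsets of a cube by Dynkin's argument, then to simple functions and their L1 limits. *)
Definition tcont g := forall e : R, 0 < e -> exists2 r : R, 0 < r &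
  forall h : V, `|h| < r -> Int (fun x => `|g (x + h) - g x|) <= e.

Let itgs g h : itg g -> itg (fun x => `|g (x + h) - g x|).
Proof. by move=> ig; exact: (integrable_norm (itgB (itg_shift hlam h ig) ig)). Qed.

Lemma tcontD f g : itg f -> itg g -> tcont f -> tcont g -> tcont (fun x => f x + g x).
Proof.
move=> jf jg tf tg e e0; have e2 : 0 < e / 2 by rewrite divr_gt0.
have [r r0 hr] := tf _ e2; have [s s0 hs] := tg _ e2.
exists (Num.min r s) => [|h]; first by rewrite lt_min r0.
rewrite lt_min => /andP[/hr h1 /hs h2].
rewrite (splitr e); apply: le_trans (lerD h1 h2).
rewrite -(RintegralD measurableT (itgs h jf) (itgs h jg)).
apply: le_Int; [exact: itgs (itgD jf jg)|exact: itgD (itgs h jf) (itgs h jg)|].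
by move=> x; rewrite opprD addrACA ler_normD.
Qed.

Lemma tcontZ (c : R) f : itg f -> tcont f -> tcont (fun x => c * f x).
Proof.
move=> jf tf e e0; have c0 : 0 < `|c| + 1 by rewrite ltr_wpDl.
have [|r r0 hr] := tf (e / (`|c| + 1)); first by rewrite divr_gt0.
exists r => // h /hr h1.
have -> : (fun x => `|c * f (x + h) - c * f x|) = (fun x => `|c| * `|f (x + h) - f x|).
  by apply/funext => x; rewrite -mulrBr normrM.
rewrite (RintegralZl _ measurableT (itgs h jf)).
apply: (@le_trans _ _ ((`|c| + 1) * (e / (`|c| + 1)))); last by rewrite mulrC divfK// gt_eqF.
by rewrite ler_pM// ?lerDl// Rintegral_ge0.
Qed.

Lemma tcont_sum I (s : seq I) (f : I -> V -> R) : (forall i, itg (f i)) ->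
  (forall i, tcont (f i)) -> tcont (fun x => \sum_(i <- s) f i x).
Proof.
move=> jf tf; elim: s => [|i s ih].
  move=> e e0; exists 1 => // h _; rewrite Int0 ?ltW// => x.
  by rewrite !big_nil subrr normr0.
have -> : (fun x => \sum_(j <- i :: s) f j x) = (fun x => f i x + \sum_(j <- s) f j x).
  by apply/funext => x; rewrite big_cons.
by apply: tcontD => //; exact: itg_sum.
Qed.

(** The three-term splitting: by translation invariance the shifted error [g - f] costs as much as
    the unshifted one. *)
Lemma tcont_lim g : itg g ->
  (forall e : R, 0 < e -> exists f, [/\ itg f, tcont f & Int (fun x => `|g x - f x|) <= e]) ->
  tcont g.
Proof.
move=> jg hg e e0; have e3 : 0 < e / 3 by rewrite divr_gt0.
have [f [jf tf gf]] := hg _ e3; have [r r0 hr] := tf _ e3.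
exists r => // h /hr h1.
have j1 : itg (fun x => `|g x - f x|) by exact: (integrable_norm (itgB jg jf)).
have j2 := itg_shift hlam h j1.
apply: (@le_trans _ _ (Int (fun x => `|g (x + h) - f (x + h)| + `|g x - f x| + `|f (x + h) - f x|))).
  apply: le_Int; [exact: itgs|exact: itgD (itgD j2 j1) (itgs h jf)|move=> x].
  have -> : g (x + h) - g x = (g (x + h) - f (x + h)) - (g x - f x) + (f (x + h) - f x) by ring.
  by rewrite (le_trans (ler_normD _ _))// lerD2r ler_normB.
rewrite (RintegralD measurableT (itgD j2 j1) (itgs h jf)) (RintegralD measurableT j2 j1).
by rewrite (Int_shift hlam h j1); lra.
Qed.

Lemma itg_indic (A : set V) (N : R) : measurable (A : set T) -> (forall x, A x -> `|x| <= N) ->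
  itg (\1_A : V -> R).
Proof.
move=> mA AN; have -> : (\1_A : V -> R) = (fun y => 1 * \1_A y) by apply/funext => y; rewrite mul1r.
apply: (@itg_locM _ _ lam (fun=> 1) _ 1 N).
- exact: L1loc_cst.
- exact: measurable_indic.
- by move=> y; rewrite indicE; case: (_ \in _); rewrite ?normr1 ?normr0.
- by move=> y yN; rewrite indicE memNset// => /AN; rewrite leNgt yN.
Qed.

Lemma Int_indic (A : set V) : measurable (A : set T) -> Int (\1_A : V -> R) = fine (lam (A : set T)).
Proof. by move=> mA; rewrite /Rintegral integral_indic// setIT. Qed.

Lemma cts_prod I (s : seq I) (f : I -> V -> R) :
  (forall i, continuous (f i)) -> continuous (fun x => \prod_(i <- s) f i x).
Proof.
move=> h; elim: s => [|i s ih].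
  by under eq_fun do rewrite big_nil; exact: ctsC.
by under eq_fun do rewrite big_cons; exact: ctsM.
Qed.

Lemma box_bounded a b : exists N : R, forall x, box a b x -> `|x| <= N.
Proof.
exists (`|a| + `|b|) => x h; apply: norm_leP => [|i]; first by rewrite addr_ge0.
have := coord_le_norm a i; have := coord_le_norm b i; have := h i.
rewrite !ler_norml => /andP[h1 h2] /andP[h3 h4] /andP[h5 h6].
have := normr_ge0 a; have := normr_ge0 b => *; apply/andP; split; lra.
Qed.

Lemma max0_dist (c p q : R) : `|Num.max 0 (c - p) - Num.max 0 (c - q)| <= `|p - q|.
Proof.
have [h1|h1] := leP 0 (c - p); have [h2|h2] := leP 0 (c - q);
  by have [h|h] := ger0P (p - q); rewrite ler_norml; apply/andP; split; lra.
Qed.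

(** The box and its translate meet in a box with sides [max 0 (b_i - a_i - |h_i|)]. The L1 distance
    of the two indicators is thus [2 * (H 0 - H h)] with [H] continuous. *)
Lemma tcont_box a b : tcont (\1_(box a b) : V -> R).
Proof.
have [N hN] := box_bounded a b; have mB := measurable_box a b.
have jB := itg_indic mB hN.
pose H (h : V) : R := \prod_(i < d) Num.max 0 (b ord0 i - a ord0 i - `|h ord0 i|).
have cH : continuous H.
  apply: cts_prod => i x; apply/continuous_epsP => e e0; exists e => // y xy.
  apply: le_lt_trans xy; apply: (@le_trans _ _ `|x ord0 i - y ord0 i|); last first.
    by have := coord_le_norm (x - y) i; rewrite !mxE.
  apply: (@le_trans _ _ `| `|x ord0 i| - `|y ord0 i| |); last exact: ler_dist_dist.
  exact: max0_dist.
have IH h : Int (fun x => `|\1_(box a b) (x + h) - \1_(box a b) x|) = 2 * (H 0 - H h).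
  pose a' : V := \row_i Num.max (a ord0 i) (a ord0 i - h ord0 i).
  pose b' : V := \row_i Num.min (b ord0 i) (b ord0 i - h ord0 i).
  have [N' hN'] := box_bounded a' b'.
  have jB' := itg_indic (measurable_box a' b') hN'.
  (* For numbers [p], [q] equal to 0 or 1, [|p - q| = p + q - 2 p q], and the product is the
     indicator of the intersection. *)
  have E x : `|\1_(box a b) (x + h) - \1_(box a b) x| =
     \1_(box a b) (x + h) + \1_(box a b) x - 2 * \1_(box a' b') x :> R.
    have -> : \1_(box a' b') x = \1_(box a b) (x + h) * \1_(box a b) x :> R.
      have P : box a' b' x <-> box a b (x + h) /\ box a b x.
        split=> [hx|[h1 h2] i]; last first.
          have := h1 i; have := h2 i; rewrite !mxE ge_max le_min.
          by move=> /andP[-> ->] /andP[? ?] /=; rewrite lerBlDr lerBrDr; apply/andP.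
        split=> i; have := hx i; rewrite !mxE ge_max le_min.
          by rewrite lerBlDr lerBrDr => /andP[/andP[? ?] /andP[? ?]]; apply/andP.
        by move=> /andP[/andP[? ?] /andP[? ?]]; apply/andP.
      rewrite !indicE -natrM mulnb; congr (nat_of_bool _)%:R.
      by apply/idP/andP; rewrite !inE; apply P.
    rewrite !indicE; case: (_ \in _); case: (_ \in _);
      rewrite /= ?mulr1n ?mulr0n ?subrr ?subr0 ?sub0r ?normrN ?normr0 ?normr1; ring.
  rewrite (funext E).
  have jS := itg_shift hlam h jB.
  rewrite (RintegralB measurableT (itgD jS jB) (itgZ 2 jB')) (RintegralD measurableT jS jB).
  rewrite (Int_shift hlam h jB) (RintegralZl 2 measurableT jB').
  rewrite !Int_indic ?lam_box//=; [|exact: measurable_box..].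
  have -> : \prod_(i < d) Num.max 0 (b ord0 i - a ord0 i) = H 0.
    by apply: eq_bigr => i _; rewrite mxE normr0 subr0.
  have -> : \prod_(i < d) Num.max 0 (b' ord0 i - a' ord0 i) = H h.
    apply: eq_bigr => i _; congr Num.max; rewrite !mxE.
    by have [h0|h0] := ger0P (h ord0 i);
      [rewrite min_r ?max_l|rewrite min_l ?max_r]; lra.
  by ring.
move=> e e0; have [|r r0 hr] := (continuous_epsP H 0).1 (cH 0) (e / 2); first by rewrite divr_gt0.
exists r => // h hhr; rewrite IH.
have /hr : `|0 - h| < r by rewrite sub0r normrN.
by move=> /(le_lt_trans (ler_norm _)); lra.
Qed.

(** Sets satisfying the claim contain the pi-system of boxes and form a Dynkin class. Intersecting
    with a fixed cube keeps all measures finite, so that complements become differences of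
    integrable functions. *)
Lemma tcont_indic (A : set V) (N : R) : 0 <= N -> measurable (A : set T) ->
  tcont (\1_(A `&` cube N) : V -> R).
Proof.
move=> N0; have mQ := @measurable_cube R d N.
have bQ (B : set V) x : (B `&` cube N) x -> `|x| <= N by move=> [_ /(cubeP _ N0)].
have jQ (B : set V) : measurable (B : set T) -> itg (\1_(B `&` cube N) : V -> R).
  by move=> mB; apply: (@itg_indic _ N) => [|x]; [exact: measurableI|exact: bQ].
move: A; apply: (@dynkin_induction _ T (@boxes R d)) => //.
- exact: setI_closed_boxes.
- by rewrite setTI; exact: tcont_box.
- move=> B bB; have [a [b ->]] : boxes (B `&` cube N).
    apply: setI_closed_boxes => //; exists (const_mx (- N)), (const_mx N) => //.
  exact: tcont_box.
- move=> S mS tS.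
  have -> : (\1_(~` S `&` cube N) : V -> R) = (fun x => \1_(setT `&` cube N) x + (-1) * \1_(S `&` cube N) x).
    apply/funext => x; rewrite !indicE setTI.
    rewrite !in_setI in_setC; case: (x \in S); case: (x \in cube N) => /=; ring.
  apply: tcontD.
  + exact: jQ.
  + by apply: (itgZ (-1)); exact: jQ.
  + by rewrite setTI; exact: tcont_box.
  + by apply: tcontZ => //; exact: jQ.
- move=> F mF tF hF; have mU : measurable (\bigcup_k F k : set T) by exact: bigcupT_measurable.
  apply: tcont_lim; first exact: jQ.
  move=> e e0.
  pose G k : set T := F k `&` cube N.
  have mG k : measurable (G k) by exact: measurableI.
  have tG : trivIset setT G.
    exact: trivIset_setIr tF.
  have GU : \bigcup_k G k = (\bigcup_k F k) `&` cube N by rewrite setI_bigcupl.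
  have fG k : (lam (G k) < +oo)%E by apply: (@lam_bounded_lty _ _ _ hlam _ N) => // x; exact: bQ.
  (* Sigma-additivity says that the partial sums of the disjoint indicators converge in L1;
     [tcont_lim] then handles the countable union. *)
  have := @measure_semi_sigma_additive _ T R lam G mG tG.
  rewrite GU; move=> /(_ (measurableI _ _ mU mQ)) cv.
  have fU : lam ((\bigcup_k F k) `&` cube N) \is a fin_num.
    rewrite ge0_fin_numE//; apply: (@lam_bounded_lty _ _ _ hlam _ N); first exact: measurableI.
    by move=> x; exact: bQ.
  move: cv; rewrite -(fineK fU) => /fine_cvgP[_ /cvgrPdist_lt/(_ e e0)] [n _ hn].
  have {hn} := hn n (leqnn n) => hn.
  exists (fun x => \sum_(i < n) \1_(G i) x); split.
  + by apply: (@itg_sum _ _ lam _ (index_enum 'I_n) (fun i => \1_(G i))) => i; exact: jQ.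
  + by apply: (@tcont_sum _ (index_enum 'I_n) (fun i => \1_(G i))) => i; [exact: jQ|exact: hF].
  + have jU := jQ _ mU.
    have jS : itg (fun x => \sum_(i < n) \1_(G i) x).
      by apply: (@itg_sum _ _ lam _ (index_enum 'I_n) (fun i => \1_(G i))) => i; exact: jQ.
    have E x : `|\1_((\bigcup_k F k) `&` cube N) x - \sum_(i < n) \1_(G i) x| =
        \1_((\bigcup_k F k) `&` cube N) x - \sum_(i < n) \1_(G i) x :> R.
      apply: ger0_norm; rewrite subr_ge0 -GU indicE; case: (boolP (x \in _)) => xU; last first.
        rewrite big1// => i _; rewrite indicE memNset// => Gx.
        by move/negP: xU; apply; rewrite inE; exists i.
      move: xU; rewrite inE => -[j _ Gj].
      have Gi i : i != j -> \1_(G i) x = 0 :> R.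
        move=> ij; rewrite indicE memNset// => Gx.
        by move/eqP: ij; apply; apply: tG => //; exists x.
      case: (ltnP j n) => jn; last first.
        by rewrite big1 => [|i _]; [exact: ler01|apply: Gi; rewrite ltn_eqF// (leq_trans (ltn_ord i))].
      rewrite (bigD1 (Ordinal jn))//= big1 ?addr0 => [|i ij]; last by apply: Gi.
      by rewrite indicE mem_set.
    rewrite (funext E).
    rewrite (RintegralB measurableT jU jS) Int_sum; last by move=> i; exact: jQ.
    rewrite Int_indic; last exact: measurableI.
    apply: ltW; apply: le_lt_trans hn; apply: le_trans (ler_norm _).
    rewrite lerB// /= big_mkord -sum_fine; last by move=> i _; rewrite ge0_fin_numE.
    by apply: ler_sum => i _; rewrite Int_indic.
Qed.

End Translation.

Import HBSimple.

(** * Local L1 convergence of mollifications *)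

Section MollifyL1.
Variables (R : realType) (d : nat).
Local Notation V := 'rV[R]_d.
Local Notation T := (Rd R d).
Variable lam : {measure set T -> \bar R}.
Hypothesis hlam : is_lebesgue lam.
Implicit Types (x y v : V) (g f F U chi : V -> R).
Notation itg g := (lam.-integrable [set: T] (EFin \o (g : T -> R))).
Notation "'Int' g" := (Rintegral lam [set: T] (g : T -> R)) (at level 10, g at level 8).

(** Simple functions approximate [g] in L1 on the cube, and each is a finite combination of
    indicators already treated. *)
Lemma tcont_cube g (N : R) : 0 <= N -> itg g -> (forall x, ~ cube N x -> g x = 0) ->
  tcont lam g.
Proof.
move=> N0 jg gN; apply: (tcont_lim hlam jg) => e e0.
have mQ := @measurable_cube R d N.
have jgQ : lam.-integrable (cube N : set T) (EFin \o (g : T -> R)).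
  exact: (integrableS measurableT mQ _ jg).
have [g_ [ig_ _ cv]] := approximation_sfun_integrable mQ jgQ.
have /fine_cvgP[fin /cvgrPdist_lt/(_ e e0) ev] := cv.
have [n [Fn en]] : exists n, (\int[lam]_(z in (cube N : set T)) `|(g z)%:E - (g_ n z)%:E|)%E \is a fin_num /\
   fine (\int[lam]_(z in (cube N : set T)) `|(g z)%:E - (g_ n z)%:E|)%E < e.
  have [n [h1 h2]] := filter_ex (filterI fin ev); exists n; split => //.
  by move: h2 => /=; rewrite sub0r normrN; apply: le_lt_trans; exact: ler_norm.
pose f x := \sum_(y <- finmap.enum_fset (fset_set (range (g_ n)))) y * \1_(g_ n @^-1` [set y] `&` cube N) x.
have mP (t : R) : measurable (g_ n @^-1` [set t] : set T).
  by rewrite -[X in measurable X]setTI; exact: (measurable_funP (g_ n)).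
have jP (t : R) : itg (\1_(g_ n @^-1` [set t] `&` cube N) : V -> R).
  apply: (@itg_indic _ _ _ hlam _ N); first exact: measurableI.
  by move=> x [_ /(cubeP _ N0)].
have fE x : f x = g_ n x * \1_(cube N) x.
  rewrite /f (fimfunE (g_ n) x) fsbig_finite//= mulr_suml.
  apply: eq_bigr => y _; rewrite -mulrA; congr (_ * _).
  by rewrite !indicE in_setI -natrM mulnb.
have jf : itg f by apply: itg_sum => y; exact: (itgZ y (jP y)).
exists f; split=> //.
  apply: (tcont_sum hlam) => y; first exact: (itgZ y (jP y)).
  by apply: (tcontZ hlam) => //; exact: (tcont_indic hlam N0 (mP y)).
apply: ltW; apply: le_lt_trans en; rewrite le_eqVlt; apply/orP; left; apply/eqP.
congr fine; rewrite [RHS]integral_mkcond; apply: eq_integral => x _.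
rewrite patchE fE indicE; case: (boolP (x \in cube N)) => xN; first by rewrite mulr1.
by rewrite mulr0 subr0 gN ?normr0//; move: xN; rewrite notin_setE.
Qed.

(** By Tonelli the L1 error of [g * eta] is at most the [eta]-average of the L1 distances between
    [g] and its translates. As [u] is only locally integrable, this is applied to its restriction
    [g] to the cube of half-side [M + 1]. *)
Lemma mollify_L1 (u : V -> R) (M e : R) : L1loc lam u -> 0 <= M -> 0 < e ->
  exists2 r : R, 0 < r <= 1 & forall eta, mollifier lam r eta ->
    Int (fun x => `|convol lam u eta x - u x| * \1_(cube M) x) <= e.
Proof.
move=> lu M0 e0.
have N0 : 0 <= M + 1 by rewrite addr_ge0.
pose g x : R := u x * \1_(cube (M + 1)) x.
have mQ N : measurable (cube N : set T) := measurable_cube N.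
have m1 N : measurable_fun [set: T] (\1_(cube N) : T -> R) by exact: measurable_indic.
have b1 N x : `|\1_(cube N) x| <= 1 :> R.
  by rewrite indicE; case: (_ \in _); rewrite ?normr1 ?normr0.
have s1 N x : 0 <= N -> N < `|x| -> \1_(cube N) x = 0 :> R.
  by move=> N0' xN; rewrite indicE memNset// => /(cubeP _ N0'); rewrite leNgt xN.
have jg : itg g by apply: (itg_locM lu (m1 _) (b1 _)) => x; exact: s1.
have [|r0 r00 hr] := @tcont_cube g (M + 1) N0 jg _ e e0.
  by move=> x xN; rewrite /g indicE memNset// mulr0.
(* A radius below 1 keeps the convolutions of [u] and of [g] equal on the cube of half-side [M]; a
   radius below [r0] bounds the translation error by [e]. *)
exists (Num.min r0 1 / 2); first by rewrite divr_gt0 ?lt_min ?r00//= ler_pdivrMr// ge_min; apply/orP; right; lra.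
set r := _ / 2 => eta heta.
have rr0 : r < r0 by rewrite /r ltr_pdivrMr// gt_min; apply/orP; left; lra.
have r1 : r < 1 by rewrite /r ltr_pdivrMr// gt_min; apply/orP; right; lra.
case: (heta) => k eta0 ev eM I1.
have ceta := smoothc_continuous k; have beta := k.2.
have jeta := itg_bsupp hlam ceta beta.
have lg := itg_L1loc jg.
pose D x := `|convol lam g eta x - g x|.
have mcg : measurable_fun [set: T] (convol lam g eta : T -> R).
  apply: measurable_continuous => x; apply: differentiable_continuous.
  by case: (conv_diff lg k x).
have mD : measurable_fun [set: T] (D : T -> R).
  by apply: measurableT_comp => //; apply: measurable_funB => //; exact: itg_measurable jg.
have cE x : convol lam g eta x = Int (fun y => g (x + y) * eta y).
  rewrite /convol -(Int_shift hlam x (itg_conv x lg ceta beta)).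
  congr (Int _); apply/funext => y.
  by rewrite opprD addrA addrAC subrr sub0r ev (addrC y).
have jxy x : itg (fun y => g (x + y) * eta y).
  have := itg_shift hlam x (itg_conv x lg ceta beta).
  congr (lam.-integrable _ _); apply/funext => y /=; congr (_%:E).
  by rewrite opprD addrA addrAC subrr sub0r ev (addrC y).
have jx x : itg (fun y => g x * eta y) by exact: itgZ.
have jd x : itg (fun y => `|g (x + y) - g x| * eta y).
  have := integrable_norm (itgB (jxy x) (jx x)).
  congr (lam.-integrable _ _); apply/funext => y /=; congr (_%:E).
  by rewrite -mulrBl normrM (ger0_norm (eta0 y)).
have D1 x : D x <= Int (fun y => `|g (x + y) - g x| * eta y).
  have gE : g x = Int (fun y => g x * eta y) by rewrite (RintegralZl _ measurableT jeta) I1 mulr1.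
  rewrite /D cE [X in _ - X]gE -(RintegralB measurableT (jxy x) (jx x)).
  apply: (le_trans (le_normr_Rintegral measurableT (itgB (jxy x) (jx x)))).
  apply: le_Int => //; first exact: (integrable_norm (itgB (jxy x) (jx x))).
  by move=> y; rewrite -mulrBl normrM (ger0_norm (eta0 y)).
have mg := itg_measurable jg; have meta := itg_measurable jeta.
have mF : measurable_fun [set: T * T]
    (fun p : T * T => (`|g (p.1 + p.2) - g p.1| * eta p.2)%:E).
  apply/measurable_EFinP; apply: measurable_funM.
    apply: measurableT_comp => //; apply: measurable_funB.
      exact: (measurableT_comp mg (@measurable_addr R d)).
    exact: (measurableT_comp mg measurable_fst).
  exact: (measurableT_comp meta measurable_snd).
have mF' : measurable_fun [set: T * T]
    (fun p : T * T => (`|g (p.2 + p.1) - g p.2| * eta p.1)%:E).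
  apply/measurable_EFinP; apply: measurable_funM.
    apply: measurableT_comp => //; apply: measurable_funB.
      under eq_fun do rewrite addrC.
      exact: (measurableT_comp mg (@measurable_addr R d)).
    exact: (measurableT_comp mg measurable_snd).
  exact: (measurableT_comp meta measurable_fst).
have tot : (\int[lam]_(x in [set: T]) (D x)%:E <= e%:E)%E.
  apply: (@le_trans _ _ (\int[lam]_(x in [set: T]) \int[lam]_(y in [set: T])
      (`|g (x + y) - g x| * eta y)%:E)%E).
    apply: ge0_le_integral => //.
    - by move=> x _; rewrite lee_fin normr_ge0.
    - exact/measurable_EFinP.
    - apply: (@measurable_tonelli _ _ _ hlam (fun x y => (`|g (x + y) - g x| * eta y)%:E)) => //.
      by move=> x y; rewrite lee_fin mulr_ge0.
    - move=> x _; rewrite -[leRHS]fineK; first by rewrite lee_fin; exact: D1.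
      exact: (integrable_fin_num measurableT (jd x)).
  rewrite (@tonelli _ _ _ hlam (fun x y => (`|g (x + y) - g x| * eta y)%:E)) //; last first.
    by move=> x y; rewrite lee_fin mulr_ge0.
  apply: (@le_trans _ _ (\int[lam]_(y in [set: T]) (e * eta y)%:E)%E); last first.
    rewrite -[leLHS]fineK; last exact: (integrable_fin_num measurableT (itgZ e jeta)).
    by rewrite lee_fin -[X in X <= _]/(Int (fun y => e * eta y)) (RintegralZl _ measurableT jeta) I1 mulr1.
  apply: ge0_le_integral => //.
  - by move=> y _; apply: integral_ge0 => x _; rewrite lee_fin mulr_ge0.
  - apply: (@measurable_tonelli _ _ _ hlam (fun y x => (`|g (x + y) - g x| * eta y)%:E)) => //.
    by move=> y x; rewrite lee_fin mulr_ge0.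
  - by apply/measurable_EFinP; exact: itg_measurable (itgZ e jeta).
  - move=> y _.
    have jy : itg (fun x => `|g (x + y) - g x|).
      exact: (integrable_norm (itgB (itg_shift hlam y jg) jg)).
    have jy' : itg (fun x => `|g (x + y) - g x| * eta y).
      by have := itgZ (eta y) jy; under eq_fun do rewrite mulrC.
    rewrite -[leLHS]fineK; last exact: (integrable_fin_num measurableT jy').
    rewrite lee_fin -[X in X <= _]/(Int (fun x => `|g (x + y) - g x| * eta y)).
    rewrite (RintegralZr _ measurableT jy).
    have [yr|yr] := ltP r `|y|; first by rewrite eM// !mulr0.
    by rewrite ler_wpM2r// hr// (le_lt_trans yr).
have jD : itg D.
  apply/integrableP; split; first exact/measurable_EFinP.
  rewrite (eq_integral (fun x : T => (D x)%:E)) => [|x _]; last first.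
    by rewrite /= ger0_norm ?normr_ge0.
  by rewrite (le_lt_trans tot)// ltry.
have uD x : `|convol lam u eta x - u x| * \1_(cube M) x <= D x.
  rewrite indicE; case: (boolP (x \in cube M)) => [/set_mem/(cubeP _ M0) xM|_]; last first.
    by rewrite mulr0 normr_ge0.
  rewrite mulr1.
  have inQ y : `|y| <= M + 1 -> \1_(cube (M + 1)) y = 1 :> R.
    by move=> yM; rewrite indicE mem_set//; apply/cubeP.
  have -> : u x = g x by rewrite /g inQ ?mulr1//; lra.
  suff -> : convol lam u eta x = convol lam g eta x by [].
  congr (Int _); apply/funext => y.
  have [yr|yr] := ltP r `|x - y|; first by rewrite eM// !mulr0.
  rewrite /g inQ ?mulr1//.
  have : `|y| <= `|x - y| + `|x| by rewrite distrC -{1}(subrK x y) ler_normD.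
  by move=> *; lra.
rewrite -lee_fin; apply: le_trans tot.
rewrite -[leRHS]fineK; last exact: (integrable_fin_num measurableT jD).
rewrite lee_fin; apply: le_Int => //.
  apply: (le_itg _ jD).
    apply: measurable_funM => //; apply: measurableT_comp => //.
    apply: measurable_funB; last by case: lu.
    apply: measurable_continuous => x; apply: differentiable_continuous.
    by case: (conv_diff lu k x).
  by move=> x; rewrite ger0_norm ?mulr_ge0// ?indicE// (ger0_norm (normr_ge0 _)) -indicE.
Qed.

End MollifyL1.

(** * Total variation of the truncated function *)

Section Truncation.
Variables (R : realType) (d : nat).
Local Notation V := 'rV[R]_d.
Local Notation T := (Rd R d).
Variable lam : {measure set T -> \bar R}.
Hypothesis hlam : is_lebesgue lam.
Implicit Types (x y v : V) (g f F U chi : V -> R).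
Notation itg g := (lam.-integrable [set: T] (EFin \o (g : T -> R))).
Notation "'Int' g" := (Rintegral lam [set: T] (g : T -> R)) (at level 10, g at level 8).

Notation grad F x := (\row_i 'D_(ebase i) F x : V).

Lemma test_field_C1 (zeta : V -> V) : test_field zeta ->
  [/\ forall i, C1 (fun x => zeta x ord0 i), forall i, bsupp (fun x => zeta x ord0 i) &
      forall x, enorm (zeta x) <= 1].
Proof.
move=> [sz cz z1]; split=> // i.
  have dz x : differentiable zeta x by exact: (sz [::] x).
  have dzv v x : differentiable ('D_v zeta) x by exact: (sz [:: v] x).
  have dc (G : V -> V) x : differentiable G x -> differentiable (fun y => G y ord0 i) x.
    move=> dG; apply: (@differentiable_comp _ _ _ _ G (fun y : V => y ord0 i)) => //.
    exact: differentiable_coord.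
  split=> [x|v]; first exact: dc.
  have -> : 'D_v (fun x => zeta x ord0 i) = (fun x => 'D_v zeta x ord0 i).
    by apply/funext => x; rewrite derive_mx ?mxE//; exact: diff_derivable.
  by move=> x; apply: differentiable_continuous; exact: dc.
have [M [_ hM]] := compact_bounded cz.
exists (M + 1) => x xM; apply/eqP; apply: contraTT xM => zx; rewrite -leNgt.
apply: (hM (M + 1)); first by rewrite ltrDl.
apply: subset_closure => /=; apply: contra_neq zx => ->.
by rewrite mxE.
Qed.

Section Cut.
Variables (u chi : V -> R) (k k' : R -> R) (z : V -> V).
Hypothesis lu : L1loc lam u.
Hypothesis cchi : C1 chi.
Hypothesis bchi : bsupp chi.
Hypothesis chi01 : forall x, 0 <= chi x <= 1.
Hypothesis dk : forall t : R, is_derive t 1 k (k' t).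
Hypothesis ck' : continuous k'.
Hypothesis k0 : forall t, 0 <= k t.
Hypothesis k'01 : forall t, 0 <= k' t <= 1.
Hypothesis klip : forall s t, `|k s - k t| <= `|s - t|.
Hypothesis cz : forall i, C1 (fun x => z x ord0 i).
Hypothesis z1 : forall x, enorm (z x) <= 1.
Hypothesis zchi : forall x, dot (z x) (grad chi x) = - enorm (grad chi x).

Let w x := chi x * k (u x).

Let ck : continuous k.
Proof. by move=> t; apply: differentiable_continuous; apply/derivable1_diffP; case: (dk t). Qed.

Let mk : measurable_fun [set: R] k.
Proof. exact: continuous_measurable_fun. Qed.

Lemma itg_cut : itg w.
Proof.
have [C C0 hC] := bsupp_bounded (C1_continuous cchi) bchi.
have mw : measurable_fun [set: T] (w : T -> R).
  apply: measurable_funM; first exact: measurable_continuous (C1_continuous cchi).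
  by apply: measurableT_comp => //; case: lu.
apply: (le_itg mw (itg_locM_cts (L1locD (L1loc_norm lu) (L1loc_cst hlam `|k 0|)) (C1_continuous cchi) bchi)).
move=> x; rewrite /w !normrM mulrC ler_wpM2r// [leRHS]ger0_norm ?addr_ge0//.
by have := klip (u x) 0; rewrite subr0 => h; rewrite -{1}(subrK (k 0) (k (u x))) (le_trans (ler_normD _ _))// lerD2r.
Qed.

Lemma itg_cutM g : continuous g -> itg (fun x => w x * g x).
Proof.
move=> cg; have -> : (fun x => w x * g x) = (fun x => k (u x) * (chi x * g x)).
  by apply/funext => x; rewrite /w (mulrC (chi x)) mulrA.
apply: itg_locM_cts; [|by apply: ctsM => //; exact: C1_continuous|exact: bsupp_mull].
split; first by apply: measurableT_comp => //; case: lu.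
move=> r; have [mu /(_ r) iu] := L1locD (L1loc_norm lu) (L1loc_cst hlam `|k 0|).
apply: (@le_integrable _ T R lam _ _ _ _ _ _ iu).
- exact: measurable_eball.
- by apply/measurable_EFinP; apply: measurable_funTS; apply: measurableT_comp => //; case: lu.
- move=> x _; rewrite /= lee_fin [leRHS]ger0_norm ?addr_ge0//.
  have := klip (u x) 0; rewrite subr0 => h; rewrite -{1}(subrK (k 0) (k (u x))).
  by rewrite (le_trans (ler_normD _ _))// lerD2r.
Qed.

(** For a fixed test field [zeta] the calibrated inequality holds for [U = u * eta]. Since [k] is
    1-Lipschitz, returning from [U] to [u] costs a multiple of the L1 distance on a cube, which is
    made smaller than [e]. *)
Lemma TV_cut : (TV lam (fun x => (u x - w x)%R) <= TV lam u + (Int (fun x => w x * divg z x))%:E)%E.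
Proof.
have jw := itg_cut; have lw := itg_L1loc jw.
have lv := L1locB lu lw.
have cdz : continuous (divg z) by apply: cts_sum => i; case: (cz i) => _; exact.
have jwz := itg_cutM cdz.
apply: ge_ereal_sup => _ [zeta tz <-].
have [cze bze ze1] := test_field_C1 tz.
have cdze : continuous (divg zeta) by apply: cts_sum => i; case: (cze i) => _; exact.
have bdze : bsupp (divg zeta) by apply: bsupp_sum => i; exact: bsupp_derive.
have jvz : itg (fun x => (u x - w x) * divg zeta x) by exact: itg_locM_cts.
rewrite -[X in (X <= _)%E]fineK; last exact: (integrable_fin_num measurableT jvz).
rewrite -[fine _]/(Int (fun x => (u x - w x) * divg zeta x)) -leeBlDr// -EFinB.
apply/lee_subgt0Pr => e e0; rewrite -EFinB.
have [C1' C10 hC1] := bsupp_bounded cdze bdze.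
have [C2 C20 hC2] := bsupp_bounded (ctsM (C1_continuous cchi) cdz) (bsupp_mull _ bchi).
have [M1 hM1] := bdze; have [M2 hM2] := bchi.
pose M := `|M1| + `|M2|.
have M0 : 0 <= M by rewrite addr_ge0.
(* [U - W] differs from [u - w] by at most [2 |U - u|], multiplied by [div zeta] (bound [C1']); the
   other term is [k U - k u] times [chi * div z] (bound [C2]). The 1 ensures [K > 0]. *)
pose K := 2 * C1' + C2 + 1.
have K0 : 0 < K by rewrite /K; lra.
have [r /andP[r0 r1] hr] := mollify_L1 hlam lu M0 (divr_gt0 e0 K0).
have [eta heta] := mollifier_exists hlam r0.
have {hr} := hr _ heta; set U := convol lam u eta => hU.
have keta : smoothc eta by case: heta.
have DU x v : 'D_v U x = convol lam u ('D_v eta) x by case: (conv_diff lu keta x) => _ ->.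
have cU : C1 U.
  split=> [x|v]; first by case: (conv_diff lu keta x).
  have -> : 'D_v U = convol lam u ('D_v eta) by apply/funext => x.
  move=> x; apply: differentiable_continuous.
  by case: (conv_diff lu (smoothc_derive v keta) x).
have lU := continuous_L1loc hlam (C1_continuous cU).
pose W x := chi x * k (U x).
pose Z x : V := (1 - chi x * k' (U x)) *: zeta x - (chi x * k' (U x)) *: z x.
have [cZ bZ Z1 ineq] : [/\ forall i, continuous (fun x => Z x ord0 i),
    forall i, bsupp (fun x => Z x ord0 i), forall x, enorm (Z x) <= 1 &
    Int (fun x => (U x - W x) * divg zeta x) - Int (fun x => W x * divg z x) <=
    - \sum_i Int (fun x => Z x ord0 i * 'D_(ebase i) U x)].
  exact: (calibration hlam cU cchi bchi chi01 dk ck' k0 k'01 cz z1 zchi cze bze ze1).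
have bZ' : bsupp (fun x => enorm (Z x)).
  have [N hN] := choice bZ.
  exists (\sum_i `|N i|) => x xN; rewrite (_ : Z x = 0) ?enorm0//.
  apply/rowP => i; rewrite [RHS]mxE hN// (le_lt_trans _ xN)// (le_trans (ler_norm _))//.
  by rewrite (bigD1 i)//= lerDl sumr_ge0.
have := TV_mollify hlam heta lu cZ bZ' Z1.
apply: le_trans; rewrite lee_fin.
have jW : itg W.
  by apply: (itg_bsupp hlam); [apply: ctsM; [|apply: cts_comp => //]; exact: C1_continuous|exact: bsupp_mull].
have jVz : itg (fun x => (U x - W x) * divg zeta x).
  by apply: itg_locM_cts => //; apply: L1locB => //; exact: itg_L1loc.
have jWz : itg (fun x => W x * divg z x).
  apply: (itg_bsupp hlam); last exact: (bsupp_mull _ (bsupp_mull _ bchi)).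
  by apply: ctsM => //; apply: ctsM; [|apply: cts_comp => //]; exact: C1_continuous.
under eq_bigr do under eq_fun do rewrite -DU.
apply: le_trans ineq.
rewrite lerBlDr -lerBlDl.
have jc : itg (fun x => `|U x - u x| * \1_(cube M) x).
  apply: (itg_locM (L1loc_norm (L1locB lU lu)) (C := 1) (M := M)).
  - by apply: measurable_indic; exact: measurable_cube.
  - by move=> x; rewrite indicE; case: (_ \in _); rewrite ?normr1 ?normr0.
  - by move=> x xM; rewrite indicE memNset// => /(cubeP _ M0); rewrite leNgt xM.
apply: (@le_trans _ _ (Int (fun x => K * (`|U x - u x| * \1_(cube M) x)))); last first.
  rewrite (RintegralZl _ measurableT jc) mulrC -ler_pdivlMr//.
rewrite -(RintegralB measurableT jvz jwz) -(RintegralB measurableT jVz jWz).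
rewrite -(RintegralB measurableT (itgB jvz jwz) (itgB jVz jWz)).
apply: le_Int; [exact: itgB (itgB jvz jwz) (itgB jVz jWz)|exact: itgZ|move=> x].
rewrite indicE; case: (boolP (x \in cube M)) => [xM|xM]; last first.
  have {}xM : M < `|x| by apply: cubeNP => //; move: xM; rewrite notin_setE.
  rewrite hM1; last by apply: le_lt_trans xM; rewrite /M (le_trans (ler_norm M1))// lerDl.
  rewrite /w /W hM2; last by apply: le_lt_trans xM; rewrite /M (le_trans (ler_norm M2))// lerDr.
  by rewrite !(mulr0, mul0r, subrr).
rewrite mulr1.
have -> : (u x - w x) * divg zeta x - w x * divg z x - ((U x - W x) * divg zeta x - W x * divg z x)
  = ((u x - U x) + chi x * (k (U x) - k (u x))) * divg zeta x + (k (U x) - k (u x)) * (chi x * divg z x).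
  by rewrite /w /W; ring.
have kl := klip (U x) (u x).
have ckl : `|chi x * (k (U x) - k (u x))| <= `|U x - u x|.
  have /andP[c0 c1] := chi01 x.
  by rewrite normrM (ger0_norm c0) -[leRHS]mul1r ler_pM.
apply: (@le_trans _ _ (2 * `|U x - u x| * C1' + `|U x - u x| * C2)).
  apply: lerD; apply: (le_trans (ler_norm _)); rewrite normrM; apply: ler_pM => //.
  by rewrite (le_trans (ler_normD _ _))// mulrDl mul1r distrC lerD.
by rewrite /K; have := normr_ge0 (U x - u x); lra.
Qed.

End Cut.
End Truncation.

(** * Cutoffs and the radial calibration *)

Section Profiles.
Variables (R : realType).
Implicit Types (s t L : R).

Lemma is_derive_ext (f g : R -> R) t (l l' : R) : is_derive t 1 f l -> f =1 g -> l = l' ->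
  is_derive t 1 g l'.
Proof. by move=> df fg <-; rewrite -(funext fg). Qed.

Definition pos t : R := (t + `|t|) / 2.

Lemma pos_id t : 0 <= t -> pos t = t.
Proof. by move=> t0; rewrite /pos ger0_norm//; lra. Qed.

Lemma pos_0 t : t <= 0 -> pos t = 0.
Proof. by move=> t0; rewrite /pos ler0_norm//; lra. Qed.

Lemma pos_ge0 t : 0 <= pos t.
Proof. by have [t0|/ltW t0] := leP 0 t; [rewrite pos_id|rewrite pos_0]. Qed.

Lemma continuous_pos : continuous pos.
Proof.
move=> t; apply: cvgM; last exact: cvg_cst.
by apply: cvgD; [exact: cvg_id|exact: norm_continuous].
Qed.

Definition p2 t : R := pos t ^+ 2.

Lemma p2_ge0 t : 0 <= p2 t. Proof. exact: sqr_ge0. Qed.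

Lemma is_derive_p2 t : is_derive t 1 p2 (2 * pos t).
Proof.
apply: (@is_derive_quad _ _ _ _ 1) => h; rewrite mul1r /p2.
have [t0|/ltW t0] := leP 0 t; have [h0|/ltW h0] := leP 0 (t + h);
  rewrite ?(pos_id t0) ?(pos_id h0) ?(pos_0 t0) ?(pos_0 h0) ler_norml;
  apply/andP; split; nra.
Qed.

Lemma continuous_p2 : continuous p2.
Proof. by move=> t; apply: cvgM; exact: continuous_pos. Qed.

Lemma cts1_comp (g h : R -> R) : continuous g -> continuous h -> continuous (fun t => h (g t)).
Proof. by move=> cg ch t; apply: continuous_comp; [exact: cg|exact: ch]. Qed.

(** A C1 substitute for the positive part: zero exactly on [t <= 0], with slope between 0 and 1.
    Squaring the positive part inside the root removes its corner. *)
Definition kap t : R := Num.sqrt (1 + p2 t) - 1.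
Definition kap' t : R := pos t / Num.sqrt (1 + p2 t).

Lemma kap_arg_gt0 t : 0 < 1 + p2 t.
Proof. by rewrite ltr_wpDr// p2_ge0. Qed.

Lemma is_derive_kap t : is_derive t 1 kap (kap' t).
Proof.
have d1 : is_derive t 1 (fun t => 1 + p2 t) (2 * pos t).
  have d0 := is_deriveD (is_derive_cst (1 : R) t 1) (is_derive_p2 t).
  by apply: (is_derive_ext d0) => [x|]; rewrite ?add0r.
have := @is_derive1_comp R Num.sqrt (fun t => 1 + p2 t) t _ _ (is_derive1_sqrt (kap_arg_gt0 t)) d1.
move=> d2; apply: (is_derive_ext (is_deriveB d2 (is_derive_cst (1 : R) t 1))) => [x//|].
by rewrite subr0 /kap' invfM mulrACA mulVf ?mul1r 1?mulrC.
Qed.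

Lemma continuous_sqrt_comp (g : R -> R) : continuous g -> continuous (fun t => Num.sqrt (g t)).
Proof. by move=> cg t; apply: continuous_comp; [exact: cg|exact: sqrt_continuous]. Qed.

Lemma continuous_kap' : continuous kap'.
Proof.
have c1 : continuous (fun t => 1 + p2 t).
  by move=> t; apply: cvgD; [exact: cvg_cst|exact: continuous_p2].
move=> t; apply: cvgM; first exact: continuous_pos.
apply: cvgV; first by rewrite gt_eqF// sqrtr_gt0 kap_arg_gt0.
exact: (continuous_sqrt_comp c1).
Qed.

Lemma kap_ge0 t : 0 <= kap t.
Proof. by rewrite subr_ge0 -{1}sqrtr1 ler_sqrt ?lerDl ?p2_ge0// ltW// kap_arg_gt0. Qed.

Lemma kap_eq0 t : t <= 0 -> kap t = 0.
Proof. by move=> t0; rewrite /kap /p2 pos_0// expr0n addr0 sqrtr1 subrr. Qed.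

Lemma kap_gt0 t : 0 < t -> 0 < kap t.
Proof.
move=> t0; rewrite subr_gt0 -{1}sqrtr1 ltr_sqrt ?ltrDl ?kap_arg_gt0//.
by rewrite /p2 pos_id ?(ltW t0)// exprn_gt0.
Qed.

Lemma kap'01 t : 0 <= kap' t <= 1.
Proof.
have h := kap_arg_gt0 t.
rewrite divr_ge0 ?pos_ge0 ?sqrtr_ge0//= ler_pdivrMr ?sqrtr_gt0// mul1r.
rewrite -(ler_sqr) ?nnegrE ?pos_ge0 ?sqrtr_ge0// sqr_sqrtr ?(ltW h)//.
by rewrite /p2 lerDr.
Qed.

Lemma kap_lip s t : `|kap s - kap t| <= `|s - t|.
Proof.
wlog st : s t / t <= s.
  by move=> H; have [/H//|/ltW/H] := leP t s; rewrite distrC (distrC s).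
have [c _||c _ ->] := @MVT_segment R kap kap' t s st; first exact: is_derive_kap.
  apply: continuous_subspaceT => c; apply: differentiable_continuous.
  by apply/derivable1_diffP; case: (is_derive_kap c).
rewrite normrM -[leRHS]mul1r ler_wpM2r//.
by have /andP[h0 h1] := kap'01 c; rewrite ger0_norm.
Qed.

Lemma kap_le t : 0 <= t -> kap t <= t.
Proof.
move=> t0; have := kap_lip t 0; rewrite (kap_eq0 (lexx 0)) !subr0 (ger0_norm t0).
by rewrite ger0_norm ?kap_ge0.
Qed.

Section Radial.
Variable L : R.
Hypothesis L0 : 0 < L.

(** The argument is a squared distance, so no singularity arises at the centre. The value is 1 for
    [t <= L] and 0 for [t >= 2 * L], and the two nested squared positive parts keep the profile
    C1. *)
Definition cutoff t : R := p2 (1 - p2 ((t - L) / L)).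
Definition cutoff' t : R := 2 * pos (1 - p2 ((t - L) / L)) * - (2 * pos ((t - L) / L) / L).

Lemma is_derive_cutoff t : is_derive t 1 cutoff (cutoff' t).
Proof.
have d0 : is_derive t 1 (fun t => (t - L) / L) (L^-1).
  have d0 := is_deriveZ (L^-1) (is_deriveB (is_derive_id t 1) (is_derive_cst L t 1)).
  by apply: (is_derive_ext d0) => [x|]; [rewrite mulrC|rewrite subr0 [LHS]mulr1].
have d1 := @is_derive1_comp R p2 (fun t => (t - L) / L) t _ _ (is_derive_p2 _) d0.
have d2 := is_deriveB (is_derive_cst (1 : R) t 1) d1.
have d3 := @is_derive1_comp R p2 _ t _ _ (is_derive_p2 _) d2.
by apply: (is_derive_ext d3) => [x//|]; rewrite sub0r.
Qed.

Lemma continuous_aff : continuous (fun t => (t - L) / L).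
Proof.
move=> t; apply: cvgM; last exact: cvg_cst.
by apply: cvgB; [exact: cvg_id|exact: cvg_cst].
Qed.

Lemma continuous_cutoff' : continuous cutoff'.
Proof.
have c1 := cts1_comp continuous_aff continuous_pos.
have c0 : continuous (fun t => 1 - p2 ((t - L) / L)).
  move=> t; apply: cvgB; first exact: cvg_cst.
  exact: (cts1_comp continuous_aff continuous_p2).
have c2 := cts1_comp c0 continuous_pos.
move=> t; apply: cvgM; first by apply: cvgM; [exact: cvg_cst|exact: c2].
apply: cvgN; apply: cvgM; last exact: cvg_cst.
by apply: cvgM; [exact: cvg_cst|exact: c1].
Qed.

Lemma cutoff01 t : 0 <= cutoff t <= 1.
Proof.
rewrite p2_ge0 /cutoff /p2 expr_le1 ?pos_ge0//.
have := p2_ge0 ((t - L) / L); set q := p2 _ => q0.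
by have [h|/ltW h] := leP 0 (1 - q); rewrite ?(pos_id h) ?(pos_0 h)//; lra.
Qed.

Lemma cutoff_eq1 t : t <= L -> cutoff t = 1.
Proof.
move=> tL; rewrite /cutoff {2}/p2 pos_0 ?expr0n ?subr0 /p2 ?pos_id ?expr1n//.
by rewrite pmulr_lle0 ?invr_gt0//; lra.
Qed.

Lemma cutoff_eq0 t : 2 * L <= t -> cutoff t = 0.
Proof.
move=> tL; have h : 1 <= (t - L) / L by rewrite ler_pdivlMr//; lra.
rewrite /cutoff {1}/p2 pos_0 ?expr0n// subr_le0 /p2 pos_id; last lra.
by rewrite expr_ge1//; lra.
Qed.

Lemma cutoff'_eq0 t : t <= L -> cutoff' t = 0.
Proof.
move=> tL; rewrite /cutoff' (pos_0 (_ : (t - L) / L <= 0)); first by rewrite !(mulr0, mul0r, oppr0).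
by rewrite pmulr_lle0 ?invr_gt0//; lra.
Qed.

Lemma cutoff'_le0 t : cutoff' t <= 0.
Proof.
have h : 0 <= L^-1 by rewrite invr_ge0 ltW.
by rewrite /cutoff' mulrN oppr_le0; do ?[exact: pos_ge0|apply: mulr_ge0].
Qed.

(* [gau t = t] for [t >= L] and [gau t >= t, L / 2] always, so the field
   [(x - c) / sqrt (gau |x - c|^2)] is C1, has norm at most 1, and is the unit radial
   field where the gradient of the cutoff does not vanish. *)
Definition gau t : R := t + p2 (L - t) / L.
Definition gau' t : R := 1 - 2 * pos (L - t) / L.

Lemma gau_ge t : t <= gau t.
Proof. by rewrite lerDl divr_ge0 ?p2_ge0// ltW. Qed.

Lemma gau_id t : L <= t -> gau t = t.
Proof. by move=> Lt; rewrite /gau /p2 pos_0 ?subr_le0// expr0n mul0r addr0. Qed.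

Lemma gau_ge_half t : L / 2 <= gau t.
Proof.
have [Lt|/ltW Lt] := leP L t; first by rewrite gau_id//; move: L0 Lt; lra.
rewrite /gau /p2 pos_id ?subr_ge0// -(ler_pM2r L0) mulrDl divfK ?gt_eqF//.
by move: L0 Lt; nra.
Qed.

Lemma gau_gt0 t : 0 < gau t.
Proof. by apply: lt_le_trans (gau_ge_half t); rewrite divr_gt0. Qed.

Lemma gau'_bound t : 0 <= t -> `|gau' t| <= 1.
Proof.
move=> t0; rewrite ler_norml /gau'.
have h0 := pos_ge0 (L - t).
have hL : pos (L - t) <= L.
  by have [h|/ltW h] := leP 0 (L - t); rewrite ?(pos_id h) ?(pos_0 h); move: L0; lra.
have : 0 <= 2 * pos (L - t) / L <= 2.
  apply/andP; split; first by apply: divr_ge0; [exact: mulr_ge0|exact: ltW].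
  by rewrite ler_pdivrMr//; move: L0; lra.
by move=> /andP[? ?]; apply/andP; split; lra.
Qed.

Lemma is_derive_gau t : is_derive t 1 gau (gau' t).
Proof.
have d0 : is_derive t 1 (fun t => L - t) (- 1).
  have d1 := is_deriveB (is_derive_cst L t 1) (is_derive_id t 1).
  by apply: (is_derive_ext d1) => [x//|]; rewrite sub0r.
have d1 := @is_derive1_comp R p2 _ t _ _ (is_derive_p2 _) d0.
apply: (is_derive_ext (is_deriveD (is_derive_id t 1) (is_deriveZ (L^-1) d1))) => [x|].
  by rewrite /gau (mulrC _ L^-1).
by rewrite /gau' /GRing.scale/=; ring.
Qed.

Definition mrad t : R := (Num.sqrt (gau t))^-1.
Definition mrad' t : R := - (mrad t ^+ 2) * ((2 * Num.sqrt (gau t))^-1 * gau' t).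

Lemma is_derive_mrad t : is_derive t 1 mrad (mrad' t).
Proof.
have s0 : Num.sqrt (gau t) != 0 by rewrite gt_eqF// sqrtr_gt0 gau_gt0.
have d1 := @is_derive1_comp R Num.sqrt gau t _ _ (is_derive1_sqrt (gau_gt0 t)) (is_derive_gau t).
apply: (is_derive_ext (@is_deriveV R (Num.sqrt \o gau) t _ 1 s0 d1)) => [x//|].
by rewrite /mrad' /mrad exprVn.
Qed.

Lemma continuous_gau : continuous gau.
Proof.
move=> t; apply: differentiable_continuous; apply/derivable1_diffP.
by case: (is_derive_gau t).
Qed.

Lemma continuous_mrad : continuous mrad.
Proof.
move=> t; apply: differentiable_continuous; apply/derivable1_diffP.
by case: (is_derive_mrad t).
Qed.

Lemma continuous_mrad' : continuous mrad'.
Proof.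
have c0 : continuous (fun t => L - t).
  by move=> t; apply: cvgB; [exact: cvg_cst|exact: cvg_id].
have c1 := cts1_comp c0 continuous_pos.
move=> t; apply: cvgM.
  by apply: cvgN; apply: cvgM; exact: continuous_mrad.
apply: cvgM.
  apply: cvgV; first by rewrite gt_eqF// mulr_gt0// sqrtr_gt0 gau_gt0.
  apply: cvgM; first exact: cvg_cst.
  exact: (continuous_sqrt_comp continuous_gau).
apply: cvgB; first exact: cvg_cst.
apply: cvgM; last exact: cvg_cst.
by apply: cvgM; [exact: cvg_cst|exact: c1].
Qed.

Lemma mrad_gt0 t : 0 < mrad t.
Proof. by rewrite invr_gt0 sqrtr_gt0 gau_gt0. Qed.

Lemma mrad_le t : mrad t <= (Num.sqrt (L / 2))^-1.
Proof.
by rewrite lef_pV2 ?posrE ?sqrtr_gt0 ?gau_gt0 ?divr_gt0// ler_sqrt ?gau_ge_half// ltW// gau_gt0.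
Qed.

(** [2 t mrad' t] is the part of the divergence of [mrad(|x - c|^2) (x - c)] that comes from
    differentiating the scalar factor. Since [|gau'| <= 1] and [t <= gau t], it is at most one
    further [mrad t], whence the factor [d + 1] in the divergence bound. *)
Lemma mrad'_bound t : 0 <= t -> 2 * t * mrad' t <= mrad t.
Proof.
move=> t0; apply: (le_trans (ler_norm _)).
rewrite /mrad' !normrM normrN normfV.
have g0 := gau_gt0 t; have s0 : 0 < Num.sqrt (gau t) by rewrite sqrtr_gt0.
rewrite (ger0_norm (ltW (_ : 0 < 2 * Num.sqrt (gau t)))) ?mulr_gt0//.
rewrite (ger0_norm t0) (ger0_norm (_ : 0 <= mrad t ^+ 2)) ?sqr_ge0// (ger0_norm (_ : 0 <= 2))//.
have := gau'_bound t0; set b := `|_| => b1.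
have E : mrad t ^+ 2 = (gau t)^-1 by rewrite /mrad exprVn sqr_sqrtr// ltW.
rewrite E invfM.
have -> : 2 * t * ((gau t)^-1 * (2^-1 * (Num.sqrt (gau t))^-1 * b)) = (t / gau t) * b * mrad t.
  by rewrite /mrad; field; rewrite !gt_eqF.
rewrite -[leRHS]mul1r ler_wpM2r ?(ltW (mrad_gt0 t))// mulr_ile1 ?divr_ge0 ?normr_ge0 ?(ltW g0)//.
by rewrite ler_pdivrMr// mul1r gau_ge.
Qed.

End Radial.
End Profiles.

(** * The radial cutoff around a centre and its calibrating field *)

Section Comparison.
Variables (R : realType) (d : nat).
Local Notation V := 'rV[R]_d.
Local Notation T := (Rd R d).
Variable lam : {measure set T -> \bar R}.
Hypothesis hlam : is_lebesgue lam.
Implicit Types (x y v : V) (g f F U chi : V -> R).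
Notation itg g := (lam.-integrable [set: T] (EFin \o (g : T -> R))).
Notation "'Int' g" := (Rintegral lam [set: T] (g : T -> R)) (at level 10, g at level 8).

Notation grad F x := (\row_i 'D_(ebase i) F x : V).

Section Radial.
Variables (c : V) (L : R).
Hypothesis L0 : 0 < L.

Definition rchi x : R := cutoff L (sqdist c x).
Definition rz x : V := mrad L (sqdist c x) *: (x - c).

Lemma C1_sqdist : C1 (sqdist c).
Proof.
split=> [x|v]; first by case: (sqdist_diff c x).
have -> : 'D_v (sqdist c) = (fun x => 2 * dot (x - c) v).
  by apply/funext => x; case: (sqdist_diff c x) => _ ->.
have -> : (fun x => 2 * dot (x - c) v) = (fun x => 2 * (dot v x - dot v c)).
  by apply/funext => x; rewrite dotC dotDr dotNr.
apply: ctsM; first exact: ctsC.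
by apply: ctsB; [exact: continuous_dot|exact: ctsC].
Qed.

Lemma C1_rchi : C1 rchi.
Proof. by case: (C1_comp (is_derive_cutoff L) (@continuous_cutoff' R L) C1_sqdist). Qed.

Lemma grad_rchi x : grad rchi x = (2 * cutoff' L (sqdist c x)) *: (x - c).
Proof.
apply/rowP => i; rewrite mxE.
case: (C1_comp (is_derive_cutoff L) (@continuous_cutoff' R L) C1_sqdist) => _ ->.
case: (sqdist_diff c x) => _ ->; rewrite [RHS]mxE mulrCA mulrA; congr (_ * _).
rewrite /dot (bigD1 i)//= big1 => [|j ji]; last by rewrite [ebase _ _ _]mxE (negPf ji) andbF mulr0.
by rewrite [ebase _ _ _]mxE !eqxx mulr1 addr0.
Qed.

Lemma bsupp_rchi : bsupp rchi.
Proof.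
exists (`|c| + (2 * L + 1)) => x xc; rewrite /rchi cutoff_eq0//.
rewrite /sqdist -enorm_sqr.
have h : 2 * L + 1 <= enorm (x - c).
  apply: le_trans (norm_le_enorm _).
  have : `|x| <= `|x - c| + `|c| by rewrite -{1}(subrK c x) ler_normD.
  by move: xc; lra.
by rewrite expr2; move: L0 h; set e := enorm _; nra.
Qed.

Lemma C1_rz i : C1 (fun x => rz x ord0 i).
Proof.
have -> : (fun x => rz x ord0 i) = (fun x => mrad L (sqdist c x) * (x ord0 i - c ord0 i)).
  by apply/funext => x; rewrite !mxE.
apply: C1M.
  by case: (C1_comp (is_derive_mrad L0) (@continuous_mrad' R L L0) C1_sqdist).
have D v : 'D_v (fun x : V => x ord0 i - c ord0 i) = (fun=> v ord0 i).
  apply/funext => x; have [di Di] := coord_diff i x.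
  rewrite (deriveB (diff_derivable di) (derivable_cst _ _ _)) Di.
  by rewrite (derive_cst (c ord0 i) x v) subr0.
split=> [x|v]; last by rewrite D; exact: ctsC.
by apply: differentiableB; [case: (coord_diff i x)|exact: differentiable_cst].
Qed.

Lemma enorm_rz x : enorm (rz x) <= 1.
Proof.
rewrite enormZ ger0_norm ?(ltW (mrad_gt0 L0 _))// /mrad mulrC ler_pdivrMr ?sqrtr_gt0 ?gau_gt0//.
by rewrite mul1r enormE ler_sqrt ?(ltW (gau_gt0 L0 _))// gau_ge.
Qed.

(** Where [grad rchi] is nonzero one has [sqdist c x > L]; there [rz] is the outward unit radial
    field, and the gradient of the decreasing profile points inward. *)
Lemma rz_rchi x : dot (rz x) (grad rchi x) = - enorm (grad rchi x).
Proof.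
rewrite grad_rchi; have [tL|tL] := leP (sqdist c x) L.
  by rewrite cutoff'_eq0// mulr0 scale0r enorm0 oppr0 /dot big1// => i _; rewrite !mxE mulr0.
rewrite enormZ dotZl dotZr ler0_norm; last first.
  by rewrite pmulr_rle0// cutoff'_le0.
rewrite mulNr opprK mulrCA; congr (_ * _).
rewrite /mrad gau_id ?(ltW tL)// enormE -/(sqdist c x).
have s0 : 0 < sqdist c x by rewrite (lt_trans L0).
rewrite -{2}(sqr_sqrtr (ltW s0)) expr2 mulrA mulVf ?mul1r//.
by rewrite gt_eqF// sqrtr_gt0.
Qed.

(** The divergence is [d mrad t + 2 t mrad' t] with [t = |x - c|^2]. The bound is independent of
    [c], which makes the threshold on [alpha] uniform in the centre. *)
Lemma divg_rz x : divg rz x <= (d%:R + 1) * (Num.sqrt (L / 2))^-1.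
Proof.
set t := sqdist c x.
have -> : divg rz x = d%:R * mrad L t + 2 * t * mrad' L t.
  have -> : 2 * t * mrad' L t = \sum_i 2 * mrad' L t * (x ord0 i - c ord0 i) ^+ 2.
    rewrite -mulr_sumr mulrAC; congr (_ * _); rewrite /t /sqdist.
    by apply: eq_bigr => i _; rewrite !mxE expr2.
  have -> : d%:R * mrad L t = \sum_(i < d) mrad L t.
    by rewrite sumr_const card_ord mulr_natl.
  rewrite -big_split; apply: eq_bigr => i _ /=.
  have -> : (fun y => rz y ord0 i) = (fun x => mrad L (sqdist c x) * (x ord0 i - c ord0 i)).
    by apply/funext => y; rewrite !mxE.
  have [cm Dm] := C1_comp (is_derive_mrad L0) (@continuous_mrad' R L L0) C1_sqdist.
  have [di Di] := coord_diff i x.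
  have dm : differentiable (fun x => mrad L (sqdist c x)) x by case: cm.
  have dc : differentiable (fun x : V => x ord0 i - c ord0 i) x.
    by apply: differentiableB; [|exact: differentiable_cst].
  rewrite (deriveM (diff_derivable dm) (diff_derivable dc)) Dm.
  rewrite (deriveB (diff_derivable di) (derivable_cst _ _ _)) (derive_cst (c ord0 i) x _) subr0 Di.
  rewrite [delta_mx _ _ _ _]mxE !eqxx /GRing.scale/= mulr1; congr (_ + _).
  case: (sqdist_diff c x) => _ ->.
  rewrite /dot (bigD1 i)//= big1 => [|j ji]; last by rewrite [delta_mx _ _ _ _]mxE (negPf ji) andbF mulr0.
  by rewrite [delta_mx _ _ _ _]mxE !eqxx !mxE mulr1 addr0 -/t; ring.
have t0 : 0 <= t by exact: dot_ge0.
have h1 := mrad'_bound L0 t0; have h2 := mrad_le L0 t.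
rewrite [leRHS]mulrDl mul1r; apply: lerD; last exact: le_trans h1 h2.
exact: ler_wpM2l.
Qed.

End Radial.
End Comparison.

(** * Comparison for minimizers *)

Section Minimizer.
Variables (R : realType) (d : nat).
Local Notation V := 'rV[R]_d.
Local Notation T := (Rd R d).
Variable lam : {measure set T -> \bar R}.
Hypothesis hlam : is_lebesgue lam.
Implicit Types (x y v : V) (g f F U chi : V -> R).
Notation itg g := (lam.-integrable [set: T] (EFin \o (g : T -> R))).
Notation "'Int' g" := (Rintegral lam [set: T] (g : T -> R)) (at level 10, g at level 8).

Variable psi : R -> R.
Hypothesis psi_scv : strictly_convex psi.
Hypothesis psi_even : forall s, psi (- s) = psi s.
Hypothesis psi0 : psi 0 = 0.

Lemma psi_gt0 t : t != 0 -> 0 < psi t.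
Proof.
move=> t0; have tt : t != - t by apply: contra_neq t0 => h; lra.
have h : 0 < (2^-1 : R) < 1 by rewrite invr_gt0 ltr0n /= invf_lt1// ltr1n.
have := psi_scv tt h; rewrite psi_even.
have -> : 2^-1 * t + (1 - 2^-1) * - t = 0 by lra.
by rewrite psi0; lra.
Qed.

Lemma psi_ge0 t : 0 <= psi t.
Proof. by have [->|/psi_gt0/ltW//] := eqVneq t 0; rewrite psi0. Qed.

(** Convexity between 0 and [a], where [psi 0 = 0]: the ratio [psi t / t] is nondecreasing on
    [t > 0]. *)
Lemma psi_star (a b : R) : 0 < b -> b <= a -> psi b <= b / a * psi a.
Proof.
move=> b0; rewrite le_eqVlt => /predU1P[<-|ba]; first by rewrite divff ?mul1r// gt_eqF.
have a0 : 0 < a := lt_trans b0 ba.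
have h : 0 < b / a < 1 by rewrite divr_gt0//= ltr_pdivrMr// mul1r.
have := psi_scv (lt0r_neq0 a0) h.
by rewrite mulr0 addr0 psi0 mulr0 addr0 divfK ?gt_eqF// => /ltW.
Qed.

(** With [p <= q <= r] the ratios [psi t / t] at [nu], [b], [a], one gets [psi a - psi b = r a - q b
    >= q (a - b) >= p (a - b)]. *)
Lemma psi_slope (nu a b : R) : 0 < nu -> nu <= b -> b <= a ->
  psi nu / nu * (a - b) <= psi a - psi b.
Proof.
move=> nu0 nub ba; have b0 : 0 < b := lt_le_trans nu0 nub.
have a0 : 0 < a := lt_le_trans b0 ba.
have h1 : psi nu / nu <= psi b / b.
  by rewrite ler_pdivrMr// mulrAC -mulrA mulrC psi_star.
have h2 : psi b / b <= psi a / a.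
  by rewrite ler_pdivrMr// mulrAC -mulrA mulrC psi_star.
have -> : psi a = psi a / a * a by rewrite divfK ?gt_eqF.
have -> : psi b = psi b / b * b by rewrite divfK ?gt_eqF.
move: h1 h2; set p := psi nu / nu; set q := psi b / b; set r := psi a / a => h1 h2.
have : p * (a - b) <= q * (a - b) by rewrite ler_wpM2r// subr_ge0.
have : q * a <= r * a by rewrite ler_wpM2r// ltW.
by lra.
Qed.

(** An even function that is nondecreasing on the half-line is a monotone function of the absolute
    value. *)
Lemma measurable_psi : measurable_fun [set: R] psi.
Proof.
have -> : psi = (fun t => psi (Num.max 0 t)) \o Num.norm.
  apply/funext => t /=; rewrite max_r//.
  by have [//|_] := ger0P t; rewrite psi_even.
apply: measurableT_comp => //.
apply: nondecreasing_measurable => // s t st.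
have m0 : 0 <= Num.max 0 s by rewrite le_max lexx.
have mst : Num.max 0 s <= Num.max 0 t by rewrite ge_max !le_max lexx st orbT.
move: m0 mst; move: (Num.max 0 s) (Num.max 0 t) => a b.
rewrite le_eqVlt => /predU1P[<- _|a0 ab]; first by rewrite psi0 psi_ge0.
have b0 := lt_le_trans a0 ab.
apply: (le_trans (psi_star a0 ab)); rewrite -[leRHS]mul1r ler_wpM2r ?psi_ge0//.
by rewrite ler_pdivrMr// mul1r.
Qed.

Lemma TV_ge0 (u : V -> R) : (0 <= TV lam u)%E.
Proof.
have D0 v : 'D_v ((fun=> 0) : V -> V) = (fun=> 0) by apply/funext => x; exact: derive_cst.
have it0 (vs : seq V) : Defs.iterD vs ((fun=> 0) : V -> V) = (fun=> 0).
  by elim: vs => //= v vs ->; rewrite D0.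
apply: ereal_sup_ubound; exists ((fun=> 0) : V -> V).
  split=> [vs x||x]; last by rewrite enorm0.
    by rewrite it0; exact: differentiable_cst.
  have -> : [set x : V | (fun=> 0 : V) x != 0] = set0.
    by rewrite -subset0 => x /=; rewrite eqxx.
  by rewrite closure0; exact: compact0.
rewrite (eq_integral (fun=> 0%E)) ?integral0// => x _.
rewrite /divg big1 ?mulr0// => i _.
have -> : (fun y : V => ((fun=> 0) : V -> V) y ord0 i) = cst 0 by apply/funext => y; rewrite mxE.
exact: derive_cst.
Qed.

Lemma minimizer_upper (f u : V -> R) (alpha s nu rho : R) (c : V) :
  BV lam f -> is_minimizer lam psi f alpha u -> 0 < alpha -> 0 < nu -> 0 < rho ->
  lam ([set x | s - nu < f x] `&` eball c rho : set T) = 0%E ->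
  alpha * ((d%:R + 1) * (Num.sqrt (rho ^+ 2 / 2 / 2))^-1) < psi nu / nu ->
  lam ([set x | s < u x] `&` eball c (rho / 2) : set T) = 0%E.
Proof.
move=> Bf [Bu minu] a0 nu0 rho0 fnull small.
(* The cutoff lives where [|x - c|^2 < 2 L = rho^2] and equals 1 where [|x - c|^2 <= L], in
   particular on the ball of radius [rho / 2]. *)
pose L := rho ^+ 2 / 2.
have L0 : 0 < L by rewrite divr_gt0// exprn_gt0.
pose k t := kap (t - s); pose k' t := kap' (t - s).
have dk (t : R) : is_derive t 1 k (k' t).
  have d0 : is_derive t 1 (fun t : R => t - s) 1.
    apply: (is_derive_ext (is_deriveB (is_derive_id t 1) (is_derive_cst s t 1))) => [x//|].
    by rewrite subr0.
  have d1 := @is_derive1_comp R (@kap R) (fun t : R => t - s) t _ _ (is_derive_kap _) d0.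
  apply: (is_derive_ext d1) => [x//|].
  by rewrite mulr1.
have ck' : continuous k'.
  have cs : continuous (fun t : R => t - s).
    by move=> t; apply: cvgB; [exact: cvg_id|exact: cvg_cst].
  exact: (cts1_comp cs (@continuous_kap' R)).
have k0 t : 0 <= k t by exact: kap_ge0.
have k'01 t : 0 <= k' t <= 1 by exact: kap'01.
have klip t t' : `|k t - k t'| <= `|t - t'|.
  by rewrite (le_trans (kap_lip _ _))// opprB addrA subrK.
have chi01 x : 0 <= rchi c L x <= 1 by exact: cutoff01.
have lu := Bu.1; have lf := Bf.1; have mu := lu.1; have mf := lf.1.
pose w x := rchi c L x * k (u x).
have jw : itg w := itg_cut hlam lu (C1_rchi c L) (bsupp_rchi c L0) dk klip.
have mw := itg_measurable jw.
have w0 x : 0 <= w x by have /andP[? _] := chi01 x; rewrite mulr_ge0.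
pose v x := u x - w x.
have tv := TV_cut hlam lu (C1_rchi c L) (bsupp_rchi c L0) chi01 dk ck' k0 k'01 klip
  (C1_rz c L0) (enorm_rz c L0) (rz_rchi c L0).
set B := Int (fun x => _ * divg _ _) in tv.
pose D := (d%:R + 1) * (Num.sqrt (L / 2))^-1 : R.
have BD : B <= D * Int w.
  rewrite -(RintegralZl D measurableT jw); apply: le_Int.
  - have cdz : continuous (divg (rz c L)) by apply: cts_sum => i; case: (C1_rz c L0 i) => _; exact.
    exact: (itg_cutM hlam lu (C1_rchi c L) (bsupp_rchi c L0) dk klip cdz).
  - exact: itgZ.
  - by move=> x; rewrite [leLHS]mulrC; apply: ler_wpM2r; [exact: w0|exact: divg_rz].
have TVu : TV lam u \is a fin_num by rewrite ge0_fin_numE ?TV_ge0//; case: Bu.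
have Bv : BV lam v.
  split; first by apply: L1locB => //; exact: itg_L1loc.
  apply: (le_lt_trans tv); rewrite -(fineK TVu) -EFinD; exact: ltry.
have mpsi (g : V -> R) : measurable_fun [set: T] (g : T -> R) ->
    measurable_fun [set: T] (fun x : T => (psi (g x - f x))%:E).
  move=> mg; apply/measurable_EFinP; apply: (measurableT_comp measurable_psi).
  exact: measurable_funB.
have ppos (g : V -> R) : (0 <= \int[lam]_(x in [set: T]) (psi (g x - f x))%:E)%E.
  by apply: integral_ge0 => x _; rewrite lee_fin psi_ge0.
(* The competitor [f] has energy [alpha * TV f], which is finite; finite energies are what allows
   subtraction later. *)
have pfin : (\int[lam]_(x in [set: T]) (psi (u x - f x))%:E)%E \is a fin_num.
  rewrite ge0_fin_numE//.
  apply: (@le_lt_trans _ _ (Jfun lam psi f alpha u)).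
    by rewrite /Jfun leeDl// mule_ge0 ?TV_ge0// lee_fin ltW.
  apply: (le_lt_trans (minu _ Bf)).
  rewrite /Jfun (eq_integral (fun=> 0%E)) ?integral0 ?add0e; last first.
    by move=> x _; rewrite subrr psi0.
  have : TV lam f \is a fin_num by rewrite ge0_fin_numE ?TV_ge0//; case: Bf.
  by move=> /fineK <-; rewrite -EFinM ltry.
have mv : measurable_fun [set: T] (v : T -> R) by exact: measurable_funB.
have point : (\int[lam]_(x in [set: T]) ((psi (v x - f x))%:E + (psi nu / nu * w x)%:E) <=
              \int[lam]_(x in [set: T]) (psi (u x - f x))%:E)%E.
  apply: ae_ge0_le_integral => //.
  - by move=> x _; rewrite adde_ge0// lee_fin ?psi_ge0// mulr_ge0// divr_ge0 ?psi_ge0// ltW.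
  - apply: emeasurable_funD; first exact: mpsi.
    by apply/measurable_EFinP; exact: measurable_funM.
  - by move=> x _; rewrite lee_fin psi_ge0.
  - exact: mpsi.
  - exists ([set x | s - nu < f x] `&` eball c rho); split => //.
      apply: measurableI; last exact: measurable_eball.
      rewrite -[X in measurable X]setTI -preimage_itvoy.
      by apply: mf => //; exact: measurable_itv.
    move=> x /= hx; apply: contrapT => xN; apply: hx => _.
    rewrite -EFinD lee_fin.
    have [wx|wx] := eqVneq (w x) 0; first by rewrite /v wx mulr0 addr0 subr0.
    have us : s < u x.
      rewrite ltNge; apply/negP => us; move/eqP: wx; apply.
      by rewrite /w /k kap_eq0 ?mulr0// subr_le0.
    (* A nonzero [w x] forces [u x > s] and [x] in the ball. As [w <= u - s], the value [v x] is
       still at least [s], so [v x - f x >= nu] and [psi_slope] applies. *)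
    have xb : eball c rho x.
      rewrite /eball/= ltNge; apply/negP => xr; move/eqP: wx; apply.
      rewrite /w /rchi cutoff_eq0 ?mul0r// /sqdist -enorm_sqr /L mulrC divfK//.
      by rewrite ler_sqr ?nnegrE ?enorm_ge0 ?(ltW rho0).
    have fx : f x <= s - nu by rewrite leNgt; apply/negP => fx; apply: xN.
    have wk : w x <= u x - s.
      apply: (@le_trans _ _ (k (u x))).
        by have /andP[_ h] := chi01 x; rewrite /w -[leRHS]mul1r ler_wpM2r.
      by apply: kap_le; rewrite subr_ge0 ltW.
    have := @psi_slope nu (u x - f x) (v x - f x) nu0.
    rewrite /v; have := w0 x => h0.
    have -> : u x - f x - (u x - w x - f x) = w x by ring.
    move=> H; have := H _ _; lra.
rewrite ge0_integralD// in point; last 4 first.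
- by move=> x _; rewrite lee_fin psi_ge0.
- exact: mpsi.
- by move=> x _; rewrite lee_fin mulr_ge0// divr_ge0 ?psi_ge0// ltW.
- by apply/measurable_EFinP; exact: measurable_funM.
have := minu _ Bv; rewrite /Jfun => J.
have Iw : (\int[lam]_(x in [set: T]) (psi nu / nu * w x)%:E)%E = (psi nu / nu * Int w)%:E.
  rewrite -(RintegralZl _ measurableT jw) /Rintegral fineK//.
  exact: (integrable_fin_num measurableT (itgZ _ jw)).
rewrite Iw in point.
have qfin : (\int[lam]_(x in [set: T]) (psi (v x - f x))%:E)%E \is a fin_num.
  rewrite ge0_fin_numE//; apply: (@le_lt_trans _ _ (\int[lam]_(x in [set: T]) (psi (u x - f x))%:E)%E).
    apply: le_trans point; rewrite leeDl// lee_fin; apply: mulr_ge0; last by apply: Rintegral_ge0 => x _; exact: w0.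
    by rewrite divr_ge0 ?psi_ge0// ltW.
  by rewrite -ge0_fin_numE.
have TVv : TV lam v \is a fin_num by rewrite ge0_fin_numE ?TV_ge0//; case: Bv.
move: point J tv; rewrite -(fineK pfin) -(fineK qfin) -(fineK TVu) -/v -(fineK TVv).
rewrite -!EFinM -!EFinD !lee_fin.
set p := fine _; set q := fine _; set t := fine _; set t' := fine _ => h1 h2 h3.
have I0 : 0 <= Int w by apply: Rintegral_ge0 => x _; exact: w0.
(* If [Int w] were positive, minimality would give [psi nu / nu <= alpha * D], against the smallness
   of [alpha]. *)
have Iw0 : Int w = 0.
  apply/eqP; rewrite eq_le I0 andbT leNgt; apply/negP => Ip.
  have : alpha * D * Int w < psi nu / nu * Int w by rewrite ltr_pM2r.
  have : alpha * t' <= alpha * (t + D * Int w).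
    by rewrite ler_pM2l// (le_trans h3)// lerD2l.
  by move: h1 h2; lra.
have : (\int[lam]_(x in [set: T]) `|(w x)%:E| = 0)%E.
  rewrite (eq_integral (fun x : T => (w x)%:E)) => [|x _]; last by rewrite /= ger0_norm.
  rewrite -[LHS]fineK; last exact: (integrable_fin_num measurableT jw).
  by rewrite -[fine _]/(Int w) Iw0.
move=> /(ae_eq_integral_abs lam measurableT ((measurable_EFinP _ _).2 mw)) [N [mN N0 hN]].
apply/eqP; rewrite eq_le measure_ge0 andbT -N0 le_measure ?inE//.
  apply: measurableI; last exact: measurable_eball.
  rewrite -[X in measurable X]setTI -preimage_itvoy.
  by apply: mu => //; exact: measurable_itv.
(* On the smaller ball the cutoff is 1 and [kap] is positive, so [u x > s] would make [w x]
   positive, whereas [w] vanishes off the null set [N]. *)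
move=> x [us xb]; apply: hN => /= h; have := h I => -[] w0x.
have : 0 < w x.
  rewrite /w /rchi cutoff_eq1 ?mul1r ?kap_gt0 ?subr_gt0//.
  rewrite /sqdist -enorm_sqr /L; move: xb; rewrite /eball/= => xb.
  have := enorm_ge0 (x - c); move: xb rho0; set e := enorm _; rewrite !expr2; nra.
by rewrite w0x ltxx.
Qed.

End Minimizer.

(** * Reflection of data and minimizer *)

Section Symmetry.
Variables (R : realType) (d : nat).
Local Notation V := 'rV[R]_d.
Local Notation T := (Rd R d).
Variable lam : {measure set T -> \bar R}.
Hypothesis hlam : is_lebesgue lam.
Implicit Types (x y v : V) (g f F U chi : V -> R).
Notation itg g := (lam.-integrable [set: T] (EFin \o (g : T -> R))).
Notation "'Int' g" := (Rintegral lam [set: T] (g : T -> R)) (at level 10, g at level 8).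

Lemma test_field_opp (z : V -> V) : test_field z ->
  test_field (fun x => - z x) /\ forall x, divg (fun x => - z x) x = - divg z x.
Proof.
move=> tz; have [cz _ _] := test_field_C1 tz; case: tz => sz kz z1.
have itN (vs : seq V) : Defs.iterD vs (fun x => - z x) = (fun x => - Defs.iterD vs z x).
  elim: vs => //= v vs ->; apply/funext => x.
  by rewrite (deriveN (diff_derivable (sz vs x))).
split.
  split=> [vs x||x]; last by rewrite enormN.
    by rewrite itN; apply: differentiableN; exact: sz.
  have -> : [set x | - z x != 0] = [set x | z x != 0]; last exact: kz.
  by apply/seteqP; split=> x /=; rewrite oppr_eq0.
move=> x; rewrite /divg -sumrN; apply: eq_bigr => i _.
have -> : (fun y => (- z y) ord0 i) = (fun y => - z y ord0 i) by apply/funext => y; rewrite mxE.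
by case: (cz i) => dz _; rewrite (deriveN (diff_derivable (dz x))).
Qed.

Lemma TV_opp_le (u : V -> R) : (TV lam (fun x => (- u x)%R) <= TV lam u)%E.
Proof.
apply: ge_ereal_sup => _ [z tz <-]; have [tN dN] := test_field_opp tz.
apply: ereal_sup_ubound; exists (fun x => - z x); first exact: tN.
by apply: eq_integral => x _; rewrite dN mulrN mulNr.
Qed.

Lemma TV_opp (u : V -> R) : TV lam (fun x => - u x) = TV lam u.
Proof.
apply/eqP; rewrite eq_le TV_opp_le /=.
by have := TV_opp_le (fun x => - u x); under eq_fun do rewrite opprK.
Qed.

Lemma BV_opp (u : V -> R) : BV lam u -> BV lam (fun x => - u x).
Proof.
move=> [lu tu]; split; last by rewrite TV_opp.
by have := L1locZ (-1) lu; under eq_fun do rewrite mulN1r.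
Qed.

Variable psi : R -> R.
Hypothesis psi_scv : strictly_convex psi.
Hypothesis psi_even : forall s, psi (- s) = psi s.
Hypothesis psi0 : psi 0 = 0.

Lemma Jfun_opp f (alpha : R) (u : V -> R) :
  Jfun lam psi (fun x => - f x) alpha u = Jfun lam psi f alpha (fun x => - u x).
Proof.
rewrite /Jfun TV_opp; congr (_ + _)%E; apply: eq_integral => x _.
by rewrite opprK -[in RHS]psi_even opprD !opprK.
Qed.

(** Evenness of [psi] and symmetry of the test fields make [- u] a minimizer for [- f]; the upper
    comparison is applied at level [- s]. *)
Lemma minimizer_lower (f u : V -> R) (alpha s nu rho : R) (c : V) :
  BV lam f -> is_minimizer lam psi f alpha u -> 0 < alpha -> 0 < nu -> 0 < rho ->
  lam ([set x | f x < s + nu] `&` eball c rho : set T) = 0%E ->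
  alpha * ((d%:R + 1) * (Num.sqrt (rho ^+ 2 / 2 / 2))^-1) < psi nu / nu ->
  lam ([set x | u x < s] `&` eball c (rho / 2) : set T) = 0%E.
Proof.
move=> Bf [Bu minu] a0 nu0 rho0 fnull small.
have mN : is_minimizer lam psi (fun x => - f x) alpha (fun x => - u x).
  split; first exact: BV_opp.
  move=> v Bv; rewrite !Jfun_opp.
  have -> : (fun x => - - u x) = u by apply/funext => x; rewrite opprK.
  by apply: minu; exact: BV_opp.
have := minimizer_upper hlam psi_scv psi_even psi0 (BV_opp Bf) mN a0 nu0 rho0 (s := - s) (c := c).
have -> : [set x | - s - nu < - f x] = [set x | f x < s + nu].
  by apply/seteqP; split=> x /=; rewrite -opprD ltrN2.
have -> : [set x | - s < - u x] = [set x | u x < s].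
  by apply/seteqP; split=> x /=; rewrite ltrN2.
by apply.
Qed.

End Symmetry.

(** * Boundaries and Hausdorff distance *)

Section Boundary.
Variables (R : realType) (d : nat).
Local Notation V := 'rV[R]_d.
Local Notation T := (Rd R d).
Variable lam : {measure set T -> \bar R}.
Hypothesis hlam : is_lebesgue lam.
Implicit Types (x y v : V) (g f F U chi : V -> R).
Implicit Types (E A B G : set V).

(** Balls have finite positive measure, so [fine] loses nothing, and the ratio is below 1 exactly
    when the complement has positive measure in the ball. *)
Lemma lam_split_gt0 E x r : measurable (E : set T) -> 0 < r ->
  (0 < fine (lam (E `&` eball x r : set T)) / fine (lam (eball x r : set T)) < 1)%R <->
  (0 < lam (E `&` eball x r : set T))%E /\ (0 < lam (~` E `&` eball x r : set T))%E.
Proof.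
move=> mE r0; have mB := measurable_eball x r.
have fB := lam_eball_lty hlam x r; have pB := lam_eball_gt0 hlam x r0.
have m1 : measurable (E `&` eball x r : set T) by exact: measurableI.
have m2 : measurable (~` E `&` eball x r : set T) by apply: measurableI => //; exact: measurableC.
have f1 : (lam (E `&` eball x r : set T) < +oo)%E.
  by apply: le_lt_trans fB; rewrite le_measure ?inE//; exact: subIsetr.
have f2 : (lam (~` E `&` eball x r : set T) < +oo)%E.
  by apply: le_lt_trans fB; rewrite le_measure ?inE//; exact: subIsetr.
have add : lam (eball x r : set T) = (lam (E `&` eball x r : set T) + lam (~` E `&` eball x r : set T))%E.
  rewrite -measureU//; last by rewrite setIACA setICr set0I.
  by congr (lam _); rewrite -setIUl setUCr setTI.
move: add pB; rewrite -(@fineK _ (lam (E `&` eball x r : set T))) ?ge0_fin_numE//.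
rewrite -(@fineK _ (lam (~` E `&` eball x r : set T))) ?ge0_fin_numE//.
rewrite -(@fineK _ (lam (eball x r : set T))) ?ge0_fin_numE// -EFinD => -[].
rewrite !lte_fin /=; set a := fine _; set b := fine _; set c := fine _ => add c0.
split=> [/andP[]|[b0 c1]].
  by rewrite pmulr_lgt0 ?invr_gt0// ltr_pdivrMr// mul1r add ltrDl.
by rewrite divr_gt0//= ltr_pdivrMr// mul1r add ltrDl.
Qed.

Lemma mboundaryP E x : measurable (E : set T) ->
  mboundary lam E x <-> msupport lam E x /\ msupport lam (~` E) x.
Proof.
move=> mE; split=> [h|[h1 h2] r r0].
  by split=> r r0; have /(lam_split_gt0 x mE r0)[] := h r r0.
by apply/(lam_split_gt0 x mE r0); split; [exact: h1|exact: h2].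
Qed.

(** If the ball contained no support point, each of its points would have a neighbourhood in which
    [E] is null, and [null_local] would make [E] null in the whole ball. *)
Lemma msupport_ball E x r : measurable (E : set T) ->
  (0 < lam (E `&` eball x r : set T))%E -> exists2 y, eball x r y & msupport lam E y.
Proof.
move=> mE pos; apply: contrapT => h.
suff : lam (E `&` eball x r : set T) = 0%E by move=> e; rewrite e ltxx in pos.
apply: null_local => //; first exact: measurable_eball.
move=> y yx; apply: contrapT => h2; apply: h; exists y => // s s0.
rewrite lt0e measure_ge0 andbT; apply/eqP => e; apply: h2; by exists s.
Qed.

Lemma msupport_gt0 E x y r : measurable (E : set T) -> msupport lam E y -> eball x r y ->
  (0 < lam (E `&` eball x r : set T))%E.
Proof.
move=> mE yE yx; have s0 : 0 < r - enorm (y - x) by rewrite subr_gt0.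
apply: (lt_le_trans (yE _ s0)); rewrite le_measure ?inE//.
- by apply: measurableI => //; exact: measurable_eball.
- by apply: measurableI => //; exact: measurable_eball.
- by apply: setIS; apply: eball_sub; rewrite addrC subrK.
Qed.

(** Join a support point [y0] of [E] to a support point [y1] of the complement inside the convex
    ball, and take the last parameter [t] whose point still lies in the support of [E]. Points just
    after [t] belong to the support of the complement; both supports being closed, [g t] lies in
    both. *)
Lemma boundary_in_ball E x r : measurable (E : set T) ->
  (0 < lam (E `&` eball x r : set T))%E -> (0 < lam (~` E `&` eball x r : set T))%E ->
  exists2 y, eball x r y & mboundary lam E y.
Proof.
move=> mE p1 p2; have mCE : measurable (~` E : set T) by exact: measurableC.
have [y0 y0x y0E] := msupport_ball mE p1; have [y1 y1x y1E] := msupport_ball mCE p2.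
pose g (t : R) := y0 + t *: (y1 - y0).
have gd (t t' : R) : enorm (g t - g t') = `|t - t'| * enorm (y1 - y0).
  by rewrite /g opprD addrACA subrr add0r -scalerBl enormZ.
have gx (t : R) : 0 <= t <= 1 -> eball x r (g t).
  move=> /andP[t0 t1]; rewrite /eball/=.
  have -> : g t - x = (1 - t) *: (y0 - x) + t *: (y1 - x).
    by apply/rowP => i; rewrite !mxE; ring.
  rewrite (le_lt_trans (enormD _ _))// !enormZ (ger0_norm t0) ger0_norm ?subr_ge0//.
  move: y0x y1x; rewrite /eball/=; set a := enorm _; set b := enorm _ => h1 h2.
  have [->|tn0] := eqVneq t 0; first by rewrite subr0 mul1r mul0r addr0.
  have tp : 0 < t by rewrite lt_neqAle eq_sym tn0.
  have : t * b < t * r by rewrite ltr_pM2l.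
  have : (1 - t) * a <= (1 - t) * r by rewrite ler_wpM2l ?subr_ge0// ltW.
  by lra.
(* Closedness of the support, restricted to the segment. *)
have near_supp (F : set V) (t : R) : measurable (F : set T) ->
   (forall e, 0 < e -> exists2 t' : R, `|t' - t| < e & msupport lam F (g t')) ->
   msupport lam F (g t).
  move=> mF h s s0; have c0 : 0 < enorm (y1 - y0) + 1 by rewrite ltr_wpDl ?enorm_ge0.
  have [|t' tt' ft'] := h (s / (enorm (y1 - y0) + 1)); first by rewrite divr_gt0.
  apply: (msupport_gt0 mF ft'); rewrite /eball/= gd.
  apply: (@le_lt_trans _ _ (`|t' - t| * (enorm (y1 - y0) + 1))); first by rewrite ler_wpM2l// lerDl.
  by rewrite -ltr_pdivlMr.
pose S := [set t : R | 0 <= t <= 1 /\ msupport lam E (g t)].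
have S0 : S 0 by split; [rewrite lexx ler01|rewrite /g scale0r addr0].
have hS : has_sup S by split; [exists 0|exists 1 => t [/andP[]]].
set t := sup S.
have t0 : 0 <= t by apply: sup_upper_bound.
have t1 : t <= 1 by apply: ge_sup; [exists 0|move=> s [/andP[]]].
have tE : msupport lam E (g t).
  apply: near_supp => // e e0; have [s Ss ts] := sup_adherent e0 hS.
  exists s; last by case: Ss.
  have st : s <= t by apply: sup_upper_bound.
  by rewrite ltr_norml; apply/andP; split; move: ts; rewrite -/t; lra.
exists (g t); first by apply: gx; rewrite t0.
apply/mboundaryP => //; split=> //.
have [t1'|t1'] := eqVneq t 1; first by rewrite t1' /g scale1r addrC subrK.
apply: near_supp => // e e0.
have t1s : t < 1 by rewrite lt_neqAle t1'.
(* A parameter beyond [t], within [e] of it and still at most 1; maximality of [t] excludes its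
   point from the support of [E]. *)
pose s := t + Num.min (e / 2) (1 - t).
have m0 : 0 < Num.min (e / 2) (1 - t) by rewrite lt_min divr_gt0//= subr_gt0.
have m1 : Num.min (e / 2) (1 - t) <= e / 2 by rewrite ge_min lexx.
have m2 : Num.min (e / 2) (1 - t) <= 1 - t by rewrite ge_min lexx orbT.
exists s; first by rewrite /s addrAC subrr add0r gtr0_norm//; lra.
have sN : ~ msupport lam E (g s).
  move=> sE; have : s <= t.
    by apply: sup_upper_bound => //; split=> //; apply/andP; split; rewrite /s; lra.
  by rewrite /s; lra.
(* If the complement were null in the ball of radius [r'] around [g s], then [E] would have full
   measure in every smaller ball and [g s] would lie in its support. *)
move=> r' r'0; rewrite lt0e measure_ge0 andbT; apply/eqP => e0'.
apply: sN => r2 r20; pose m := Num.min r' r2.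
have m00 : 0 < m by rewrite lt_min r'0.
have : (0 < lam (eball (g s) m : set T))%E by exact: lam_eball_gt0.
have le1 : (lam (~` E `&` eball (g s) m : set T) <= lam (~` E `&` eball (g s) r' : set T))%E.
  rewrite le_measure ?inE//; try by apply: measurableI => //; exact: measurable_eball.
  by apply: setIS; apply: eball_sub; rewrite subrr enorm0 add0r ge_min lexx.
have le2 : (lam (E `&` eball (g s) m : set T) <= lam (E `&` eball (g s) r2 : set T))%E.
  rewrite le_measure ?inE//; try by apply: measurableI => //; exact: measurable_eball.
  by apply: setIS; apply: eball_sub; rewrite subrr enorm0 add0r ge_min lexx orbT.
have z1 : lam (~` E `&` eball (g s) m : set T) = 0%E.
  by apply/eqP; rewrite eq_le measure_ge0 andbT -e0'.
have -> : lam (eball (g s) m : set T) = lam (E `&` eball (g s) m : set T).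
  have -> : (eball (g s) m) = (E `&` eball (g s) m) `|` (~` E `&` eball (g s) m).
    by rewrite -setIUl setUCr setTI.
  rewrite measureU//; try by apply: measurableI => //; exact: measurable_eball.
    rewrite [X in (_ + X)%E]z1 adde0; congr (lam _).
    by rewrite setIUr setIA setIid setIA setICr set0I setU0.
  by rewrite setIACA setICr set0I.
by move=> /lt_le_trans; apply.
Qed.

Lemma edist_lt (A : set V) x (r : R) : (Defs.edist x A < r%:E)%E -> exists2 y, A y & enorm (x - y) < r.
Proof. by move=> /ereal_inf_lt[_ [y Ay <-]]; rewrite lte_fin; exists y. Qed.

Lemma edist_le (A : set V) x y : A y -> (Defs.edist x A <= (enorm (x - y))%:E)%E.
Proof. by move=> Ay; apply: ereal_inf_lbound; exists y. Qed.

(** A support point of [B] in the ball of radius [rho / 2] would have a support point of [A] within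
    [rho / 2], hence in the ball where [A] is null. The Hausdorff hypotheses enter only here:
    nullity passes to a shifted level at the price of half the radius. *)
Lemma dH_transfer A B x (rho : R) : measurable (A : set T) -> measurable (B : set T) ->
  (dH (msupport lam A) (msupport lam B) < (rho / 2)%:E)%E ->
  lam (A `&` eball x rho : set T) = 0%E -> lam (B `&` eball x (rho / 2) : set T) = 0%E.
Proof.
move=> mA mB hd A0; apply/eqP; rewrite -measure_le0 leNgt; apply/negP => p.
have [y yx yB] := msupport_ball mB p.
have : (Defs.edist y (msupport lam A) < (rho / 2)%:E)%E.
  apply: le_lt_trans hd; rewrite /dH le_max; apply/orP; right.
  by apply: ereal_sup_ubound; left; exists y.
move=> /edist_lt[y' y'A yy'].
suff : (0 < lam (A `&` eball x rho : set T))%E by rewrite A0 ltxx.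
apply: (msupport_gt0 mA y'A); rewrite /eball/=.
rewrite -(subrKA y) (le_lt_trans (enormD _ _))// (splitr rho) ltrD//.
by rewrite enormB.
Qed.

Lemma dH_le A B (e : R) : 0 <= e -> (forall x, A x -> (Defs.edist x B <= e%:E)%E) ->
  (forall x, B x -> (Defs.edist x A <= e%:E)%E) -> (0 <= dH A B <= e%:E)%E.
Proof.
move=> e0 h1 h2; apply/andP; split.
  by rewrite /dH le_max; apply/orP; left; apply: ereal_sup_ubound; right.
rewrite /dH ge_max; apply/andP; split; apply: ge_ereal_sup => _ [[x xA <-]|->].
- exact: h1.
- by rewrite lee_fin.
- exact: h2.
- by rewrite lee_fin.
Qed.

End Boundary.

(** * From balls without mass to convergence of boundaries *)

Section Convergence.
Variables (R : realType) (d : nat).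
Local Notation V := 'rV[R]_d.
Local Notation T := (Rd R d).
Variable lam : {measure set T -> \bar R}.
Hypothesis hlam : is_lebesgue lam.
Implicit Types (x y v : V) (g f F U chi : V -> R).
Implicit Types (E A B G : set V).

Lemma cvg0_dH (D : R -> \bar R) :
  (forall e : R, 0 < e -> \forall a \near 0^'+, (0 <= D a <= e%:E)%E) -> D @ 0^'+ --> 0%E.
Proof.
move=> h; apply/fine_cvgP; split.
  apply: filterS (h 1 ltr01) => a /andP[D0 D1].
  by rewrite ge0_fin_numE// (le_lt_trans D1)// ltry.
apply/cvgrPdist_le => e e0; apply: filterS (h e e0) => a /andP[D0 D1].
have fin : D a \is a fin_num by rewrite ge0_fin_numE// (le_lt_trans D1)// ltry.
move: D0 D1; rewrite -(fineK fin) !lee_fin /= => D0 D1.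
by rewrite sub0r normrN ger0_norm.
Qed.

Lemma symdiff_gt0 A B (C : set V) : measurable (A : set T) -> measurable (B : set T) ->
  measurable (C : set T) ->
  (lam (symdiff A B : set T) < lam (B `&` C : set T))%E -> (0 < lam (A `&` C : set T))%E.
Proof.
move=> mA mB mC h; rewrite lt0e measure_ge0 andbT; apply/eqP => e.
have m1 : measurable (A `&` C : set T) by exact: measurableI.
have m2 : measurable (symdiff A B : set T) by apply: measurableU; exact: measurableD.
have : (lam (B `&` C : set T) <= lam (A `&` C : set T) + lam (symdiff A B : set T))%E.
  apply: (@le_trans _ _ (lam ((A `&` C) `|` symdiff A B : set T))); last exact: measureU2.
  rewrite le_measure ?inE//; [exact: measurableI|exact: measurableU|].
  move=> x [Bx Cx]; have [Ax|nAx] := pselect (A x); first by left.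
  by right; right.
by rewrite e add0e leNgt h.
Qed.

(** The last hypothesis, uniform in [x], puts the boundary of [E a] near that of [G]. Convergence in
    measure gives the other half only pointwise in [x]; boundedness of [G] makes it uniform. *)
Lemma dH_cvg (E : R -> set V) G (M : R) :
  (forall a, 0 < a -> measurable (E a : set T)) -> measurable (G : set T) ->
  (forall x, G x -> `|x| <= M) ->
  (fun a => lam (symdiff (E a) G : set T)) @ 0^'+ --> 0%E ->
  (forall rho : R, 0 < rho -> exists2 a0 : R, 0 < a0 & forall a, 0 < a -> a < a0 -> forall x,
     (lam (G `&` eball x rho : set T) = 0%E ->
        exists2 r, 0 < r & lam (E a `&` eball x r : set T) = 0%E) /\
     (lam (~` G `&` eball x rho : set T) = 0%E ->
        exists2 r, 0 < r & lam (~` E a `&` eball x r : set T) = 0%E)) ->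
  (fun a => dH (mboundary lam (E a)) (mboundary lam G)) @ 0^'+ --> 0%E.
Proof.
move=> mE mG GM cv hE; apply: cvg0_dH => e e0.
have mCG : measurable (~` G : set T) by exact: measurableC.
have e2 : 0 < e / 2 by rewrite divr_gt0.
have [a0 a00 ha0] := hE e e0.
(* Every unit ball around a boundary point of [G] meets [G], so the boundary of [G] lies in [K]. *)
pose K : set V := [set x | `|x| <= `|M| + 1].
have cK : compact K.
  apply: bounded_closed_compact.
    by exists (`|M| + 1); split; [exact: num_real|move=> s /ltW h x /= /le_trans]; apply.
  have -> : K = (fun x : V => `|x|) @^-1` [set t | t <= `|M| + 1] by [].
  apply: closed_comp; last exact: closed_le.
  by move=> x _; exact: norm_continuous.
have GK x : mboundary lam G x -> K x.
  move=> /(mboundaryP hlam x mG)[+ _] => /(_ 1 ltr01) p.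
  have [y [Gy yx]] : (G `&` eball x 1) !=set0.
    by apply/set0P/eqP => h; rewrite h measure0 ltxx in p.
  have := GM _ Gy; have := norm_le_enorm (y - x); move: yx; rewrite /eball/= => h1 h2 h3.
  have : `|x| <= `|y - x| + `|y| by rewrite distrC -{1}(subrK y x) ler_normD.
  by rewrite /K/=; have := ler_norm M; lra.
pose P (a : R) (y : V) := mboundary lam G y -> (Defs.edist y (mboundary lam (E a)) <= e%:E)%E.
have cov : \forall a \near 0^'+, K `<=` P a.
  (* It suffices to find, for each [x] in [K], a neighbourhood of [x] and a range of [a] that work
     together. If [G] or its complement is null in the ball of radius [e / 2] around [x], that ball
     contains no boundary point of [G] and there is nothing to show. *)
  apply: (iffLR (compact_near_coveringP K) cK) => x Kx.
  have [[p1 p2]|np] := pselect ((0 < lam (G `&` eball x (e / 2) : set T))%E /\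
                                (0 < lam (~` G `&` eball x (e / 2) : set T))%E); last first.
    exists (eball x (e / 2), setT) => /=; first by split; [exact: nbhs_eball|exact: filterT].
    move=> [y a] [/= yx _] /(mboundaryP hlam y mG)[h1 h2]; exfalso; apply: np.
    by split; [exact: (msupport_gt0 mG h1 yx)|exact: (msupport_gt0 mCG h2 yx)].
  (* Once the symmetric difference has measure below [m], both [E a] and its complement keep mass in
     the ball, which then contains a boundary point of [E a]. *)
  pose m := mine (lam (G `&` eball x (e / 2) : set T)) (lam (~` G `&` eball x (e / 2) : set T)).
  have mB := measurable_eball x (e / 2).
  have mfin : m \is a fin_num.
    rewrite ge0_fin_numE; last by rewrite le_min !measure_ge0.
    rewrite gt_min; apply/orP; left; apply: le_lt_trans (lam_eball_lty hlam x (e / 2)).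
    rewrite le_measure ?inE//; first exact: measurableI.
  have m0 : 0 < fine m.
    by rewrite -lte_fin fineK// lt_min p1.
  have ev : \forall a \near 0^'+, (lam (symdiff (E a) G : set T) < m)%E.
    have /fine_cvgP[fin /cvgrPdist_lt/(_ _ m0) h] := cv.
    apply: filterS2 fin h => a fa; rewrite sub0r normrN => h.
    rewrite -(fineK fa) -(fineK mfin) lte_fin.
    exact: le_lt_trans (ler_norm _) h.
  exists (eball x (e / 2), [set a | 0 < a /\ (lam (symdiff (E a) G : set T) < m)%E]) => /=.
    split; first exact: nbhs_eball.
    by apply: filterI ev; exact: nbhs_right_gt.
  move=> [y a] [/= yx [a1 hm]] _.
  have mEa := mE a a1; have mCE : measurable (~` E a : set T) by exact: measurableC.
  have q1 : (0 < lam (E a `&` eball x (e / 2) : set T))%E.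
    by apply: (symdiff_gt0 mEa mG mB); apply: lt_le_trans hm _; rewrite ge_min lexx.
  have q2 : (0 < lam (~` E a `&` eball x (e / 2) : set T))%E.
    apply: (symdiff_gt0 mCE mCG mB).
    have -> : symdiff (~` E a) (~` G) = symdiff (E a) G.
      rewrite /symdiff !setDE !setCK setUC; congr (_ `|` _); exact: setIC.
    by apply: lt_le_trans hm _; rewrite ge_min lexx orbT.
  have [y' y'x y'E] := boundary_in_ball hlam mEa q1 q2.
  apply: (le_trans (edist_le y y'E)); rewrite lee_fin ltW//.
  rewrite -(subrKA x) (le_lt_trans (enormD _ _))// (splitr e) ltrD//.
  by rewrite enormB.
near=> a.
have a1 : 0 < a by near: a; exact: nbhs_right_gt.
have a2 : a < a0 by near: a; exact: nbhs_right_lt.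
have Ka : K `<=` P a by near: a.
apply: dH_le; first exact: ltW.
  move=> x /(mboundaryP hlam x (mE a a1))[xE xCE].
  rewrite leNgt; apply/negP => far.
  (* With no boundary point of [G] in the ball, [G] or its complement is null there; the hypothesis
     then removes [x] from the support of [E a] or of its complement. *)
  have nob : ~ (exists2 y, eball x e y & mboundary lam G y).
    move=> [y yx yG]; have := lt_le_trans far (edist_le x yG).
    by rewrite lte_fin enormB ltNge (ltW yx).
  have [h1 h2] := ha0 a a1 a2 x.
  have [z1|n1] := eqVneq (lam (G `&` eball x e : set T)) 0%E.
    by have [r r0 hr] := h1 z1; have := xE r r0; rewrite hr ltxx.
  have [z2|n2] := eqVneq (lam (~` G `&` eball x e : set T)) 0%E.
    by have [r r0 hr] := h2 z2; have := xCE r r0; rewrite hr ltxx.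
  apply: nob; apply: (boundary_in_ball hlam mG); by rewrite lt0e measure_ge0 andbT.
by move=> x xG; apply: (Ka x (GK x xG)).
Unshelve. all: by end_near. Qed.

End Convergence.

(** Both signs of the shift are controlled at once, since which of them is used depends on the sign
    of [s]. The bound [b] will be [|s|], so that the shifted level stays on the same branch of
    [levelset]. *)
Lemma cvg0_dnbhs_pick (R : realType) (D : R -> \bar R) (r b : R) : D @ 0^' --> 0%E ->
  0 < r -> 0 < b -> exists2 n : R, 0 < n < b & (D n < r%:E)%E /\ (D (- n)%R < r%:E)%E.
Proof.
move=> /fine_cvgP[fin /cvgrPdist_lt h] r0 b0.
have : \forall t \near 0^', (D t < r%:E)%E.
  apply: filterS2 fin (h r r0) => t ft; rewrite sub0r normrN => ht.
  by rewrite -(fineK ft) lte_fin; exact: le_lt_trans (ler_norm _) ht.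
move=> [e /= e0 he]; pose n := Num.min e b / 2.
have m0 : 0 < Num.min e b by rewrite lt_min e0.
have n0 : 0 < n by rewrite divr_gt0.
have ne : n < e by rewrite /n ltr_pdivrMr// gt_min; apply/orP; left; lra.
have nb : n < b by rewrite /n ltr_pdivrMr// gt_min; apply/orP; right; lra.
exists n; first by rewrite n0.
split; apply: he => /=.
- by rewrite sub0r normrN gtr0_norm.
- by rewrite gt_eqF.
- by rewrite opprK add0r gtr0_norm.
- by rewrite oppr_eq0 gt_eqF.
Qed.

Theorem theorem1p3 (R : realType) (d : nat) (lam : {measure set Rd R d -> \bar R})
  (psi : R -> R) (f : 'rV[R]_d -> R) (u : R -> 'rV[R]_d -> R) (s : R) :
  (2 <= d)%N ->
  is_lebesgue lam ->
  assumptionA d psi ->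
  BV lam f ->
  (exists r : R, forall x, r < enorm x -> f x = 0) ->
  (forall alpha : R, 0 < alpha -> is_minimizer lam psi f alpha (u alpha)) ->
  s != 0 ->
  (fun alpha => lam (symdiff (levelset (u alpha) s) (levelset f s) : set (Rd R d)))
    @ 0^'+ --> 0%E ->
  (fun nu => dH (msupport lam (levelset f s)) (msupport lam (levelset f (s + nu))))
    @ 0^' --> 0%E ->
  (fun nu => dH (msupport lam (~` levelset f s)) (msupport lam (~` levelset f (s + nu))))
    @ 0^' --> 0%E ->
  (fun alpha => dH (mboundary lam (levelset (u alpha) s)) (mboundary lam (levelset f s)))
    @ 0^'+ --> 0%E.
Proof.
move=> _ hlam [scv ev psi0 _ _] Bf [r0 fr0] minu s0 cv cv1 cv2.
have mlevel (g : 'rV[R]_d -> R) t : measurable_fun [set: Rd R d] (g : Rd R d -> R) ->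
    measurable (levelset g t : set (Rd R d)).
  move=> mg; rewrite /levelset; case: ifP => _; rewrite -[X in measurable X]setTI.
    by rewrite -preimage_itvoy; apply: mg => //; exact: measurable_itv.
  by rewrite -preimage_itvNyo; apply: mg => //; exact: measurable_itv.
have mf := Bf.1.1.
have mu a : 0 < a -> measurable_fun [set: Rd R d] (u a : Rd R d -> R).
  by move=> /minu[[[]]].
apply: (@dH_cvg _ _ lam hlam (fun a => levelset (u a) s) (levelset f s) r0) => //.
- by move=> a a0; apply: mlevel; exact: mu.
- exact: mlevel.
(* Outside the support [f x = 0], and 0 lies in no level set with [s != 0]; this bounds the level
   set of [f]. *)
- move=> x; apply: contraPP => /negP; rewrite -ltNge => xr.
  have fx : f x = 0 by apply: fr0; exact: lt_le_trans xr (norm_le_enorm x).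
  by rewrite /levelset; case: ifPn => s1 /=; rewrite fx; [apply/negP; rewrite -leNgt ltW|apply/negP].
move=> rho rho0.
have rho2 : 0 < rho / 2 by rewrite divr_gt0.
have as0 : 0 < `|s| by rewrite normr_gt0.
have [n1 /andP[n10 n1s] [d1 d1']] := cvg0_dnbhs_pick cv1 rho2 as0.
have [n2 /andP[n20 n2s] [d2 d2']] := cvg0_dnbhs_pick cv2 rho2 as0.
(* For the complement the shift [n2] is split: one half is the gap in the comparison, the other
   moves the level past [s], because a strict inequality for [u] has to cover the non-strict one
   defining the complement. *)
have n22 : 0 < n2 / 2 by rewrite divr_gt0.
(* The divergence bound at radius [rho / 2], the radius left after [dH_transfer]; the comparison
   halves it once more. *)
pose C : R := (d%:R + 1) * (Num.sqrt ((rho / 2) ^+ 2 / 2 / 2))^-1.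
have C0 : 0 < C.
  rewrite mulr_gt0 ?ltr_wpDl// invr_gt0 sqrtr_gt0 !divr_gt0// exprn_gt0//.
have k1 : 0 < psi n1 / n1 by rewrite divr_gt0// psi_gt0// gt_eqF.
have k2 : 0 < psi (n2 / 2) / (n2 / 2) by rewrite divr_gt0// psi_gt0// gt_eqF.
exists (Num.min (psi n1 / n1 / C) (psi (n2 / 2) / (n2 / 2) / C)).
  by rewrite lt_min; apply/andP; split; apply: divr_gt0.
move=> a a0; rewrite lt_min => /andP[a1 a2] x.
rewrite ltr_pdivlMr// in a1; rewrite ltr_pdivlMr// in a2.
have minua := minu a a0.
have rho4 : 0 < rho / 2 / 2 by rewrite divr_gt0.
have sub0 (A B : set 'rV[R]_d) : measurable (A : set (Rd R d)) -> measurable (B : set (Rd R d)) ->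
    A `<=` B -> forall r, lam (B `&` eball x r : set (Rd R d)) = 0%E ->
    lam (A `&` eball x r : set (Rd R d)) = 0%E.
  move=> mA mB AB r h; apply/eqP; rewrite -measure_le0 -h le_measure ?inE//.
  - by apply: measurableI => //; exact: measurable_eball.
  - by apply: measurableI => //; exact: measurable_eball.
  - exact: setSI.
have mlt (g : 'rV[R]_d -> R) t : measurable_fun [set: Rd R d] (g : Rd R d -> R) ->
    measurable ([set y | g y < t] : set (Rd R d)).
  move=> mg; rewrite -[X in measurable X]setTI -preimage_itvNyo.
  by apply: mg => //; exact: measurable_itv.
have mgt (g : 'rV[R]_d -> R) t : measurable_fun [set: Rd R d] (g : Rd R d -> R) ->
    measurable ([set y | t < g y] : set (Rd R d)).
  move=> mg; rewrite -[X in measurable X]setTI -preimage_itvoy.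
  by apply: mg => //; exact: measurable_itv.
have mC (g : 'rV[R]_d -> R) t : measurable_fun [set: Rd R d] (g : Rd R d -> R) ->
    measurable (~` levelset g t : set (Rd R d)) by move=> mg; apply: measurableC; exact: mlevel.
have mua := mu a a0.
have [s1|s1] := ltP 0 s.
  have sn1 : 0 < s - n1 by rewrite subr_gt0 -(gtr0_norm s1).
  have sn2 : 0 < s + n2 by rewrite addr_gt0.
  split=> G0; exists (rho / 2 / 2) => //.
    have := dH_transfer (mlevel f s mf) (mlevel f (s - n1) mf) d1' G0.
    rewrite /levelset sn1 s1 => F0.
    exact: (minimizer_upper hlam scv ev psi0 Bf minua a0 n10 rho2 F0 a1).
  have := dH_transfer (mC f s mf) (mC f (s + n2) mf) d2 G0 => F0.
  (* The set where [f < s + n2] lies in the complement of the level set at [s + n2]; it is written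
     as level [s + n2 / 2] plus gap [n2 / 2]. *)
  have F1 : lam ([set y | f y < (s + n2 / 2) + n2 / 2] `&` eball x (rho / 2) : set (Rd R d)) = 0%E.
    apply: sub0 F0 => //; [exact: mlt|exact: mC|].
    move=> y /=; rewrite /levelset sn2 -addrA -splitr => h; apply/negP.
    by rewrite -leNgt ltW.
  apply: sub0 (minimizer_lower hlam scv ev psi0 Bf minua a0 n22 rho2 F1 a2) => //; [exact: mC|exact: mlt|].
  move=> y /=; rewrite /levelset s1 => /negP; rewrite -leNgt => h.
  by rewrite (le_lt_trans h)// ltrDl.
(* For negative levels the sets are sublevel sets, so both the signs of the shifts and the upper and
   lower comparisons trade places. *)
have s2 : s < 0 by rewrite lt_neqAle s0.
have sn1 : (0 < s + n1) = false by apply/negbTE; rewrite -leNgt; move: n1s; rewrite ltr0_norm//; lra.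
have sn2 : (0 < s - n2) = false by apply/negbTE; rewrite -leNgt; lra.
have s3 : (0 < s) = false by apply/negbTE; rewrite -leNgt.
split=> G0; exists (rho / 2 / 2) => //.
  have := dH_transfer (mlevel f s mf) (mlevel f (s + n1) mf) d1 G0.
  rewrite /levelset sn1 s3 => F0.
  exact: (minimizer_lower hlam scv ev psi0 Bf minua a0 n10 rho2 F0 a1).
have := dH_transfer (mC f s mf) (mC f (s - n2) mf) d2' G0 => F0.
have F1 : lam ([set y | (s - n2 / 2) - n2 / 2 < f y] `&` eball x (rho / 2) : set (Rd R d)) = 0%E.
  apply: sub0 F0 => //; [exact: mgt|exact: mC|].
  move=> y /=; rewrite /levelset sn2 -addrA -opprD -splitr => h; apply/negP.
  by rewrite -leNgt ltW.
apply: sub0 (minimizer_upper hlam scv ev psi0 Bf minua a0 n22 rho2 F1 a2) => //; [exact: mC|exact: mgt|].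
move=> y /=; rewrite /levelset s3 => /negP; rewrite -leNgt => h.
by rewrite (lt_le_trans _ h)// ltrBlDr ltrDl.
Qed.
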